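(* Let $\mathcal M$ be a mixture of $k+k'$ distributions $D_1,\dots,D_k,D_1',\dots,D_{k'}'$ over $\mathbb{R}^d$ with means $\mu_1,\dots,\mu_k,\mu_1',\dots,\mu_{k'}'$ and weights $w_1,\dots,w_k,w_1',\dots,w_{k'}'$ with $\sum_j w_j+\sum_j w_j'=1$. Assume (1) $D_1,\dots,D_k$ are the translates $D(\mu_1),\dots,D(\mu_k)$ of a distribution $D$ over $\mathbb{R}^d$ satisfying SFD, i.e. there are constants $c_1,c_2\ge0$ with $\inf_{t:\|t\|_2\le T}|\phi_D(t)|\gtrsim d^{-c_1}T^{-c_2}$ for all $T\ge 1$; and (2) $D_1',\dots,D_{k'}'$ satisfy FFD, i.e. there are constants $c_1',c_2'\ge0$ with $\sup_{t:\|t\|_2\ge T}|\phi_{D_j'}(t)|\lesssim d^{-c_1'}T^{-c_2'}$ for all $j\in[k']$ (where $\phi_{D_j'}$ is the characteristic function of the centered version of $D_j'$, so that $\phi_{D_j'(\mu_j')}(t)=e^{i\langle t,\mu_j'\rangle}\phi_{D_j'}(t)$), with $c_2'>c_2$. Let $\gamma=\min_{j\neq j'\in[k]}\|\mu_j-\mu_{j'}\|_2>0$, $w_{\min}=\min_{j\in[k]}w_j$, $B=\max_{j\in[k]}\|\mu_j\|_2$. There is an algorithm that given $\varepsilon,\delta\in(0,1)$ and $n$ i.i.d. samples from $\mathcal M$ outputs $\{(\widehat w_j,\widehat\mu_j)\}_{j\in[k]}$ such that with probability at least $1-\delta$ there is a permutation $\pi$ of $[k]$ with $$\max_{j\in[k]}\|\mu_j-\widehat\mu_{\pi(j)}\|_2\le\varepsilon,\qquad\max_{j\in[k]}|w_j-\widehat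 w_{\pi(j)}|\le\varepsilon.$$ The sample complexity is $n=\mathrm{poly}_{c_1,c_2,c_1',c_2'}(d,1/\gamma,B,1/w_{\min},1/\varepsilon)\log(1/\delta)$ and the running time is $\mathrm{poly}(n)$.
   Context: $\phi_P(t)=\mathbb{E}_{X\sim P}[e^{i\langle t,X\rangle}]$ denotes the characteristic function. For a centered distribution $P$, $P(\mu)$ denotes the law of $X+\mu$, $X\sim P$. The symbols $\gtrsim,\lesssim$ hide absolute positive constants; $\mathrm{poly}_{c_1,c_2,c_1',c_2'}$ denotes a polynomial whose degree depends on these constants.
   Formalization: The distribution D is taken as known: the algorithm may evaluate its characteristic function at unit cost (with D unknown the means are not identifiable). The factor log(1/δ) is read as max(1, log(1/δ)), since as δ→1 the literal factor would allow a single sample. *)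

(* Defs.v *)
From HB Require Import structures.
From mathcomp Require Import all_boot all_order all_algebra perm.
From mathcomp Require Import all_classical all_reals all_analysis.
From mathcomp.real_closed Require Import complex.
From mathcomp Require mpoly.

Set Implicit Arguments.
Unset Strict Implicit.
Unset Printing Implicit Defensive.

Import Order.TTheory GRing.Theory Num.Theory.
Import numFieldNormedType.Exports.
(* The notations of mpoly clash with those of the analysis library. *)
Import -(notations) mpoly.

Local Open Scope classical_set_scope.
Local Open Scope ring_scope.

(** * Distributions on R^d *)

(* R^d with its Borel sigma-algebra; the open sets of 'rV[R]_d in the library
   (sup-norm topology) are the usual ones. *)
Definition borelRd (R : realType) (d : nat) :=
  g_sigma_algebraType (@open ('rV[R]_d : topologicalType)).

Section Distributions.
Context {R : realType} {d : nat}.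
Implicit Types (x t v : 'rV[R]_d) (P : probability (borelRd R d) R).

Definition dotp t x : R := \sum_(i < d) t 0 i * x 0 i.

(* The library's norm `|x| on 'rV is the sup norm. *)
Definition norm2 x : R := Num.sqrt (dotp x x).

Definition charfun P t : R[i] :=
  ((\int[P]_x cos (dotp t x)) +i* (\int[P]_x sin (dotp t x)))%C.

Definition cmod (z : R[i]) : R := ComplexField.Normc.normc z.

Definition centered P : Prop := forall i : 'I_d,
  P.-integrable setT (fun x : 'rV[R]_d => (x 0 i)%:E) /\
  \int[P]_x (x : 'rV[R]_d) 0 i = 0.

(* P(v), the law of X + v for X ~ P *)
Definition translate P v : set (borelRd R d) -> \bar R :=
  pushforward P ((fun x => x + v) : borelRd R d -> borelRd R d).

(* a and A are the absolute constants hidden in the symbols \gtrsim and \lesssim. *)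
Definition SFD (a c1 c2 : R) P : Prop := forall T : R, 1 <= T ->
  a * d%:R `^ (- c1) * T `^ (- c2)
    <= inf [set cmod (charfun P t) | t in [set t | norm2 t <= T]].

Definition FFD (A c1 c2 : R) P : Prop := forall T : R, 1 <= T ->
  sup [set cmod (charfun P t) | t in [set t | T <= norm2 t]]
    <= A * d%:R `^ (- c1) * T `^ (- c2).

Definition mixture k k' (D : probability (borelRd R d) R)
    (D' : 'I_k' -> probability (borelRd R d) R)
    (mu : 'I_k -> 'rV[R]_d) (mu' : 'I_k' -> 'rV[R]_d)
    (w : 'I_k -> R) (w' : 'I_k' -> R) : set (borelRd R d) -> \bar R :=
  fun S => (\sum_(j < k) (w j)%:E * translate D (mu j) S +
            \sum_(j < k') (w' j)%:E * translate (D' j) (mu' j) S)%E.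

(* The minimum over the empty range, for k = 1, is +oo, and then 1/gamma,
   read as fine gamma^-1, is 0. *)
Definition separation k (mu : 'I_k -> 'rV[R]_d) : \bar R :=
  \big[Order.min/+oo%E]_(p : 'I_k * 'I_k | p.1 != p.2)
     (norm2 (mu p.1 - mu p.2))%:E.

(* Used with weights at most 1, so that the unit 1 is harmless. *)
Definition min_weight k (w : 'I_k -> R) : R := \big[Order.min/1]_(j < k) w j.

Definition max_norm k (mu : 'I_k -> 'rV[R]_d) : R :=
  \big[Order.max/0]_(j < k) norm2 (mu j).

(* The X_i are i.i.d. of law Q, the U_j are i.i.d. uniform on [0, 1], and the
   two families are independent of each other: the joint law of the X_i and of
   any finite number of the U_j is the product law. *)
Definition iid_with_uniforms n (dO : measure_display) (Omega : measurableType dO)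
    (Pr : probability Omega R) (Q : set (borelRd R d) -> \bar R)
    (X : 'I_n -> {RV Pr >-> borelRd R d}) (U : nat -> {RV Pr >-> R}) : Prop :=
  forall (m : nat) (S : 'I_n -> set (borelRd R d)) (V : 'I_m -> set R),
    (forall i, measurable (S i)) -> (forall j, measurable (V j)) ->
    Pr [set o | (forall i, S i (X i o)) /\ (forall j, V j (U j o))] =
    (\prod_(i < n) Q (S i) * \prod_(j < m) uniform_prob (@ltr01 R) (V j))%E.

End Distributions.

(** * Algorithms *)

(* A real RAM: a memory of natural numbers (used for control and addressing), a
   memory of exact real numbers with unit-cost arithmetic, comparisons and
   elementary functions, indirect addressing, a source of independent uniform
   reals, and an oracle for the known characteristic function.  A program is a
   finite text that does not depend on R, on the dimensions or on the input. *)

Inductive iexp : Type :=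
| IConst of nat
| ILoad of iexp
| IAdd of iexp & iexp
| ISub of iexp & iexp
| IMul of iexp & iexp.

Inductive unary_op : Type := Sqrt | Exp | Ln | Cos | Sin | Atan.

Inductive rexp : Type :=
| RLoad of iexp
| RNat of iexp
| RAdd of rexp & rexp
| RSub of rexp & rexp
| RMul of rexp & rexp
| RDiv of rexp & rexp
| RFun of unary_op & rexp.

Inductive test : Type :=
| ILe of iexp & iexp
| RLe of rexp & rexp
| Not of test.

Inductive program : Type :=
| Skip
| ISet of iexp & iexp
| RSet of iexp & rexp
| Draw of iexp
| Query of iexp & iexp
| Seq of program & program
| If of test & program & program
| While of test & program.

Section Semantics.
Context {R : realType}.

Record state := State {
  imem : nat -> nat;
  rmem : nat -> R;
  drawn : nat  (* number of uniform reals consumed so far *)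
}.

Fixpoint ieval (s : state) (e : iexp) : nat :=
  match e with
  | IConst c => c
  | ILoad e1 => imem s (ieval s e1)
  | IAdd e1 e2 => (ieval s e1 + ieval s e2)%N
  | ISub e1 e2 => (ieval s e1 - ieval s e2)%N
  | IMul e1 e2 => (ieval s e1 * ieval s e2)%N
  end.

Definition unary_eval (o : unary_op) : R -> R :=
  match o with
  | Sqrt => Num.sqrt
  | Exp => expR
  | Ln => @ln R
  | Cos => cos
  | Sin => sin
  | Atan => atan
  end.

Fixpoint reval (s : state) (e : rexp) : R :=
  match e with
  | RLoad e1 => rmem s (ieval s e1)
  | RNat e1 => (ieval s e1)%:R
  | RAdd e1 e2 => reval s e1 + reval s e2
  | RSub e1 e2 => reval s e1 - reval s e2
  | RMul e1 e2 => reval s e1 * reval s e2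
  | RDiv e1 e2 => reval s e1 / reval s e2
  | RFun o e1 => unary_eval o (reval s e1)
  end.

Fixpoint teval (s : state) (b : test) : bool :=
  match b with
  | ILe e1 e2 => (ieval s e1 <= ieval s e2)%N
  | RLe e1 e2 => reval s e1 <= reval s e2
  | Not b1 => ~~ teval s b1
  end.

Definition iset (s : state) (a v : nat) : state :=
  State [eta imem s with a |-> v] (rmem s) (drawn s).

Definition rset (s : state) (a : nat) (v : R) : state :=
  State (imem s) [eta rmem s with a |-> v] (drawn s).

Definition draw (u : nat -> R) (s : state) (a : nat) : state :=
  State (imem s) [eta rmem s with a |-> u (drawn s)] (drawn s).+1.

(* exec phi u c s t s' is deterministic in s: started in s, with oracle phi and random tape u, the
   program c halts in s' after exactly t steps.  An expression has a size fixed
   by the program text, so each basic instruction and each test counts as one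
   step.  [Query a b] reads a frequency of R^d in the real cells a, ..., a+d-1
   and writes the real and imaginary parts of phi there in cells b and b+1. *)
Inductive exec (d : nat) (phi : 'rV[R]_d -> R[i]) (u : nat -> R) :
    program -> state -> nat -> state -> Prop :=
| exec_Skip s : exec phi u Skip s 1 s
| exec_ISet a e s : exec phi u (ISet a e) s 1 (iset s (ieval s a) (ieval s e))
| exec_RSet a e s : exec phi u (RSet a e) s 1 (rset s (ieval s a) (reval s e))
| exec_Draw a s : exec phi u (Draw a) s 1 (draw u s (ieval s a))
| exec_Query a b s :
    let z := phi (\row_(l < d) rmem s (ieval s a + l)%N) in
    exec phi u (Query a b) s 1
      (rset (rset s (ieval s b) (complex.Re z)) (ieval s b).+1 (complex.Im z))
| exec_Seq c1 c2 s s1 s2 t1 t2 :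
    exec phi u c1 s t1 s1 -> exec phi u c2 s1 t2 s2 ->
    exec phi u (Seq c1 c2) s (t1 + t2)%N s2
| exec_If b c1 c2 s s1 t :
    exec phi u (if teval s b then c1 else c2) s t s1 ->
    exec phi u (If b c1 c2) s t.+1 s1
| exec_While_false b c s :
    ~~ teval s b -> exec phi u (While b c) s 1 s
| exec_While_true b c s s1 s2 t1 t2 :
    teval s b -> exec phi u c s t1 s1 -> exec phi u (While b c) s1 t2 s2 ->
    exec phi u (While b c) s (t1 + t2).+1 s2.

(* The input consists of n, d, k in the natural memory and of epsilon, delta and
   the samples, one after the other, in the real memory. *)
Definition input (n d k : nat) (eps delta : R) (x : 'I_n -> 'rV[R]_d) : state :=
  State (nth 0%N [:: n; d; k])
        (nth 0 ([:: eps; delta] ++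
                [seq x i 0 l | i <- enum 'I_n, l <- enum 'I_d]))
        0.

(* The output is read in the real memory: first the k weights, then the k means,
   one after the other. *)
Definition out_weight k (s : state) (j : 'I_k) : R := rmem s j.

Definition out_mean d k (s : state) (j : 'I_k) : 'rV[R]_d :=
  \row_(l < d) rmem s (k + j * d + l)%N.

End Semantics.

Definition accurate (R : realType) (d k : nat) (eps : R)
    (mu : 'I_k -> 'rV[R]_d) (w : 'I_k -> R)
    (muhat : 'I_k -> 'rV[R]_d) (what : 'I_k -> R) : Prop :=
  exists s : {perm 'I_k},
    \big[Order.max/0]_(j < k) norm2 (mu j - muhat (s j)) <= eps /\
    \big[Order.max/0]_(j < k) `|w j - what (s j)| <= eps.

(* mmeasure mdeg p is the library's msize p, that is, 1 + the degree. *)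
Definition total_degree (R : realType) (p : mpoly 5 R) : nat :=
  (mmeasure mdeg p).-1.

(* A sample-size polynomial, evaluated at (d, 1/gamma, B, 1/w_min, 1/eps) *)
Definition sample_poly (R : realType) (p : mpoly 5 R) (d k : nat)
    (mu : 'I_k -> 'rV[R]_d) (w : 'I_k -> R) (eps : R) : R :=
  meval
    (nth 0 [:: d%:R; fine (separation mu)^-1%E; max_norm mu;
               (min_weight w)^-1; eps^-1]) p.

(* Main.v *)
(* At frequencies t of norm between T and T N^5, the SFD lower bound allows one
   to divide the empirical characteristic function by phi_D, and the FFD
   components are, since c2' > c2 and T is a large power of N, polynomially
   smaller than phi_D: the quotient is sum_j w_j exp(i <t, mu_j>) up to a
   polynomially small error.  Along t = h (L1 + s) v, s < L, with v a random
   integer direction for which the <v, mu_j> are well separated, multiplying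
   by exp(-i h (L1 + s) x) and averaging over s (a Dirichlet kernel) gives w_j
   in modulus near x = <v, mu_j> and almost nothing away from these points.
   The peaks over a grid of x give the weights, and shifting the frequency by
   h e_l multiplies the value at a peak by exp(i h mu_jl), hence the means.  All
   parameters are powers of an integer N that the program reads off n and
   delta. *)

Require Import Defs.
From mathcomp Require Import all_boot all_order all_algebra perm.
From mathcomp Require Import all_classical all_reals all_analysis.
From mathcomp Require Import measurable_realfun ring lra zify.
From mathcomp.real_closed Require Import complex.
From mathcomp Require mpoly.

Set Implicit Arguments.
Unset Strict Implicit.
Unset Printing Implicit Defensive.

Import Order.TTheory GRing.Theory Num.Theory.
Import numFieldNormedType.Exports.

Local Open Scope classical_set_scope.
Local Open Scope ring_scope.

(** * Characters and one-dimensional deconvolution *)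

Section UnitCircle.
Context {R : realType}.
Implicit Types (x y a b : R) (z : R[i]).

(** The program knows none of gamma, B and w_min; the integer N stands for all scales. It is the
    largest integer whose m-th power is at most n, also after multiplication by ln(1/delta), and the
    sample-size polynomial pushes N above d, 1/gamma, B, 1/w_min, 1/eps and a constant K that
    absorbs a and A. Conversely, N^m <= n keeps the running time polynomial in n. The program cannot
    test whether a direction separates the projections. It looks at the number of peaks instead: k
    separated peaks, each near a projection, already force the k projections apart by counting, and
    then all estimates are accurate. Separation only guarantees that some round reaches k peaks, so
    the program stops at the first such round, without any vote. All rounds share one sample. The
    empirical characteristic function is therefore controlled on the whole lattice h {0, ...,
    N^(b+12)}^d, which contains every frequency that a direction can produce. The logarithm of its
    cardinality is polynomial in N, which the choice of m pays for in Chernoff's bound. *)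

Definition cis x : R[i] := (cos x +i* sin x)%C.

Lemma cmodM z1 z2 : cmod (z1 * z2) = cmod z1 * cmod z2.
Proof. exact: ComplexField.Normc.normcM. Qed.

Lemma cmodD z1 z2 : cmod (z1 + z2) <= cmod z1 + cmod z2.
Proof. exact: le_normcD. Qed.

Lemma cmodN z : cmod (- z) = cmod z.
Proof. exact: normcN. Qed.

Lemma cmodB z1 z2 : cmod (z1 - z2) <= cmod z1 + cmod z2.
Proof. by rewrite -(cmodN z2); exact: cmodD. Qed.

Lemma cmodV z : cmod z^-1 = (cmod z)^-1.
Proof. exact: ComplexField.Normc.normcV. Qed.

Lemma cmod0 : cmod (0 : R[i]) = 0.
Proof. exact: ComplexField.Normc.normc0. Qed.

Lemma cmod_ge0 z : 0 <= cmod z.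
Proof. by case: z => a b; rewrite /cmod /= sqrtr_ge0. Qed.

Lemma cmod_eq0 z : (cmod z == 0) = (z == 0).
Proof.
apply/eqP/eqP=> [/ComplexField.Normc.eq0_normc //|->]; exact: cmod0.
Qed.

Lemma cmod_cis x : cmod (cis x) = 1.
Proof. by rewrite /cmod /= cos2Dsin2 sqrtr1. Qed.

Lemma cmod_real a : cmod a%:C%C = `|a|.
Proof. by rewrite /cmod /= expr0n /= addr0 sqrtr_sqr. Qed.

Lemma cmod_sum (I : Type) (r : seq I) (P : pred I) (F : I -> R[i]) :
  cmod (\sum_(i <- r | P i) F i) <= \sum_(i <- r | P i) cmod (F i).
Proof.
elim/big_rec2: _ => [|i u v _ IH]; first by rewrite cmod0.
exact: le_trans (cmodD _ _) (lerD _ _).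
Qed.

Lemma cmodDl z1 z2 : cmod z1 - cmod z2 <= cmod (z1 + z2).
Proof.
by rewrite lerBlDr -{1}(addrK z2 z1); exact: cmodB.
Qed.

Lemma ler_dist_cmod z1 z2 : `|cmod z1 - cmod z2| <= cmod (z1 - z2).
Proof.
have h1 : cmod z2 <= cmod z1 + cmod (z1 - z2).
  by rewrite -{1}(subKr z1 z2) cmodB.
have h2 : cmod z1 <= cmod (z1 - z2) + cmod z2.
  by rewrite -{1}(subrK z2 z1) cmodD.
by rewrite ler_norml; lra.
Qed.

Lemma Im_le_cmod z : `|complex.Im z| <= cmod z.
Proof.
case: z => a b; rewrite /cmod /= -[`|b|]sqrtr_sqr ler_sqrt.
  by rewrite lerDr sqr_ge0.
by rewrite addr_ge0 ?sqr_ge0.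
Qed.

Lemma cmod_le_ReIm z : cmod z <= `|complex.Re z| + `|complex.Im z|.
Proof.
case: z => a b; rewrite /cmod /=.
rewrite -[leRHS]ger0_norm ?addr_ge0 // -sqrtr_sqr ler_sqrt ?sqr_ge0 //.
by rewrite sqrrD !real_normK ?num_real // lerD2r lerDl mulrn_wge0 // mulr_ge0.
Qed.

Lemma cisD x y : cis (x + y) = cis x * cis y.
Proof. by rewrite /cis cosD sinD; simpc; congr (_ +i* _)%C; ring. Qed.

Lemma cis0 : cis 0 = 1.
Proof. by rewrite /cis cos0 sin0. Qed.

Lemma cisMn x n : cis (n%:R * x) = cis x ^+ n.
Proof.
elim: n => [|n IH]; first by rewrite mul0r cis0 expr0.
by rewrite -natr1 mulrDl mul1r cisD IH exprSr.
Qed.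

(** The derivative is bounded only on the symmetric interval spanned by [a] and [b], because
    [sin t - t] has a small derivative only near 0. *)
Lemma mean_value_lipschitz (f df : R -> R) (c a b : R) :
  (forall x, is_derive x 1 f (df x)) ->
  (forall x, `|x| <= Num.max `|a| `|b| -> `|df x| <= c) ->
  `|f b - f a| <= c * `|b - a|.
Proof.
move=> fd dfc.
wlog ab : a b dfc / a <= b => [H|].
  have [ab|/ltW ba] := leP a b; first exact: H.
  by rewrite distrC (distrC b); apply: H => // x; rewrite maxC; apply: dfc.
have fc : {within `[a, b], continuous f}.
  apply: derivable_within_continuous => x _.
  exact: (@ex_derive _ _ _ _ _ _ _ (fd x)).
have [d dab ->] := MVT_segment ab (fun x _ => fd x) fc.
rewrite normrM ler_wpM2r //; apply: dfc.
move: dab; rewrite in_itv /= => /andP[ad db].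
rewrite ler_norml le_max lerNl.
have := ler_norm b; have := ler_norm (- a); rewrite normrN => h1 h2.
by rewrite le_max; apply/andP; split; apply/orP; [left|right]; lra.
Qed.

Lemma sin_lipschitz a b : `|sin b - sin a| <= `|b - a|.
Proof.
rewrite -[leRHS]mul1r; apply: (@mean_value_lipschitz sin cos) => // x _.
by rewrite ler_norml cos_geN1 cos_le1.
Qed.

Lemma cos_lipschitz a b : `|cos b - cos a| <= `|b - a|.
Proof.
rewrite -[leRHS]mul1r.
apply: (@mean_value_lipschitz cos (fun x => - sin x)) => // x _.
by rewrite normrN ler_norml sin_geN1 sin_le1.
Qed.

Lemma cis_lipschitz a b : cmod (cis b - cis a) <= 2 * `|b - a|.
Proof.
rewrite (le_trans (cmod_le_ReIm _)) // mulr2n mulrDl mul1r.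
by apply: lerD; [exact: cos_lipschitz|exact: sin_lipschitz].
Qed.

(** The derivative [cos t - 1] is at most [|t|] in modulus because [cos] is 1-Lipschitz, so the mean
    value bound yields a square. *)
Lemma sin_sub_id x : `|sin x - x| <= x ^+ 2.
Proof.
have dr (y : R) : is_derive y 1 (fun t => sin t - t) (cos y - 1).
  exact: is_deriveB.
have /= := @mean_value_lipschitz _ _ `|x| 0 x dr.
rewrite sin0 !subr0 -expr2 real_normK ?num_real //; apply=> y.
rewrite normr0 max_r // => yx; apply: le_trans yx.
by have := cos_lipschitz 0 y; rewrite cos0 subr0.
Qed.

(** [|1 - cis x|] dominates [|sin x|], which is at least [|x| - x^2], and [x^2 <= |x| / 2] on this
    range. *)
Lemma cis_far x : `|x| <= 2^-1 -> `|x| / 2 <= cmod (1 - cis x).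
Proof.
move=> x1; rewrite (le_trans _ (Im_le_cmod _)) //= sub0r normrN.
have := sin_sub_id x; rewrite -real_normK ?num_real // => h.
have h2 : `|x| <= `|sin x| + `|sin x - x|.
  by rewrite -{1}(subKr (sin x) x) ler_normB.
have h3 : `|x| ^+ 2 <= `|x| / 2 by rewrite expr2 ler_wpM2l.
lra.
Qed.

(** A geometric sum of ratio [cis x] is at most 2 over [|1 - cis x|]. The bound on [|x|] excludes
    the other multiples of 2 pi, where the sum would peak again. *)
Lemma cis_geom L x : `|x| <= 2^-1 -> x != 0 -> (0 < L)%N ->
  cmod (L%:R^-1%:C%C * \sum_(s < L) cis (s%:R * x)) <= 4 / (L%:R * `|x|).
Proof.
move=> x1 x0 L0.
have xp : 0 < `|x| by rewrite normr_gt0.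
have Lp : 0 < L%:R :> R by rewrite ltr0n.
have h := cis_far x1.
have np : 0 < cmod (1 - cis x) by apply: lt_le_trans h; rewrite divr_gt0.
rewrite cmodM cmod_real ger0_norm ?invr_ge0 ?ler0n //.
have -> : \sum_(s < L) cis (s%:R * x) = \sum_(s < L) cis x ^+ s.
  by apply: eq_bigr => s _; rewrite cisMn.
have : cmod (1 - cis x) * cmod (\sum_(s < L) cis x ^+ s) <= 2.
  rewrite -cmodN opprB -cmodM -subrX1 (le_trans (cmodB _ _)) //.
  by rewrite -cisMn cmod_cis -cis0 cmod_cis -mulr2n.
set S := cmod (\sum__ _) => hS.
rewrite ler_pdivlMr ?mulr_gt0 // mulrACA mulVf ?gt_eqF // mul1r.
have S0 : 0 <= S by exact: cmod_ge0.
nra.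
Qed.

(** The bound is free of [c], since each term differs from [cis (c * x)] by the phase [s x] alone;
    in the application [c] is the large first index of the window. *)
Lemma cis_mean_near L c x : (0 < L)%N ->
  cmod (L%:R^-1%:C%C * \sum_(s < L) cis ((c + s%:R) * x) - cis (c * x))
    <= 2 * (L%:R * `|x|).
Proof.
move=> L0; have Lp : 0 < L%:R :> R by rewrite ltr0n.
have -> : cis (c * x) = L%:R^-1%:C%C * \sum_(s < L) cis (c * x).
  rewrite sumr_const card_ord -[cis _ *+ _]mulr_natl mulrA.
  have -> : (L%:R : R[i]) = (L%:R)%:C%C by rewrite rmorph_nat.
  by rewrite -rmorphM mulVf ?gt_eqF // mul1r.
rewrite -mulrBr -sumrB cmodM cmod_real ger0_norm ?invr_ge0 //.
rewrite ler_pdivrMl // (le_trans (cmod_sum _ _ _)) //.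
apply: (@le_trans _ _ (\sum_(s < L) (2 * (L%:R * `|x|)))).
  apply: ler_sum => s _; rewrite (le_trans (cis_lipschitz _ _)) //.
  rewrite ler_wpM2l // -mulrBl addrC addKr normrM ler_wpM2r //.
  by rewrite ger0_norm // ler_nat ltnW.
by rewrite sumr_const card_ord [leRHS]mulr_natl.
Qed.

End UnitCircle.

(** * Deconvolution along a line of frequencies *)

Section Deconvolution.
Context {R : realType} (d k : nat).
Variables (mu : 'I_k -> 'rV[R]_d) (w : 'I_k -> R).
Variables (h : R) (S0 : nat) (v : 'rV[R]_d).
Implicit Types (e : 'rV[R]_d) (x y : R) (L s : nat).

(** The first index [S0] is kept apart from the window length: it makes the frequencies large, while
    the resolution depends only on the length and on [h]. *)
Definition grid_freq s e : 'rV[R]_d := h *: ((S0 + s)%:R *: v + e).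

Definition mean_proj j : R := dotp v (mu j).

Lemma dotpDl e1 e2 (m : 'rV[R]_d) :
  dotp (e1 + e2) m = dotp e1 m + dotp e2 m.
Proof.
by rewrite /dotp -big_split /=; apply: eq_bigr => i _; rewrite !mxE mulrDl.
Qed.

Lemma dotpZl (c : R) e m : dotp (c *: e) m = c * dotp e m.
Proof.
by rewrite /dotp mulr_sumr; apply: eq_bigr => i _; rewrite !mxE mulrA.
Qed.

Lemma dotp_grid_freq s e j :
  dotp (grid_freq s e) (mu j) = (S0 + s)%:R * (h * mean_proj j) + h * dotp e (mu j).
Proof. by rewrite dotpZl dotpDl dotpZl /mean_proj; ring. Qed.

(** A normalised Dirichlet kernel, up to the phase [cis (S0 * h * y)]. *)
Definition kernel L y : R[i] :=
  L%:R^-1%:C%C * \sum_(s < L) cis ((S0 + s)%:R * (h * y)).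

Lemma kernel_far L y : (0 < L)%N -> 0 < h -> y != 0 -> h * `|y| <= 2^-1 ->
  cmod (kernel L y) <= 4 / (L%:R * (h * `|y|)).
Proof.
move=> L0 h0 y0 hy; rewrite /kernel.
have -> : \sum_(s < L) cis ((S0 + s)%:R * (h * y)) =
    cis (S0%:R * (h * y)) * \sum_(s < L) cis (s%:R * (h * y)).
  by rewrite mulr_sumr; apply: eq_bigr => s _; rewrite natrD mulrDl cisD.
have hn : `|h * y| = h * `|y| by rewrite normrM gtr0_norm.
rewrite mulrCA cmodM cmod_cis mul1r -hn cis_geom ?hn //.
by rewrite mulf_neq0 // gt_eqF.
Qed.

Lemma kernel_near L y : (0 < L)%N -> 0 < h ->
  `|cmod (kernel L y) - 1| <= 2 * (L%:R * (h * `|y|)).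
Proof.
move=> L0 h0; have hn : `|h * y| = h * `|y| by rewrite normrM gtr0_norm.
have := @cis_mean_near R L S0%:R (h * y) L0; rewrite hn.
under eq_bigr do rewrite -natrD.
apply: le_trans.
by rewrite -[X in `|_ - X|](cmod_cis (S0%:R * (h * y))) ler_dist_cmod.
Qed.

Variables (g : nat -> 'rV[R]_d -> R[i]) (kappa : R) (L1 : nat).

Definition deconv L e x : R[i] :=
  L%:R^-1%:C%C * \sum_(s < L) g s e * cis (- ((S0 + s)%:R * (h * x))).

Definition offset e := e = 0 \/ exists i : 'I_d, e = delta_mx 0 i.

Hypothesis g_approx : forall s e, (s < L1)%N -> offset e ->
  cmod (g s e - \sum_(j < k) (w j)%:C%C * cis (dotp (grid_freq s e) (mu j)))
    <= kappa.
Hypothesis h_gt0 : 0 < h.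
Hypothesis w_ge0 : forall j, 0 <= w j.
Hypothesis w_le1 : \sum_(j < k) w j <= 1.

(** Exchanging the sums replaces each atom by a kernel centred at its projection. The noise keeps
    its size [kappa], being averaged against factors of modulus one. *)
Lemma deconv_approx L e x : (0 < L <= L1)%N -> offset e ->
  cmod (deconv L e x - \sum_(j < k)
    (w j)%:C%C * cis (h * dotp e (mu j)) * kernel L (mean_proj j - x)) <= kappa.
Proof.
move=> /andP[L0 LL1] eo; have Lp : 0 < L%:R :> R by rewrite ltr0n.
have -> : \sum_(j < k) (w j)%:C%C * cis (h * dotp e (mu j)) * kernel L (mean_proj j - x)
    = L%:R^-1%:C%C * \sum_(s < L)
      (\sum_(j < k) (w j)%:C%C * cis (dotp (grid_freq s e) (mu j))) *
      cis (- ((S0 + s)%:R * (h * x))).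
  under [in RHS]eq_bigr do rewrite mulr_suml.
  rewrite exchange_big /= mulr_sumr; apply: eq_bigr => j _.
  rewrite /kernel mulrCA; congr (_ * _); rewrite mulr_sumr.
  apply: eq_bigr => s _; rewrite -!mulrA; congr (_ * _).
  by rewrite -!cisD dotp_grid_freq; congr cis; ring.
rewrite /deconv -mulrBr -sumrB cmodM cmod_real ger0_norm ?invr_ge0 //.
rewrite ler_pdivrMl // (le_trans (cmod_sum _ _ _)) //.
apply: (@le_trans _ _ (\sum_(s < L) kappa)).
  apply: ler_sum => s _; rewrite -mulrBl cmodM cmod_cis mulr1.
  by apply: g_approx => //; exact: leq_trans LL1.
by rewrite sumr_const card_ord [leRHS]mulr_natl.
Qed.

(** By contraposition: if every projection is farther than [r], the kernels contribute at most
    [thr / 4] and the noise at most [thr / 2], together below the threshold. *)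
Lemma deconv_detect L (thr r : R) x : (0 < L <= L1)%N -> 0 < r ->
  (forall j, h * `|mean_proj j - x| <= 2^-1) ->
  4 / (L%:R * (h * r)) <= thr / 4 -> 0 < thr -> kappa <= thr / 2 ->
  thr <= cmod (deconv L 0 x) -> exists j, `|mean_proj j - x| <= r.
Proof.
move=> L0 r0 hx rthr thr0 kthr detect.
apply: contrapT => /forallNP far.
have Lp : 0 < L%:R :> R by rewrite ltr0n; case/andP: L0.
have o0 : offset 0 by left.
have := deconv_approx x L0 o0.
set T := \sum_(j < k) _.
have : cmod T <= thr / 4.
  rewrite (le_trans (cmod_sum _ _ _)) //.
  apply: (@le_trans _ _ (\sum_(j < k) w j * (thr / 4))); last first.
    by rewrite -mulr_suml ler_piMl // ltW // divr_gt0.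
  apply: ler_sum => j _; rewrite 2!cmodM cmod_cis cmod_real mulr1 ger0_norm //.
  rewrite ler_wpM2l //; have /negP := far j; rewrite -ltNge => rj.
  have j0 : 0 < `|mean_proj j - x| by exact: lt_trans rj.
  rewrite (le_trans (kernel_far _ _ _ _)) //.
  - by case/andP: L0.
  - by rewrite -normr_gt0.
  - apply: le_trans rthr; rewrite ler_wpM2l // lef_pV2 ?posrE ?mulr_gt0 //.
    by rewrite !ler_wpM2l ?ltW.
have := cmodDl (deconv L 0 x) (- T); rewrite cmodN; lra.
Qed.

Section AtPeak.
Variables (L : nat) (r far x : R) (j : 'I_k).
Hypothesis L_bounds : (0 < L <= L1)%N.
Hypothesis x_near : `|mean_proj j - x| <= r.
Hypothesis far_gt0 : 0 < far.
Hypothesis x_far : forall b, b != j -> far <= `|mean_proj b - x| /\ h * `|mean_proj b - x| <= 2^-1.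

Let err := 4 / (L%:R * (h * far)) + kappa.

(** Only the other atoms are estimated. The term of [j] keeps its exact kernel value, because the
    quotient that gives the mean cancels it. *)
Lemma deconv_peak e : offset e ->
  cmod (deconv L e x -
    (w j)%:C%C * cis (h * dotp e (mu j)) * kernel L (mean_proj j - x)) <= err.
Proof.
move=> eo; have Lp : 0 < L%:R :> R by rewrite ltr0n; case/andP: L_bounds.
have := deconv_approx x L_bounds eo.
rewrite (bigD1 j) //= opprD addrA; set A := deconv _ _ _ - _ => hA.
rewrite -[A](subrK (\sum_(i < k | i != j) (w i)%:C%C *
   cis (h * dotp e (mu i)) * kernel L (mean_proj i - x))) /err.
rewrite (le_trans (cmodD _ _)) // [leRHS]addrC lerD //.
rewrite (le_trans (cmod_sum _ _ _)) //.
have c0 : 0 <= 4 / (L%:R * (h * far)) by rewrite divr_ge0 // !mulr_ge0 // ltW.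
apply: (@le_trans _ _ (\sum_(i < k | i != j) w i * (4 / (L%:R * (h * far))))).
  apply: ler_sum => b bj; rewrite 2!cmodM cmod_cis cmod_real mulr1 ger0_norm //.
  rewrite ler_wpM2l //; have [fb hb] := x_far bj.
  have b0 : 0 < `|mean_proj b - x| by exact: lt_le_trans fb.
  rewrite (le_trans (kernel_far _ _ _ _)) //.
  - by case/andP: L_bounds.
  - by rewrite -normr_gt0.
  - rewrite ler_wpM2l // lef_pV2 ?posrE ?mulr_gt0 //.
    by do 2 rewrite ler_wpM2l ?(ltW h_gt0) //.
rewrite -mulr_suml ler_piMl // (le_trans _ w_le1) //.
by rewrite [leRHS](bigD1 j) //= lerDr.
Qed.

Lemma deconv_weight :
  `|cmod (deconv L 0 x) - w j| <= 2 * (L%:R * (h * r)) + err.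
Proof.
have o0 : offset 0 by left.
have Lp : 0 < L%:R :> R by rewrite ltr0n; case/andP: L_bounds.
have wj1 : w j <= 1.
  by rewrite (le_trans _ w_le1) // (bigD1 j) //= lerDl sumr_ge0.
have h1 := le_trans (ler_dist_cmod _ _) (deconv_peak o0).
have L0 : (0 < L)%N by case/andP: L_bounds.
have h2 := kernel_near (mean_proj j - x) L0 h_gt0.
move: h1; rewrite 2!cmodM cmod_cis cmod_real mulr1 (ger0_norm (w_ge0 j)).
move: h2; set D := cmod (deconv _ _ _); set K := cmod (kernel _ _) => h2 h1.
have -> : D - w j = w j * (K - 1) + (D - w j * K) by ring.
rewrite (le_trans (ler_normD _ _)) // lerD // normrM ger0_norm //.
rewrite (le_trans (ler_piMl _ wj1)) // (le_trans h2) //.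
by do 3 rewrite ler_wpM2l ?(ltW h_gt0) //.
Qed.

Lemma deconv_mean (i : 'I_d) (wlow : R) : 0 < wlow ->
  wlow <= cmod (deconv L 0 x) ->
  `|complex.Im (deconv L (delta_mx 0 i) x / deconv L 0 x) / h - mu j 0 i|
    <= 2 * err / (wlow * h) + h * (mu j 0 i) ^+ 2.
Proof.
move=> wl0 wlF.
have ei : offset (delta_mx 0 i) by right; exists i.
have o0 : offset 0 by left.
have de : dotp (delta_mx 0 i) (mu j) = mu j 0 i.
  rewrite /dotp (bigD1 i) //= mxE !eqxx mul1r big1 ?addr0 // => l li.
  by rewrite mxE eqxx (negbTE li) mul0r.
have d0 : dotp 0 (mu j) = 0 by rewrite /dotp big1 // => l _; rewrite mxE mul0r.
have := deconv_peak ei; have := deconv_peak o0.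
rewrite de d0 mulr0 cis0 mulr1.
set D0 := deconv L 0 x; set Di := deconv L _ x; set a := cis _.
set K := kernel _ _ => h0 hi.
have D0p : 0 < cmod D0 by exact: lt_le_trans wlF.
have D00 : D0 != 0 by rewrite -cmod_eq0 gt_eqF.
have hd : cmod (Di / D0 - a) <= 2 * err / wlow.
  (* The unknown [w j * K] occurs in both deconvolutions and is eliminated: each contributes one
     [err], and the division by [D0] costs [wlow]. *)
  have -> : Di / D0 - a =
     ((Di - (w j)%:C%C * a * K) - a * (D0 - (w j)%:C%C * K)) / D0.
    by field.
  rewrite cmodM cmodV ler_pdivrMr // (@le_trans _ _ (2 * err)) //.
    rewrite (le_trans (cmodB _ _)) // cmodM cmod_cis mul1r mulr2n mulrDl mul1r.
    exact: lerD.
  have e0 : 0 <= err by rewrite (le_trans _ h0) // cmod_ge0.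
  rewrite -[leLHS]mulr1 -[leRHS]mulrA ler_wpM2l ?mulr_ge0 //.
  by rewrite mulrC ler_pdivlMr // mul1r.
have himd : `|complex.Im (Di / D0) - sin (h * mu j 0 i)| <= 2 * err / wlow.
  have -> : complex.Im (Di / D0) - sin (h * mu j 0 i) = complex.Im (Di / D0 - a).
    by rewrite /a raddfB.
  exact: le_trans (Im_le_cmod _) hd.
have hs := sin_sub_id (h * mu j 0 i).
have -> : complex.Im (Di / D0) / h - mu j 0 i =
  ((complex.Im (Di / D0) - sin (h * mu j 0 i)) +
   (sin (h * mu j 0 i) - h * mu j 0 i)) / h by field; rewrite gt_eqF.
rewrite normrM normfV (gtr0_norm h_gt0) ler_pdivrMr //.
rewrite (le_trans (ler_normD _ _)) // mulrDl lerD //.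
  have -> : 2 * err / (wlow * h) * h = 2 * err / wlow; last exact: himd.
  by field; rewrite !gt_eqF.
by rewrite (le_trans hs) // exprMn [leRHS]mulrAC.
Qed.

End AtPeak.
End Deconvolution.

(** * Greedy selection of separated peaks *)

Section Scan.
Context {R : realType}.
Variables (k : nat) (acc : nat -> bool) (X : nat -> R) (xinit sep : R).

(** [xinit] acts as a fictitious peak at least one separation to the left of all points, so that it
    never blocks a first accepted point. The cap at [k] bounds the memory whatever the direction. *)
Definition scan_step (l : seq nat) (i : nat) : seq nat :=
  if [&& (size l < k)%N, acc i & last xinit (map X l) + sep <= X i]
  then rcons l i else l.

Fixpoint scan (n : nat) : seq nat :=
  if n is n'.+1 then scan_step (scan n') n' else [::].

Lemma size_scan n : (size (scan n) <= k)%N.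
Proof.
elim: n => //= n IH; rewrite /scan_step; case: ifP => // /andP[].
by rewrite size_rcons.
Qed.

Lemma scan_sub n i : i \in scan n -> acc i /\ (i < n)%N.
Proof.
elim: n => //= n IH; rewrite /scan_step; case: ifP => [/and3P[_ ai _]|_].
  rewrite mem_rcons inE => /orP[/eqP ->//|/IH[? /leqW]]; by split.
by move=> /IH[? /leqW].
Qed.

Hypothesis sep_gt0 : 0 < sep.

Lemma scan_sorted n : sorted (fun a b => X a + sep <= X b) (scan n).
Proof.
elim: n => //= n; rewrite /scan_step; case: ifP => // /and3P[_ _].
by case: (scan n) => //= a l; rewrite last_map rcons_path => -> ->.
Qed.

Lemma scan_far n a b : (a < b < size (scan n))%N ->
  X (nth 0%N (scan n) a) + sep <= X (nth 0%N (scan n) b).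
Proof.
move=> /andP[ab bn].
have tr : transitive (fun a b => X a + sep <= X b).
  by move=> y x z xy yz; move: sep_gt0 xy yz; lra.
have := scan_sorted n; rewrite (sorted_pairwise tr) => /(pairwiseP 0%N).
by apply=> //; exact: ltn_trans bn.
Qed.

(** Two kept points near the same [z j] would be within [2 * r < sep], so nearness defines an
    injection between sets of [k] elements. Separation of the [z j] is a consequence: every other
    [z b] is near another kept point. *)
Lemma scan_recover (r : R) (z : 'I_k -> R) n : size (scan n) = k ->
  2 * r < sep ->
  (forall i, acc i -> (i < n)%N -> exists j, `|z j - X i| <= r) ->
  exists s : {perm 'I_k}, forall j,
    [/\ (nth 0%N (scan n) (s j) < n)%N, acc (nth 0%N (scan n) (s j)),
    `|z j - X (nth 0%N (scan n) (s j))| <= r &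
    forall b, b != j -> sep - r <= `|z b - X (nth 0%N (scan n) (s j))|].
Proof.
move=> szk rsep near.
have near' (a : 'I_k) : {j | `|z j - X (nth 0%N (scan n) a)| <= r}.
  apply/cid; have an : nth 0%N (scan n) a \in scan n by rewrite mem_nth ?szk.
  by have [? ?] := scan_sub an; exact: near.
pose f a := sval (near' a).
have fP a : `|z (f a) - X (nth 0%N (scan n) a)| <= r by exact: svalP (near' a).
have far (a b : 'I_k) : a != b ->
    sep <= `|X (nth 0%N (scan n) a) - X (nth 0%N (scan n) b)|.
  wlog : a b / (a < b)%N => [H|ab _].
    case: (ltngtP a b) => [ab|ba|/ord_inj ->]; last by rewrite eqxx.
    - exact: H.
    - by rewrite eq_sym distrC; apply: H.
  have := @scan_far n a b; rewrite szk ab ltn_ord => /(_ isT).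
  by rewrite ler_normr; lra.
have finj : injective f.
  move=> a b fab; apply/eqP/negPn/negP => /far.
  have := fP a; have := fP b; rewrite fab !ler_norml ler_normr; lra.
pose s := ((perm finj)^-1)%g.
have fs j : f (s j) = j by rewrite -(permE finj) permKV.
exists s => j; have sn : nth 0%N (scan n) (s j) \in scan n.
  by rewrite mem_nth ?szk.
have [? ?] := scan_sub sn; split=> //; first by rewrite -{1}(fs j).
move=> b bj; have := far (s b) (s j).
rewrite (inj_eq perm_inj) => /(_ bj); have := fP (s b); rewrite fs.
rewrite ler_norml !ler_normr; lra.
Qed.

Hypothesis X_init : forall i, xinit + sep <= X i.
Hypothesis X_mono : forall i j, (i <= j)%N -> X i <= X j.

(** Below the cap, an accepted point is discarded only for lying within [sep] of the last kept one,
    which the monotonicity of [X] places to its left. *)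
Lemma scan_cover n i : (i < n)%N -> acc i -> (size (scan n) < k)%N ->
  exists2 e, e \in scan n & X e <= X i < X e + sep.
Proof.
elim: n => //= n IH; rewrite ltnS leq_eqVlt => /orP[/eqP -> ai|ltin ai].
  rewrite /scan_step ai /=; case: ifP => [_ _|].
    by exists n; rewrite ?mem_rcons ?mem_head // lexx ltrDl.
  move=> /negbT; rewrite negb_and => /orP[/negP//|nl sk].
  move: nl; rewrite -ltNge => nl.
  have : last xinit (map X (scan n)) <= X n /\ scan n != [::] ->
    exists2 e, e \in scan n & X e <= X n < X e + sep.
    case: (scan n) nl => [|a l]; first by move=> _ [].
    rewrite /= last_map => nl [le _].
    by exists (last a l); rewrite ?mem_last // le.
  apply; move: nl (@scan_sub n); case: (scan n) => [|a l].
    by rewrite /= ltNge X_init.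
  rewrite /= last_map => _ sub; split => //; apply: X_mono.
  by have [_ /ltnW] := sub (last a l) (mem_last _ _).
rewrite /scan_step; case: ifP => [/and3P[sk _ _]|_].
  rewrite size_rcons => sk'; have [|e el ei] := IH ltin ai; first exact: ltnW.
  by exists e; rewrite // mem_rcons inE el orbT.
exact: IH.
Qed.

(** With fewer than [k] kept points, each [z j] falls in a half-open interval of length
    [sep + 2 * r] attached to a kept point, and no two of them share one, which contradicts the
    count. *)
Lemma scan_complete (r : R) (z : 'I_k -> R) n :
  (forall j, exists i, [/\ (i < n)%N, acc i & `|z j - X i| <= r]) ->
  (forall j b, j != b -> sep + 2 * r <= `|z j - z b|) ->
  size (scan n) = k.
Proof.
move=> hit far; apply/eqP; rewrite eqn_leq size_scan leqNgt; apply/negP => sk.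
have h j : {e | e \in scan n & X e - r <= z j < X e + sep + r}.
  apply/cid2; have [i [ltin ai ri]] := hit j.
  have [e es ei] := scan_cover ltin ai sk; exists e => //.
  move: ri ei; rewrite ler_norml; lra.
pose f j := s2val (h j).
have finj : injective f.
  move=> j b fjb; apply/eqP/negPn/negP => /far.
  have := s2valP' (h j); have := s2valP' (h b); rewrite -!/(f _) fjb.
  rewrite ler_normr; lra.
have : (size (map f (enum 'I_k)) <= size (scan n))%N.
  apply: uniq_leq_size; first by rewrite map_inj_uniq ?enum_uniq.
  by move=> _ /mapP[j _ ->]; exact: s2valP (h j).
by rewrite size_map size_enum_ord leqNgt sk.
Qed.

End Scan.

(** * Probability *)

Section FiniteChernoff.
Context {R : realType}.

(** Squaring [exp (u / 2) <= 1 / (1 - u / 2)], an instance of [1 + x <= exp x], avoids a series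
    expansion. *)
Lemma expR_le_quad (u : R) : `|u| <= 4^-1 -> expR u <= 1 + u + u ^+ 2.
Proof.
rewrite ler_norml => /andP[u1 u2].
have h : expR (u / 2) <= (1 - u / 2)^-1.
  rewrite -[expR _]invrK lef_pV2 ?posrE ?invr_gt0 ?expR_gt0 //; last by lra.
  by rewrite -expRN expR_ge1Dx.
have -> : expR u = expR (u / 2) * expR (u / 2) by rewrite -expRD -splitr.
apply: (@le_trans _ _ ((1 - u / 2)^-1 * (1 - u / 2)^-1)).
  by apply: ler_pM => //; exact: expR_ge0.
rewrite -invfM -[_^-1]mul1r ler_pdivrMr; last by rewrite mulr_gt0 //; lra.
have -> : (1 + u + u ^+ 2) * ((1 - u / 2) * (1 - u / 2)) =
  1 + (u / 2) ^+ 2 * (1 - 3 * u + u ^+ 2) by field.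
by rewrite lerDl mulr_ge0 ?sqr_ge0 // addr_ge0 ?sqr_ge0 //; lra.
Qed.

Lemma chernoff_upper (n K : nat) (p g : 'I_K -> R) (eta : R) :
  (forall v, 0 <= p v) -> \sum_v p v = 1 -> \sum_v p v * g v = 0 ->
  (forall v, `|g v| <= 2) -> 0 < eta <= 1 ->
  \sum_(y : {ffun 'I_n -> 'I_K} | n%:R * eta < \sum_i g (y i)) \prod_i p (y i)
    <= expR (- (n%:R * eta ^+ 2 / 16)).
Proof.
move=> p0 p1 pg g2 /andP[eta0 eta1].
(* [eta / 8] minimises the exponent [4 * lam ^ 2 - lam * eta], and [eta <= 1] keeps [|lam * g v|]
   within the range [1 / 4] of the quadratic bound. *)
pose lam := eta / 8.
have lam0 : 0 < lam by rewrite divr_gt0.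
apply: (@le_trans _ _ (\sum_(y : {ffun 'I_n -> 'I_K})
   (\prod_i (p (y i) * expR (lam * g (y i)))) * expR (- (lam * (n%:R * eta))))).
  rewrite big_mkcond /=; apply: ler_sum => y _.
  rewrite big_split /= -expR_sum -mulr_sumr -mulrA -expRD.
  have P0 : 0 <= \prod_i p (y i) by exact: prodr_ge0.
  case: ifPn => [H|_]; last by rewrite mulr_ge0 // expR_ge0.
  rewrite ler_peMr // -[leLHS]expR0 ler_expR.
  by rewrite subr_ge0 ler_pM2l // ltW.
rewrite -mulr_suml -(bigA_distr_bigA (fun _ v => p v * expR (lam * g v))) /=.
rewrite prodr_const card_ord.
have h : \sum_v p v * expR (lam * g v) <= expR (4 * lam ^+ 2).
  apply: (@le_trans _ _ (1 + 4 * lam ^+ 2)); last exact: expR_ge1Dx.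
  apply: (@le_trans _ _ (\sum_v (p v + lam * (p v * g v) + p v * (4 * lam ^+ 2)))).
    apply: ler_sum => v _.
    have lg : `|lam * g v| <= 4^-1.
      by rewrite normrM gtr0_norm //; have := g2 v; rewrite /lam; nra.
    apply: (le_trans (ler_wpM2l (p0 v) (expR_le_quad lg))).
    have gg : (g v) ^+ 2 <= 4.
      by rewrite -[_ ^+ 2]real_normK ?num_real //; have := g2 v; have := normr_ge0 (g v); nra.
    have -> : p v + lam * (p v * g v) + p v * (4 * lam ^+ 2) =
      p v * (1 + lam * g v + 4 * lam ^+ 2) by ring.
    rewrite ler_wpM2l // lerD2l exprMn mulrC ler_wpM2r ?sqr_ge0 //.
  by rewrite !big_split /= -mulr_sumr pg mulr0 addr0 -mulr_suml p1 mul1r.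
apply: (@le_trans _ _ (expR (4 * lam ^+ 2) ^+ n * expR (- (lam * (n%:R * eta))))).
  rewrite ler_wpM2r ?expR_ge0 // lerXn2r ?nnegrE ?expR_ge0 //.
  by apply: sumr_ge0 => v _; rewrite mulr_ge0 ?expR_ge0.
rewrite -expRM_natl -expRD ler_expR /lam.
have -> : n%:R * (4 * (eta / 8) ^+ 2) - eta / 8 * (n%:R * eta) =
  - (n%:R * eta ^+ 2 / 16) by field.
by [].
Qed.

Lemma chernoff (n K : nat) (p g : 'I_K -> R) (eta : R) :
  (forall v, 0 <= p v) -> \sum_v p v = 1 -> \sum_v p v * g v = 0 ->
  (forall v, `|g v| <= 2) -> 0 < eta <= 1 ->
  \sum_(y : {ffun 'I_n -> 'I_K} | n%:R * eta < `|\sum_i g (y i)|)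
     \prod_i p (y i) <= 2 * expR (- (n%:R * eta ^+ 2 / 16)).
Proof.
move=> p0 p1 pg g2 eta01.
have P0 (y : {ffun 'I_n -> 'I_K}) : 0 <= \prod_i p (y i) by exact: prodr_ge0.
apply: (@le_trans _ _
  (\sum_(y : {ffun 'I_n -> 'I_K} | n%:R * eta < \sum_i g (y i)) \prod_i p (y i) +
   \sum_(y : {ffun 'I_n -> 'I_K} | n%:R * eta < \sum_i - g (y i)) \prod_i p (y i))).
  rewrite big_mkcond [X in _ <= X + _]big_mkcond [X in _ <= _ + X]big_mkcond.
  rewrite -big_split /=; apply: ler_sum => y _.
  rewrite sumrN lter_normr; case: (n%:R * eta < \sum_i g (y i)) => /=.
    by case: ifP; rewrite ?lerDl // addr0.
  by rewrite add0r.
rewrite mulr2n mulrDl mul1r; apply: lerD; first exact: chernoff_upper.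
apply: (@chernoff_upper _ _ p (fun v => - g v)) => //.
  by under eq_bigr do rewrite mulrN; rewrite sumrN pg oppr0.
by move=> v; rewrite normrN.
Qed.

End FiniteChernoff.

(** * Rounding to finitely many levels and finite-valued laws *)

Section Level.
Context {R : realType}.

(** The lowest level also takes every negative number and the highest one everything above, so the
    map is total with finitely many values. *)
Definition level (m : nat) (y : R) : 'I_m.+1 := inord (minn (Num.truncn y) m).

Lemma levelE m y : level m y = minn (Num.truncn y) m :> nat.
Proof. by rewrite inordK // ltnS geq_minr. Qed.

Lemma level_itv m y : 0 <= y <= m%:R -> `|y - (level m y)%:R| <= 1.
Proof.
move=> /andP[y0 ym]; rewrite levelE.
have /andP[t1 t2] := truncn_itv y0.
have -> : minn (Num.truncn y) m = Num.truncn y.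
  by apply/minn_idPl; rewrite -(ler_nat R) (le_trans t1).
by move: t2; rewrite -natr1 ler_norml; lra.
Qed.

(** Links the integer part used in the analysis to the count of thresholds that a program can carry
    out. *)
Lemma level_count m y : (\sum_(j < m) (j.+1%:R <= y)%R)%N = level m y.
Proof.
rewrite levelE; set t := Num.truncn y.
have -> : (\sum_(j < m) (j.+1%:R <= y)%R = \sum_(j < m) (j < t))%N.
  apply: eq_bigr => j _; congr nat_of_bool.
  by rewrite /t truncn_gt_nat.
elim: m => [|m IH]; first by rewrite big_ord0 minn0.
rewrite big_ord_recr /= IH; case: leqP; lia.
Qed.

Lemma level_eq m y (v : 'I_m.+1) :
  (level m y == v) = ((v == ord0) || (v%:R <= y)) && ((v == ord_max) || (y < v.+1%:R)).
Proof.
rewrite -val_eqE /= levelE -!val_eqE /=.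
rewrite -truncn_le_nat; have := ltn_ord v; case: (posnP v) => [->|vp].
  by rewrite orTb andTb; move: (Num.truncn y) => t; lia.
have -> : (v%:R <= y) = (v <= Num.truncn y)%N.
  by rewrite -[in LHS](prednK vp) -truncn_gt_nat prednK.
by rewrite orFb; move: (Num.truncn y) => t; lia.
Qed.

Lemma measurable_level m (v : 'I_m.+1) : measurable [set y : R | level m y = v].
Proof.
have -> : [set y : R | level m y = v] =
  (if v == ord0 then setT else [set` `[v%:R, +oo[]) `&`
  (if v == ord_max then setT else [set` `]-oo, v.+1%:R[]).
  apply/seteqP; split => y /=.
    move=> /eqP; rewrite level_eq; case: (v == ord0); case: (v == ord_max) => //=;
    by rewrite ?in_itv /= ?andbT => // /andP[].
  case: (v == ord0) (v == ord_max) (level_eq y v) => [] [] /= e; rewrite ?in_itv /= ?andbT => -[h1 h2];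
    apply/eqP; rewrite e ?h1 ?h2 //.
by apply: measurableI; case: ifP => _ //; exact: measurable_itv.
Qed.

End Level.

Section FiniteLaw.
Context {R : realType} {dT : measure_display} {T : measurableType dT}.
Variable P : probability T R.

(** An event on finitely many finite-valued variables is a finite disjoint union of atoms, so the
    product formula is required on atoms only; that is what the independence hypothesis supplies. *)
Lemma finite_law (I : finType) (K : nat) (Y : I -> T -> 'I_K) (p : I -> 'I_K -> R)
    (B : pred {ffun I -> 'I_K}) :
  (forall y : {ffun I -> 'I_K}, measurable [set o | forall i, Y i o = y i]) ->
  (forall y : {ffun I -> 'I_K},
    P [set o | forall i, Y i o = y i] = (\prod_i p i (y i))%:E) ->
  measurable [set o | B [ffun i => Y i o]] /\
  P [set o | B [ffun i => Y i o]] = (\sum_(y | B y) \prod_i p i (y i))%:E.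
Proof.
move=> mY PY.
have E : [set o | B [ffun i => Y i o]] =
    \bigcup_(y in [set y | B y]) [set o | forall i, Y i o = y i].
  apply/seteqP; split=> [x Bx|x [y By yx]].
    by exists [ffun i => Y i x] => //= i; rewrite ffunE.
  rewrite /= (_ : [ffun i => Y i x] = y) //; apply/ffunP => i.
  by rewrite ffunE; exact: yx.
rewrite E; split; first exact: fin_bigcup_measurable.
rewrite measure_fin_bigcup //.
  rewrite -sumEFin -[RHS]big_filter [RHS]fsbig_seq ?filter_uniq ?index_enum_uniq //.
  have -> : [set` [seq y <- index_enum _ | B y]] = [set y | B y].
    apply/seteqP; split => y /=; rewrite mem_filter ?mem_index_enum ?andbT //.
  by apply: eq_fsbigr => y _; exact: PY.
  exact: finite_finset.
move=> y z _ _ [x [/= yx zx]]; apply/ffunP => i.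
by rewrite -yx -zx.
Qed.

Lemma bounded_integrable (f : T -> R) :
  measurable_fun setT f -> (forall x, `|f x| <= 1) ->
  P.-integrable setT (EFin \o f).
Proof.
move=> mf f1; apply: measurable_bounded_integrable => //.
  exact: le_lt_trans (probability_le1 P measurableT) (ltry _).
exists 1; split => // M M1 x _ /=; exact: le_trans (f1 x) (ltW M1).
Qed.

Lemma Rintegral_dist (f g : T -> R) (c : R) :
  P.-integrable setT (EFin \o f) -> P.-integrable setT (EFin \o g) ->
  (forall x, `|f x - g x| <= c) ->
  `|\int[P]_x f x - \int[P]_x g x| <= c.
Proof.
move=> fi gi fg; rewrite -RintegralB //.
have fgi : P.-integrable setT (EFin \o (fun x => f x - g x)).
  by have := integrableB measurableT fi gi.
rewrite (le_trans (le_normr_Rintegral _ _)) //.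
have -> : c = \int[P]_(x in setT) c.
  rewrite Rintegral_cst // [fine _](_ : _ = 1) ?mulr1 //.
  exact: (congr1 fine (probability_setT P)).
apply: le_Rintegral => //; first by have := integrable_norm fgi.
by apply: finite_measure_integrable_cst.
Qed.

Section FiniteValued.
Variables (K : nat) (kappa : T -> 'I_K) (val : 'I_K -> R).
Hypothesis mkappa : forall v, measurable [set x | kappa x = v].

Let decomp x : (val (kappa x))%:E =
  (\sum_v (val v)%:E * (\1_[set x | kappa x = v] x)%:E)%E.
Proof.
rewrite (bigD1 (kappa x)) //= indicE mem_set //= mule1 big1 ?adde0 // => v vx.
by rewrite indicE memNset ?mule0 //= => xv; rewrite xv eqxx in vx.
Qed.

Lemma finite_valued_integrable :
  P.-integrable setT (EFin \o (fun x => val (kappa x))).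
Proof.
have -> : EFin \o (fun x => val (kappa x)) = (fun x =>
  (\sum_v (val v)%:E * (\1_[set x | kappa x = v] x)%:E)%E).
  by apply/funext => x /=; exact: decomp.
apply: integrable_sum => // v _; apply: integrableZl => //.
exact: integrable_indic.
Qed.

Lemma Rintegral_finite_valued :
  \int[P]_x val (kappa x) =
    \sum_v val v * fine (P [set x | kappa x = v]).
Proof.
rewrite /Rintegral; under eq_integral do rewrite decomp.
rewrite integral_sum //; last first.
  by move=> v; apply: integrableZl => //; exact: integrable_indic.
have -> : (\sum_v \int[P]_x ((val v)%:E * (\1_[set x | kappa x = v] x)%:E))%E =
    (\sum_v (val v * fine (P [set x | kappa x = v]))%:E)%E.
  apply: eq_bigr => v _; rewrite integralZl //; last exact: integrable_indic.
  by rewrite integral_indic // setIT EFinM fineK // fin_num_measure.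
by rewrite sumEFin.
Qed.

End FiniteValued.
End FiniteLaw.

Section Borel.
Context {R : realType} {d : nat}.
Implicit Types (t : 'rV[R]_d).

Lemma borelRd_measurable_real (f : 'rV[R]_d -> R) :
  continuous f -> measurable_fun (setT : set (borelRd R d)) f.
Proof.
move=> /continuousP cf; apply: (measurability _ (measurable_realfun.RGenOpens.measurableE R)).
move=> _ [_ [a [b ->] <-]]; rewrite setTI.
by apply: sub_sigma_algebra; exact/cf/interval_open.
Qed.

Lemma borelRd_measurable (f : 'rV[R]_d -> 'rV[R]_d) : continuous f ->
  measurable_fun (setT : set (borelRd R d)) (f : borelRd R d -> borelRd R d).
Proof.
move=> /continuousP cf; apply: (@measurability _ _ _ (borelRd R d) _ _ (@open ('rV[R]_d : topologicalType))) => //.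
by move=> _ [A oA <-]; rewrite setTI; apply: sub_sigma_algebra; exact: cf.
Qed.

Lemma dotp_continuous t : continuous (dotp t : 'rV[R]_d -> R).
Proof.
rewrite /dotp; elim: (index_enum _) => [|i r IH].
  under eq_fun do rewrite big_nil; exact: cst_continuous.
under eq_fun do rewrite big_cons; move=> x; apply: continuousD (IH x).
by apply: continuousM; [exact: cst_continuous | exact: coord_continuous].
Qed.

Lemma addr_continuous t : continuous (fun x : 'rV[R]_d => x + t).
Proof. by move=> x; apply: continuousD; [exact: cvg_id|exact: cst_continuous]. Qed.

End Borel.

Lemma prod_EFin (R : realType) (I : finType) (F : I -> R) :
  (\prod_i (F i)%:E)%E = (\prod_i F i)%:E.
Proof. by rewrite (big_morph EFin EFinM erefl). Qed.

(** * Concentration of empirical means of a mixture *)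

Section Concentration.
Context {R : realType} {d : nat} {J : finType}.
Variables (W : J -> R) (P : J -> probability (borelRd R d) R) (m : J -> 'rV[R]_d).
Variable Q : set (borelRd R d) -> \bar R.
Hypothesis W_ge0 : forall j, 0 <= W j.
Hypothesis W_sum : \sum_j W j = 1.
Hypothesis QE : forall S, measurable S ->
  Q S = (\sum_j (W j)%:E * translate (P j) (m j) S)%E.

(** [Q] is a bare set function, so the expectation under it is defined through the components. *)
Definition mix_mean (f : 'rV[R]_d -> R) : R :=
  \sum_j W j * \int[P j]_x f ((x : 'rV[R]_d) + m j).

Section Discretized.
Variables (K : nat) (kappa : borelRd R d -> 'I_K).
Hypothesis mkappa : forall v, measurable [set x | kappa x = v].

Let kshift j (x : borelRd R d) : 'I_K := kappa (x + m j).

Let mkshift j v : measurable [set x | kshift j x = v].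
Proof.
have := @borelRd_measurable R d _ (@addr_continuous R d (m j)) measurableT _ (mkappa v).
by rewrite setTI.
Qed.

Definition mix_mass v : R := \sum_j W j * fine (P j [set x | kshift j x = v]).

Lemma mix_mass_ge0 v : 0 <= mix_mass v.
Proof. by apply: sumr_ge0 => j _; rewrite mulr_ge0 // fine_ge0. Qed.

Lemma mix_massE v : Q [set x | kappa x = v] = (mix_mass v)%:E.
Proof.
rewrite QE // -sumEFin; apply: eq_bigr => j _.
by rewrite EFinM fineK // fin_num_measure //; exact: mkshift.
Qed.

Lemma mix_mean_finite_valued (val : 'I_K -> R) :
  mix_mean (fun x => val (kappa x)) = \sum_v mix_mass v * val v.
Proof.
rewrite /mix_mean; under [RHS]eq_bigr do rewrite mulr_suml.
rewrite exchange_big /=; apply: eq_bigr => j _.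
rewrite (Rintegral_finite_valued (P j) val (mkshift j)) mulr_sumr.
by apply: eq_bigr => v _; ring.
Qed.

Lemma mix_mass_sum : \sum_v mix_mass v = 1.
Proof.
under eq_bigr do rewrite -[mix_mass _]mulr1.
rewrite -(mix_mean_finite_valued (fun=> 1)) /mix_mean -[RHS]W_sum.
apply: eq_bigr => j _; rewrite Rintegral_cst // [fine _](_ : _ = 1) ?mulr1 //.
exact: (congr1 fine (probability_setT (P j))).
Qed.

Lemma mix_mean_dist (val : 'I_K -> R) (f : 'rV[R]_d -> R) c :
  continuous f -> (forall x, `|f x| <= 1) ->
  (forall x, `|f x - val (kappa x)| <= c) ->
  `|mix_mean f - mix_mean (fun x => val (kappa x))| <= c.
Proof.
move=> cf f1 fc; rewrite /mix_mean -sumrB (le_trans (ler_norm_sum _ _ _)) //.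
rewrite -[leRHS]mul1r -W_sum mulr_suml; apply: ler_sum => j _.
rewrite -mulrBr normrM ger0_norm // ler_wpM2l //.
apply: Rintegral_dist => [||x]; last exact: fc.
- apply: bounded_integrable => [|x]; last exact: f1.
  apply: borelRd_measurable_real => x.
  by apply: continuous_comp; [exact: (@addr_continuous R d (m j))|exact: cf].
- exact: (finite_valued_integrable (P j) val (mkshift j)).
Qed.

End Discretized.

(* The hypothesis on the sample only concerns boxes, so f is first rounded to
   finitely many values; the law of the rounded sample is then a product of
   finite distributions, to which Chernoff's bound applies as a finite sum. *)
Lemma mixture_concentration n (dO : measure_display) (Omega : measurableType dO)
    (Pr : probability Omega R) (X : 'I_n -> {RV Pr >-> borelRd R d})
    (U : nat -> {RV Pr >-> R}) (f : 'rV[R]_d -> R) (eta : R) :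
  iid_with_uniforms Q X U -> (0 < n)%N ->
  continuous f -> (forall x, `|f x| <= 1) -> 0 < eta <= 1 ->
  exists B : set Omega,
    [/\ measurable B, (Pr B <= (2 * expR (- (n%:R * eta ^+ 2 / 16)))%:E)%E &
     forall o, ~ B o ->
       `|n%:R^-1 * \sum_i f (X i o) - mix_mean f| <= 3 * eta].
Proof.
move=> iid n0 cf f1 eta01; have /andP[eta0 eta1] := eta01.
(* [f + 1] is cut into [2 * M'] steps of height [1 / M'], which is at most [eta]. *)
have [M' hM'] : exists M : nat, eta^-1 < M%:R.
  by exists (Num.truncn eta^-1).+1; rewrite truncnS_gt.
have Mp : 0 < M'%:R :> R by apply: lt_trans hM'; rewrite invr_gt0.
have Meta : M'%:R^-1 <= eta.
  by rewrite -[leRHS]invrK lef_pV2 ?posrE ?invr_gt0 // ltW.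
pose kappa (x : borelRd R d) := level (2 * M') ((f x + 1) * M'%:R).
pose val (v : 'I_(2 * M').+1) : R := v%:R / M'%:R - 1.
have val1 v : `|val v| <= 1.
  have : v%:R <= 2 * M'%:R :> R by rewrite -natrM ler_nat -ltnS.
  have v0 : 0 <= v%:R :> R by [].
  move=> h; rewrite /val ler_norml; apply/andP; split.
    by rewrite lerBrDr addNr divr_ge0 // ltW.
  by rewrite lerBlDr ler_pdivrMr //; lra.
have fval x : `|f x - val (kappa x)| <= eta.
  apply: le_trans Meta.
  have -> : f x - val (kappa x) =
    ((f x + 1) * M'%:R - (kappa x)%:R) * M'%:R^-1.
    by rewrite /val; field; rewrite gt_eqF.
  rewrite normrM (ger0_norm (_ : 0 <= M'%:R^-1)) ?invr_ge0 ?(ltW Mp) //.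
  rewrite -[leRHS]mul1r ler_wpM2r ?invr_ge0 ?(ltW Mp) //.
  apply: level_itv; have := f1 x; rewrite ler_norml natrM => /andP[h1 h2].
  by apply/andP; split; [rewrite mulr_ge0 ?(ltW Mp) //; lra | rewrite ler_pM2r //; lra].
have mkappa v : measurable [set x | kappa x = v].
  have mf : measurable_fun (setT : set (borelRd R d)) (fun x => (f x + 1) * M'%:R).
    apply: measurable_funM => //; apply: measurable_funD => //.
    exact: borelRd_measurable_real.
  by have := mf measurableT _ (measurable_level v); rewrite setTI.
pose e := mix_mean (fun x => val (kappa x)).
pose p := mix_mass kappa.
have p0 v : 0 <= p v by exact: mix_mass_ge0.
have p1 : \sum_v p v = 1 by exact: mix_mass_sum.
have ee : e = \sum_v p v * val v by exact: mix_mean_finite_valued.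
have e1 : `|e| <= 1.
  rewrite ee (le_trans (ler_norm_sum _ _ _)) // -[leRHS]p1.
  by apply: ler_sum => v _; rewrite normrM ger0_norm // ler_piMr.
pose g v := val v - e.
have pg : \sum_v p v * g v = 0.
  under eq_bigr do rewrite mulrBr.
  by rewrite sumrB -mulr_suml p1 mul1r -ee subrr.
have g2 v : `|g v| <= 2.
  by rewrite (le_trans (ler_normB _ _)) // mulr2n lerD.
pose Y i o := kappa (X i o).
have YE (y : {ffun 'I_n -> 'I_(2 * M').+1}) :
    [set o | forall i, Y i o = y i] =
    [set o | (forall i, [set x | kappa x = y i] (X i o)) /\
             (forall j : 'I_0, [set: R] (U j o))].
  by apply/seteqP; split => o /=; [move=> h; split|case].
have PY (y : {ffun 'I_n -> 'I_(2 * M').+1}) :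
    Pr [set o | forall i, Y i o = y i] = (\prod_i p (y i))%:E.
  rewrite YE (iid 0%N (fun i => [set x | kappa x = y i]) (fun=> setT)) //.
  rewrite big_ord0 mule1 -prod_EFin; apply: eq_bigr => i _.
  exact: mix_massE.
have mY (y : {ffun 'I_n -> 'I_(2 * M').+1}) :
    measurable [set o | forall i, Y i o = y i].
  have -> : [set o | forall i, Y i o = y i] =
      \bigcap_(i in [set: 'I_n]) (X i @^-1` [set x | kappa x = y i]).
    by apply/seteqP; split => o /= h i; [move=> _|]; exact: h.
  apply: fin_bigcap_measurable => // i _.
  by rewrite -[X in measurable X]setTI; exact: measurable_funP.
have [mB PB] := @finite_law R _ _ Pr _ _ Y (fun=> p)
  (fun y => n%:R * eta < `|\sum_i g (y i)|) mY PY.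
exists [set o | n%:R * eta < `|\sum_i g ([ffun i => Y i o] i)|]; split=> //.
  by rewrite PB lee_fin; exact: chernoff.
move=> o /negP; rewrite -leNgt; under eq_bigr do rewrite ffunE; move=> h.
have np : 0 < n%:R :> R by rewrite ltr0n.
(* Three errors of at most [eta] each: the rounding of the sample values, the fluctuation of the
   rounded mean, and the rounding of the expectation. *)
have -> : n%:R^-1 * \sum_i f (X i o) - mix_mean f =
   n%:R^-1 * \sum_i (f (X i o) - val (Y i o)) +
   n%:R^-1 * \sum_i g (Y i o) - (mix_mean f - e).
  have -> : \sum_i g (Y i o) = \sum_i val (Y i o) - n%:R * e.
    by rewrite /g sumrB sumr_const card_ord mulr_natl.
  by rewrite sumrB; move: (\sum_i f _) (\sum_i val _) => a b; field; rewrite gt_eqF.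
have h1 : `|n%:R^-1 * \sum_i (f (X i o) - val (Y i o))| <= eta.
  rewrite normrM ger0_norm ?invr_ge0 // ler_pdivrMl //.
  rewrite (le_trans (ler_norm_sum _ _ _)) // mulr_natl -[X in _ <= _ *+ X]card_ord.
  by rewrite -sumr_const; apply: ler_sum => i _; exact: fval.
have h2 : `|n%:R^-1 * \sum_i g (Y i o)| <= eta.
  by rewrite normrM ger0_norm ?invr_ge0 // ler_pdivrMl.
have h3 : `|mix_mean f - e| <= eta by exact: mix_mean_dist.
have := ler_normB (n%:R^-1 * \sum_i (f (X i o) - val (Y i o)) + n%:R^-1 * \sum_i g (Y i o)) (mix_mean f - e).
have := ler_normD (n%:R^-1 * \sum_i (f (X i o) - val (Y i o))) (n%:R^-1 * \sum_i g (Y i o)).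
lra.
Qed.

End Concentration.

(** * Random integer directions *)

Section RandomDirections.
Context {R : realType}.

(** The law of the level of [M * u] for [u] uniform on [0, 1]: the top level is attained at [u = 1]
    only and has mass zero. *)
Definition level_mass (M : nat) (v : 'I_M.+1) : R := if (v < M)%N then M%:R^-1 else 0.

Lemma level_mass_ge0 M (v : 'I_M.+1) : 0 <= level_mass v.
Proof. by rewrite /level_mass; case: ifP => // _; rewrite invr_ge0. Qed.

Lemma level_mass_sum M : (0 < M)%N -> \sum_v level_mass (v : 'I_M.+1) = 1.
Proof.
move=> M0; rewrite big_ord_recr /= /level_mass /= ltnn addr0.
under eq_bigr => i _ do rewrite /= ltn_ord.
by rewrite sumr_const card_ord -[LHS]mulr_natl divff // pnatr_eq0 -lt0n.
Qed.

Lemma uniform_level M (v : 'I_M.+1) : (0 < M)%N ->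
  uniform_prob (@ltr01 R) [set u | level M (M%:R * u) = v] = (level_mass v)%:E.
Proof.
move=> M0; have Mp : 0 < M%:R :> R by rewrite ltr0n.
have mS : measurable [set u : R | level M (M%:R * u) = v].
  have mf : measurable_fun [set: R] (fun u : R => M%:R * u) by exact: measurable_funM.
  by have := mf measurableT _ (measurable_level v); rewrite setTI.
have -> : uniform_prob (@ltr01 R) [set u | level M (M%:R * u) = v] =
    lebesgue_measure ([set u : R | level M (M%:R * u) = v] `&` `[0, 1]%classic).
  rewrite /uniform_prob integral_uniform_pdf (eq_integral (cst 1%E)).
    by rewrite integral_cst ?mul1e //; exact: measurableI.
  move=> u; rewrite inE /= => -[_]; rewrite in_itv /= => u01.
  by rewrite /uniform_pdf u01 subr0 invr1.
rewrite /level_mass; case: ifP => vM.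
- have -> : [set u : R | level M (M%:R * u) = v] `&` `[0, 1]%classic =
     `[v%:R / M%:R, v.+1%:R / M%:R[%classic.
    apply/seteqP; split=> u /=; rewrite !in_itv /=.
      move=> [/eqP]; rewrite level_eq => /andP[h1 h2] /andP[u0 u1].
      rewrite ler_pdivrMr // ltr_pdivlMr //  [u * _]mulrC; apply/andP; split.
        by move: h1 => /orP[/eqP ->|//]; rewrite mulr_ge0 // ltW.
      by move: h2 => /orP[/eqP vm|//]; rewrite vm /= ltnn in vM.
    rewrite ler_pdivrMr // ltr_pdivlMr // [u * _]mulrC => /andP[h1 h2].
    split; first by apply/eqP; rewrite level_eq h1 h2 !orbT.
    have v0 : 0 <= v%:R :> R by [].
    have vM' : v.+1%:R <= M%:R :> R by rewrite ler_nat.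
    by rewrite -(pmulr_rge0 _ Mp) -(ler_pM2l Mp u 1) mulr1; lra.
  rewrite lebesgue_measure_itv /= lte_fin ltr_pM2r ?invr_gt0 // ltr_nat ltnSn.
  by rewrite -EFinD -mulrBl -natr1 addrAC subrr add0r mul1r.
- have vm : v = ord_max.
    by apply/val_inj => /=; move: vM (ltn_ord v) => /negbT; rewrite -leqNgt ltnS; lia.
  have -> : [set u : R | level M (M%:R * u) = v] `&` `[0, 1]%classic = [set 1].
    apply/seteqP; split=> u /=; rewrite !in_itv /=.
      move=> [/eqP]; rewrite level_eq vm /= -val_eqE /= gtn_eqF //=.
      rewrite eqxx andbT -[X in X <= _ -> _](mulr1 M%:R) ler_pM2l // => u1 /andP[_ u1'].
      by apply/eqP; rewrite eq_le u1 u1'.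
    move=> ->; rewrite ler01 lexx mulr1; split=> //.
    by apply/eqP; rewrite level_eq vm /= eqxx lexx orbT.
  exact: lebesgue_measure_set1.
Qed.

(** On [A] the other coordinates determine [f], so resetting the coordinate [l0] to [v0] is
    injective there. Each mass is at most [c] times that of the reset point under the law with a
    Dirac mass at [l0], and the latter masses sum to at most 1. *)
Lemma prob_finfun_le (J K : finType) (p : K -> R) (v0 : K) (c : R) (l0 : J)
    (A : pred {ffun J -> K}) :
  (forall v, 0 <= p v) -> \sum_v p v = 1 -> (forall v, p v <= c) -> 0 <= c ->
  (forall f g, A f -> A g -> (forall l, l != l0 -> f l = g l) -> f = g) ->
  \sum_(f | A f) \prod_l p (f l) <= c.
Proof.
move=> p0 p1 pc c0 inj.
pose F l v : R := if l == l0 then (v == v0)%:R else p v.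
pose r (f : {ffun J -> K}) := [ffun l => if l == l0 then v0 else f l].
have F0 l v : 0 <= F l v by rewrite /F; case: ifP.
apply: (@le_trans _ _ (\sum_(f | A f) c * \prod_l F l (r f l))).
  apply: ler_sum => f _; rewrite (bigD1 l0) //= [in leRHS](bigD1 l0) //=.
  rewrite {1}/F eqxx ffunE eqxx eqxx mul1r.
  have -> : \prod_(l | l != l0) F l (r f l) = \prod_(l | l != l0) p (f l).
    by apply: eq_bigr => l ll; rewrite /F ffunE (negbTE ll).
  by rewrite ler_wpM2r // prodr_ge0.
rewrite -mulr_sumr ler_piMr //.
have rinj : {in A &, injective r}.
  move=> f g Af Ag /ffunP fg; apply: inj => // l ll.
  by have := fg l; rewrite !ffunE (negbTE ll).
have -> : \sum_(f | A f) \prod_l F l (r f l) =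
    \sum_(g in [set r f | f in A]%SET) \prod_l F l (g l).
  by rewrite (big_imset (fun g : {ffun J -> K} => \prod_l F l (g l)) rinj).
apply: (@le_trans _ _ (\sum_(g : {ffun J -> K}) \prod_l F l (g l))).
  rewrite [leLHS]big_mkcond /=; apply: ler_sum => g _.
  by case: ifP => // _; exact: prodr_ge0.
rewrite -bigA_distr_bigA (bigD1 l0) //= [X in _ * X]big1 ?mulr1.
  rewrite /F eqxx (bigD1 v0) //= eqxx [X in _ + X]big1 ?addr0 // => v vv.
  by rewrite (negbTE vv).
by move=> l ll; rewrite /F (negbTE ll).
Qed.

Lemma natr_dist_ge1 (a b : nat) : a != b -> 1 <= `|a%:R - b%:R| :> R.
Proof.
wlog ab : a b / (a < b)%N => [H ne|_].
  have := ne; rewrite neq_ltn => /orP[/H->//|ba].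
  by rewrite distrC H // eq_sym.
by rewrite distrC -natrB ?(ltnW ab) // normr_nat ler1n subn_gt0.
Qed.

(* Two values of the coordinate l of the direction differ by at least 1, which
   moves the difference of the projections by 2 tau: given the other coordinates,
   at most one of the M equiprobable values is bad for the pair. *)
Lemma direction_separates M d k (mu : 'I_k -> 'rV[R]_d) (tau : R) :
  (0 < M)%N -> (2 * k ^ 2 <= M)%N -> 0 < tau ->
  (forall j b, j != b -> exists l, 2 * tau <= `|(mu j - mu b) 0 l|) ->
  \sum_(f : {ffun 'I_d -> 'I_M.+1} | [exists j, exists b, (j != b) &&
     (`|dotp (\row_l (f l).+1%:R) (mu j) - dotp (\row_l (f l).+1%:R) (mu b)| < tau)])
     \prod_l level_mass (f l) <= 2^-1.
Proof.
move=> M0 kM tau0 sep; have Mp : 0 < M%:R :> R by rewrite ltr0n.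
pose bad j b (f : {ffun 'I_d -> 'I_M.+1}) :=
  `|dotp (\row_l (f l).+1%:R) (mu j) - dotp (\row_l (f l).+1%:R) (mu b)| < tau.
have P0 (f : {ffun 'I_d -> 'I_M.+1}) : 0 <= \prod_l level_mass (f l).
  by apply: prodr_ge0 => l _; exact: level_mass_ge0.
apply: (@le_trans _ _ (\sum_(jb : 'I_k * 'I_k | jb.1 != jb.2)
   \sum_(f | bad jb.1 jb.2 f) \prod_l level_mass (f l))).
  rewrite [leLHS]big_mkcond /=; under [leRHS]eq_bigr do rewrite big_mkcond /=.
  rewrite exchange_big /=; apply: ler_sum => f _.
  case: ifP => [/existsP[j /existsP[b /andP[jb h]]]|_]; last first.
    by apply: sumr_ge0 => jb _; case: ifP.
  rewrite (bigD1 (j, b)) //= /bad h lerDl.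
  by apply: sumr_ge0 => ? _; case: ifP.
(* At most [k ^ 2] pairs, each bad with probability at most [1 / M], and [2 * k ^ 2 <= M]. *)
apply: (@le_trans _ _ (\sum_(jb : 'I_k * 'I_k) M%:R^-1)).
  rewrite [leLHS]big_mkcond /=; apply: ler_sum => -[j b] _ /=.
  case: ifP => jb; last by rewrite invr_ge0.
  have [l0 hl0] := sep j b jb.
  apply: (@prob_finfun_le _ _ (@level_mass M) ord0 _ l0).
  - exact: level_mass_ge0.
  - exact: level_mass_sum.
  - by move=> v; rewrite /level_mass; case: ifP => // _; rewrite invr_ge0.
  - by rewrite invr_ge0.
  move=> f g; rewrite /bad => hf hg fg; apply/ffunP => l.
  have [->|/fg //] := eqVneq l l0.
  pose S := \sum_(i < d | i != l0) (f i).+1%:R * (mu j - mu b) 0 i.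
  have E (h : {ffun 'I_d -> 'I_M.+1}) : (forall i, i != l0 -> f i = h i) ->
     dotp (\row_l (h l).+1%:R) (mu j) - dotp (\row_l (h l).+1%:R) (mu b) =
     (h l0).+1%:R * (mu j - mu b) 0 l0 + S.
    move=> fh; rewrite /dotp -sumrB (bigD1 l0) //= !mxE -mulrBr; congr (_ + _).
    by apply: eq_bigr => i il; rewrite !mxE -mulrBr (fh _ il).
  move: hf hg; rewrite (E f) // (E g) //; set y := (mu j - mu b) 0 l0 in hl0 *.
  move=> hf hg; apply/eqP/negPn/negP => ne.
  have d1 : 1 <= `|(f l0).+1%:R - (g l0).+1%:R| :> R.
    by apply: natr_dist_ge1; rewrite eqSS.
  have : `|((f l0).+1%:R - (g l0).+1%:R) * y| < 2 * tau.
    rewrite (_ : _ * y = ((f l0).+1%:R * y + S) - ((g l0).+1%:R * y + S)); last by ring.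
    by rewrite (le_lt_trans (ler_normB _ _)) // mulr2n mulrDl mul1r ltrD.
  by rewrite normrM ltNge (le_trans hl0) // ler_peMl.
rewrite sumr_const card_prod !card_ord -[leLHS]mulr_natl ler_pdivrMr //.
by rewrite mulrC ler_pdivlMr // mulrC -natrM ler_nat mulnn.
Qed.

(** Round [r] reads the block of [d] uniforms that starts at [r * d]. Distinct blocks are
    independent, so all [n] directions are bad with probability at most [2^-n]; [Q setT = 1] removes
    the sample from the joint law. *)
Lemma random_directions (d n M : nat) (dX : nat) (bad : pred {ffun 'I_d -> 'I_M.+1})
    (dO : measure_display) (Omega : measurableType dO)
    (Pr : probability Omega R) (Q : set (borelRd R dX) -> \bar R)
    (N : nat) (X : 'I_N -> {RV Pr >-> borelRd R dX}) (U : nat -> {RV Pr >-> R}) :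
  iid_with_uniforms Q X U -> Q setT = 1%E -> (0 < d)%N -> (0 < M)%N ->
  \sum_(f | bad f) \prod_l level_mass (f l) <= 2^-1 :> R ->
  exists B : set Omega,
    [/\ measurable B, (Pr B <= ((2^-1) ^+ n)%:E)%E &
     forall o, ~ B o -> exists2 r, (r < n)%N &
       ~~ bad [ffun l : 'I_d => level M (M%:R * U (r * d + l)%N o)]].
Proof.
move=> iid QT d0 M0 bad2.
have lt1 (j : 'I_(n * d)) : (j %/ d < n)%N by rewrite ltn_divLR.
have lt2 (j : 'I_(n * d)) : (j %% d < d)%N by rewrite ltn_mod.
pose pr (j : 'I_(n * d)) : 'I_n * 'I_d := (Ordinal (lt1 j), Ordinal (lt2 j)).
have lt3 (rl : 'I_n * 'I_d) : (rl.1 * d + rl.2 < n * d)%N.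
  case: rl => r l /=; have := ltn_ord r; have := ltn_ord l; nia.
pose ip (rl : 'I_n * 'I_d) : 'I_(n * d) := Ordinal (lt3 rl).
have prK : cancel pr ip by move=> j; apply/val_inj; rewrite /= -divn_eq.
have ipK : cancel ip pr.
  move=> [r l]; congr pair; apply/val_inj => /=.
    by rewrite divnMDl // divn_small // addn0.
  by rewrite modnMDl modn_small.
pose Y (rl : 'I_n * 'I_d) o := level M (M%:R * U (ip rl) o).
have YE (y : {ffun 'I_n * 'I_d -> 'I_M.+1}) :
    [set o | forall rl, Y rl o = y rl] =
    [set o | (forall i, [set: borelRd R dX] (X i o)) /\
      (forall j : 'I_(n * d), [set u | level M (M%:R * u) = y (pr j)] (U j o))].
  apply/seteqP; split => o /=.
    by move=> h; split=> // j; rewrite -h /Y prK.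
  by move=> [_ h] rl; rewrite /Y h ipK.
have mL v : measurable [set u : R | level M (M%:R * u) = v].
  have mf : measurable_fun [set: R] (fun u : R => M%:R * u) by exact: measurable_funM.
  by have := mf measurableT _ (measurable_level v); rewrite setTI.
have PY (y : {ffun 'I_n * 'I_d -> 'I_M.+1}) :
    Pr [set o | forall rl, Y rl o = y rl] = (\prod_rl level_mass (y rl))%:E.
  rewrite YE (iid (n * d)%N (fun=> setT)
    (fun j : 'I_(n * d) => [set u | level M (M%:R * u) = y (pr j)])) //.
  rewrite [X in (X * _)%E](_ : _ = 1%E); last by apply: big1 => i _; exact: QT.
  rewrite mul1e -prod_EFin (reindex ip) /=; last first.
    by apply: onW_bij; exists pr.
  by apply: eq_bigr => rl _; rewrite ipK uniform_level.
have mY (y : {ffun 'I_n * 'I_d -> 'I_M.+1}) :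
    measurable [set o | forall rl, Y rl o = y rl].
  have -> : [set o | forall rl, Y rl o = y rl] =
      \bigcap_(rl in [set: 'I_n * 'I_d])
        (U (ip rl) @^-1` [set u | level M (M%:R * u) = y rl]).
    by apply/seteqP; split => o /= h i; [move=> _|]; exact: h.
  apply: fin_bigcap_measurable => // i _.
  by rewrite -[X in measurable X]setTI; exact: measurable_funP.
pose row (f : {ffun 'I_n * 'I_d -> 'I_M.+1}) (r : 'I_n) := [ffun l => f (r, l)].
have [mB PB] := @finite_law R _ _ Pr _ _ Y (fun=> @level_mass M)
  (fun y => [forall r, bad (row y r)]) mY PY.
exists [set o | [forall r, bad (row [ffun rl => Y rl o] r)]]; split=> //.
- rewrite PB lee_fin.
  pose G (g : {ffun 'I_d -> 'I_M.+1}) : R := if bad g then \prod_l level_mass (g l) else 0.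
  pose curry (f : {ffun 'I_n * 'I_d -> 'I_M.+1}) := [ffun r => row f r].
  pose uncurry (F : {ffun 'I_n -> {ffun 'I_d -> 'I_M.+1}}) : {ffun 'I_n * 'I_d -> 'I_M.+1} :=
    [ffun rl => F rl.1 rl.2].
  have cK : cancel curry uncurry by move=> f; apply/ffunP => -[r l]; rewrite !ffunE.
  have uK : cancel uncurry curry.
    by move=> F; apply/ffunP => r; apply/ffunP => l; rewrite !ffunE.
  (* Regrouping the uniforms by rounds turns the sum over families into an [n]-th power. *)
  have -> : \sum_(y | [forall r, bad (row y r)]) \prod_rl level_mass (y rl) =
     \sum_(F : {ffun 'I_n -> {ffun 'I_d -> 'I_M.+1}}) \prod_r G (F r).
    rewrite [RHS](reindex curry) /=; last by apply: onW_bij; exists uncurry.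
    rewrite big_mkcond /=; apply: eq_bigr => y _.
    case: ifPn => [/forallP h|].
      rewrite [RHS](eq_bigr (fun r => \prod_l level_mass (y (r, l)))).
        by rewrite pair_bigA /=; apply: eq_bigr => -[r l] _.
      by move=> r _; rewrite /G ffunE h; apply: eq_bigr => l _; rewrite ffunE.
    rewrite negb_forall => /existsP[r br].
    by rewrite (bigD1 r) //= /G ffunE (negbTE br) mul0r.
  rewrite -(bigA_distr_bigA (fun=> G)) /= prodr_const card_ord.
  rewrite lerXn2r ?nnegrE ?invr_ge0 //.
    by apply: sumr_ge0 => g _; rewrite /G; case: ifP => // _; apply: prodr_ge0 => l _; exact: level_mass_ge0.
  by rewrite -big_mkcond.
- move=> o /negP; rewrite negb_forall => /existsP[r br]; exists r => //.
  by rewrite (_ : [ffun l => _] = row [ffun rl => Y rl o] r) //; apply/ffunP => l; rewrite !ffunE.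
Qed.

End RandomDirections.

(** * Characteristic functions *)

Section CharacteristicFunctions.
Context {R : realType} {d : nat}.
Implicit Types (P : probability (borelRd R d) R) (t m : 'rV[R]_d).

Lemma continuous_cos_dotp t : continuous (fun x : 'rV[R]_d => cos (dotp t x)).
Proof.
by move=> x; apply: continuous_comp; [exact: dotp_continuous|exact: continuous_cos].
Qed.

Lemma continuous_sin_dotp t : continuous (fun x : 'rV[R]_d => sin (dotp t x)).
Proof.
by move=> x; apply: continuous_comp; [exact: dotp_continuous|exact: continuous_sin].
Qed.

Lemma cos_bound (x : R) : `|cos x| <= 1.
Proof. by rewrite ler_norml cos_geN1 cos_le1. Qed.

Lemma sin_bound (x : R) : `|sin x| <= 1.
Proof. by rewrite ler_norml sin_geN1 sin_le1. Qed.

Lemma integrable_cos_dotp P t :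
  P.-integrable setT (EFin \o (fun x : borelRd R d => cos (dotp t x))).
Proof.
apply: bounded_integrable => [|x]; last exact: cos_bound.
apply: borelRd_measurable_real; exact: continuous_cos_dotp.
Qed.

Lemma integrable_sin_dotp P t :
  P.-integrable setT (EFin \o (fun x : borelRd R d => sin (dotp t x))).
Proof.
apply: bounded_integrable => [|x]; last exact: sin_bound.
apply: borelRd_measurable_real; exact: continuous_sin_dotp.
Qed.

Lemma dotpDr t m x : dotp t (x + m) = dotp t x + dotp t m.
Proof.
by rewrite /dotp -big_split /=; apply: eq_bigr => i _; rewrite !mxE mulrDr.
Qed.

Lemma charfun_shift P t m :
  cis (dotp t m) * charfun P t =
    ((\int[P]_x cos (dotp t ((x : 'rV[R]_d) + m))) +i*
     (\int[P]_x sin (dotp t ((x : 'rV[R]_d) + m))))%C.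
Proof.
have ic := integrable_cos_dotp P t; have ie := integrable_sin_dotp P t.
have -> : \int[P]_x cos (dotp t ((x : 'rV[R]_d) + m)) =
    \int[P]_x cos (dotp t x) * cos (dotp t m) - \int[P]_x sin (dotp t x) * sin (dotp t m).
  rewrite -!RintegralZr // -RintegralB //; last 2 first.
  - by have := integrableZr measurableT (cos (dotp t m)) ic.
  - by have := integrableZr measurableT (sin (dotp t m)) ie.
  by apply: eq_Rintegral => x _; rewrite dotpDr cosD.
have -> : \int[P]_x sin (dotp t ((x : 'rV[R]_d) + m)) =
    \int[P]_x sin (dotp t x) * cos (dotp t m) + \int[P]_x cos (dotp t x) * sin (dotp t m).
  rewrite -!RintegralZr // -RintegralD //; last 2 first.
  - by have := integrableZr measurableT (cos (dotp t m)) ie.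
  - by have := integrableZr measurableT (sin (dotp t m)) ic.
  by apply: eq_Rintegral => x _; rewrite dotpDr sinD.
by rewrite /cis /charfun; simpc; congr (_ +i* _)%C; ring.
Qed.

(** A crude bound, whose role is to make the set in [FFD] bounded, so that its [sup] dominates its
    elements. *)
Lemma charfun_le2 P t : cmod (charfun P t) <= 2.
Proof.
have i0 : P.-integrable setT (EFin \o (fun=> 0 : R)).
  exact: finite_measure_integrable_cst.
have e0 : \int[P]_x (fun=> 0 : R) x = 0 by rewrite Rintegral_cst // mul0r.
rewrite (le_trans (cmod_le_ReIm _)) //= mulr2n; apply: lerD.
  rewrite -[X in `|X|]subr0 -[X in `|_ - X|]e0.
  by apply: Rintegral_dist => // [|x]; [exact: integrable_cos_dotp|rewrite subr0 cos_bound].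
rewrite -[X in `|X|]subr0 -[X in `|_ - X|]e0.
by apply: Rintegral_dist => // [|x]; [exact: integrable_sin_dotp|rewrite subr0 sin_bound].
Qed.

Lemma SFD_lower a c1 c2 P (T : R) t : SFD a c1 c2 P -> 1 <= T -> norm2 t <= T ->
  a * d%:R `^ (- c1) * T `^ (- c2) <= cmod (charfun P t).
Proof.
move=> sfd T1 tT; apply: le_trans (sfd T T1) _; apply: ge_inf; last by exists t.
by exists 0 => _ [s _ <-]; exact: cmod_ge0.
Qed.

Lemma FFD_upper A c1 c2 P (T : R) t : FFD A c1 c2 P -> 1 <= T -> T <= norm2 t ->
  cmod (charfun P t) <= A * d%:R `^ (- c1) * T `^ (- c2).
Proof.
move=> ffd T1 tT; apply: le_trans (ffd T T1); apply: ub_le_sup; last by exists t.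
by exists 2 => _ [s _ <-]; exact: charfun_le2.
Qed.

Definition empirical_charfun n (x : 'I_n -> 'rV[R]_d) t : R[i] :=
  n%:R^-1%:C%C * \sum_i cis (dotp t (x i)).

Section EmpiricalProcess.
Context {J : finType}.
Variables (W : J -> R) (P : J -> probability (borelRd R d) R) (m : J -> 'rV[R]_d).

Definition mix_charfun t : R[i] :=
  \sum_j (W j)%:C%C * (cis (dotp t (m j)) * charfun (P j) t).

Lemma mix_charfunE t : mix_charfun t =
  ((mix_mean W P m (fun x => cos (dotp t x))) +i*
   (mix_mean W P m (fun x => sin (dotp t x))))%C.
Proof.
rewrite /mix_charfun /mix_mean.
rewrite (eq_bigr (fun j => (W j * \int[P j]_x cos (dotp t ((x : 'rV[R]_d) + m j)) +i*
  (W j * \int[P j]_x sin (dotp t ((x : 'rV[R]_d) + m j))))%C)).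
  by elim/big_rec3: _ => // j a b c _ ->; simpc.
by move=> j _; rewrite charfun_shift; simpc.
Qed.

Lemma empirical_charfunE n (x : 'I_n -> 'rV[R]_d) t : empirical_charfun x t =
  ((n%:R^-1 * \sum_i cos (dotp t (x i))) +i* (n%:R^-1 * \sum_i sin (dotp t (x i))))%C.
Proof.
rewrite /empirical_charfun.
have -> : \sum_i cis (dotp t (x i)) =
    ((\sum_i cos (dotp t (x i))) +i* (\sum_i sin (dotp t (x i))))%C.
  by elim/big_rec3: _ => // j a b c _ ->; rewrite /cis; simpc.
by simpc.
Qed.

Lemma union_bound (dO : measure_display) (Omega : measurableType dO)
    (Pr : probability Omega R) (I : finType) (c : R) (Bs : I -> set Omega) :
  (forall i, measurable (Bs i)) -> (forall i, (Pr (Bs i) <= c%:E)%E) ->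
  exists B : set Omega, [/\ measurable B, (Pr B <= (#|I|%:R * c)%:E)%E &
    forall i, Bs i `<=` B].
Proof.
move=> mB PB.
suff : forall s : seq I, exists B : set Omega,
    [/\ measurable B, (Pr B <= ((size s)%:R * c)%:E)%E &
    forall i, i \in s -> Bs i `<=` B].
  move=> /(_ (enum I))[B [mB' PB' sB]]; exists B; split=> //.
    by rewrite -cardE in PB'.
  by move=> i; apply: sB; rewrite mem_enum.
elim=> [|i s [B [mB' PB' sB]]].
  by exists set0; split=> //; rewrite measure0 mul0r.
exists (Bs i `|` B); split; first exact: measurableU.
- rewrite (le_trans (measureU2 _ _ _)) //= -natr1 mulrDl mul1r addrC EFinD.
  exact: leeD.
- move=> j; rewrite inE => /orP[/eqP ->|/sB]; first exact: subsetUl.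
  by move=> h x /h; right.
Qed.

Variable Q : set (borelRd R d) -> \bar R.
Hypothesis W_ge0 : forall j, 0 <= W j.
Hypothesis W_sum : \sum_j W j = 1.
Hypothesis QE : forall S, measurable S ->
  Q S = (\sum_j (W j)%:E * translate (P j) (m j) S)%E.

(** The constants 4 and 6 are twice those of a single concentration bound, for cosine and sine. The
    family of frequencies is deterministic, so it has to be large enough to contain those of all
    random directions. *)
Lemma uniform_concentration (I : finType) (freq : I -> 'rV[R]_d)
    n (dO : measure_display) (Omega : measurableType dO)
    (Pr : probability Omega R) (X : 'I_n -> {RV Pr >-> borelRd R d})
    (U : nat -> {RV Pr >-> R}) (eta : R) :
  iid_with_uniforms Q X U -> (0 < n)%N -> 0 < eta <= 1 ->
  exists B : set Omega,
    [/\ measurable B,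
     (Pr B <= (#|I|%:R * (4 * expR (- (n%:R * eta ^+ 2 / 16))))%:E)%E &
     forall o, ~ B o -> forall i,
       cmod (empirical_charfun (fun j => X j o) (freq i) - mix_charfun (freq i))
         <= 6 * eta].
Proof.
move=> iid n0 eta01.
have H i : exists B : set Omega,
    [/\ measurable B, (Pr B <= (4 * expR (- (n%:R * eta ^+ 2 / 16)))%:E)%E &
     forall o, ~ B o ->
     cmod (empirical_charfun (fun j => X j o) (freq i) - mix_charfun (freq i))
         <= 6 * eta].
  have [B1 [mB1 PB1 h1]] := mixture_concentration W_ge0 W_sum QE iid n0
    (@continuous_cos_dotp (freq i)) (fun x => cos_bound _) eta01.
  have [B2 [mB2 PB2 h2]] := mixture_concentration W_ge0 W_sum QE iid n0
    (@continuous_sin_dotp (freq i)) (fun x => sin_bound _) eta01.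
  exists (B1 `|` B2); split; first exact: measurableU.
    rewrite (le_trans (measureU2 _ _ _)) //.
    have -> : 4 * expR (- (n%:R * eta ^+ 2 / 16)) =
      2 * expR (- (n%:R * eta ^+ 2 / 16)) + 2 * expR (- (n%:R * eta ^+ 2 / 16)).
      by rewrite -mulrDl; congr (_ * _); ring.
    by rewrite EFinD; exact: leeD.
  move=> o /not_orP[/h1 k1 /h2 k2].
  rewrite (le_trans (cmod_le_ReIm _)) // mix_charfunE empirical_charfunE /=.
  lra.
pose Bs i := projT1 (cid (H i)).
have BsP i := projT2 (cid (H i)).
have [||B [mB PB sB]] := @union_bound _ _ Pr I
  (4 * expR (- (n%:R * eta ^+ 2 / 16))) Bs.
- by move=> i; case: (BsP i).
- by move=> i; case: (BsP i).
exists B; split=> // o nB i; case: (BsP i) => _ _; apply => bo.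
by apply: nB; exact: (sB i).
Qed.

End EmpiricalProcess.
End CharacteristicFunctions.

(** * Correctness of a round *)

Lemma norm2_le_sum (R : realType) d (x : 'rV[R]_d) : norm2 x <= \sum_i `|x 0 i|.
Proof.
have S0 : 0 <= \sum_i `|x 0 i| by exact: sumr_ge0.
rewrite -[leRHS]ger0_norm // -sqrtr_sqr ler_sqrt ?sqr_ge0 // expr2 mulr_suml.
apply: ler_sum => i _; rewrite -expr2 -real_normK ?num_real // expr2.
by rewrite ler_wpM2l // [leRHS](bigD1 i) //= lerDl sumr_ge0.
Qed.

Section Round.
Context {R : realType}.
Variables (N b' : nat).
Local Notation b := (b' + 22)%N.

(* A window of L frequencies spaced by step_h resolves 1 / (L * step_h) at the
   scale of the projections <v, mu_j>, which are N^-2 / 2 apart: N^-b for the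
   long window, against the spacing N^-(b+2) of the candidates, and N^-(b-4) for
   the short one, so coarse that the peak of its kernel is flat over the error
   N^-(b-2) of an accepted candidate.  The frequencies themselves lie between
   step_h * long_window = N^b and N^(b+5). *)
Definition step_h : R := (N ^ 8)%:R^-1.
Definition long_window : nat := N ^ (8 + b).
Definition short_window : nat := N ^ (4 + b).
Definition candidate (i : nat) : R := i%:R / (N ^ (b + 2))%:R - (N ^ 5)%:R.
Definition candidates : nat := N ^ (b + 8).
Definition peak_sep : R := (N ^ 3)%:R^-1.
Definition threshold : R := (2 * N)%:R^-1.

Context {d k : nat}.
Variables (g : nat -> 'rV[R]_d -> R[i]).

Definition long_deconv x : R[i] := deconv step_h long_window g long_window 0 x.
Definition short_deconv e x : R[i] := deconv step_h long_window g short_window e x.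

Definition accepted (i : nat) : bool := threshold <= cmod (long_deconv (candidate i)).
Definition peaks : seq nat :=
  scan k accepted candidate (candidate 0 - peak_sep) peak_sep candidates.
Definition weight_estimate x : R := cmod (short_deconv 0 x).
Definition mean_estimate x : 'rV[R]_d :=
  \row_i (complex.Im (short_deconv (delta_mx 0 i) x / short_deconv 0 x) / step_h).

Variables (mu : 'I_k -> 'rV[R]_d) (w : 'I_k -> R) (v : 'rV[R]_d).
Hypothesis N_large : (100 <= N)%N.
Hypothesis d_le : (d <= N)%N.
Hypothesis v_bound : forall l, 0 <= v 0 l <= (N ^ 3)%:R.
Hypothesis mu_bound : forall j l, `|mu j 0 l| <= N%:R.
Hypothesis w_low : forall j, N%:R^-1 <= w j.
Hypothesis w_sum : \sum_j w j <= 1.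
Hypothesis g_approx : forall s e, (s < long_window)%N -> offset e ->
  cmod (g s e - \sum_(j < k) (w j)%:C%C *
    cis (dotp (grid_freq step_h long_window v s e) (mu j))) <= (N ^ 14)%:R^-1.

(** Every scale becomes a fixed power of [y], possibly times [q] or its inverse. The exponent [b'],
    which depends on the decay constants, is confined to [q] with [0 < q <= 1], so the estimates
    reduce to comparing small powers of [y]. *)
Let y : R := N%:R^-1.
Let q : R := y ^+ b'.

Let N0 : (0 < N)%N. Proof. exact: leq_trans N_large. Qed.
Let Np : 0 < N%:R :> R. Proof. by rewrite ltr0n; apply: leq_trans N_large. Qed.
Let y0 : 0 < y. Proof. by rewrite invr_gt0. Qed.
Let y1 : y <= 100^-1.
Proof. by rewrite lef_pV2 ?posrE // ler_nat. Qed.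
Let ypow m : 0 < y ^+ m. Proof. exact: exprn_gt0. Qed.
Let ystep m : y ^+ m.+1 <= y ^+ m / 100.
Proof. by rewrite exprSr ler_wpM2l // ltW. Qed.
Let y2 : y ^+ 2 <= y / 100.
Proof. by have := ystep 1; rewrite expr1. Qed.
Let ymono m l : (m <= l)%N -> y ^+ l <= y ^+ m.
Proof. by move=> ml; rewrite ler_wiXn2l //; [exact: ltW|move: y1; lra]. Qed.
Let q0 : 0 < q. Proof. exact: exprn_gt0. Qed.
Let q1 : q <= 1.
Proof. by rewrite exprn_ile1 // ?ltW //; move: y1; lra. Qed.
Let NX m : (N ^ m)%:R^-1 = y ^+ m :> R.
Proof. by rewrite natrX exprVn. Qed.
Let NXE m : (N ^ m)%:R = (y ^+ m)^-1 :> R.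
Proof. by rewrite -NX invrK. Qed.

Let hE : step_h = y ^+ 8. Proof. exact: NX. Qed.
Let longE : long_window%:R * step_h = (q * y ^+ 22)^-1.
Proof.
rewrite hE /long_window NXE exprD invfM mulrAC mulVf ?gt_eqF // mul1r.
by rewrite exprD.
Qed.
Let shortE : short_window%:R * step_h = (q * y ^+ 18)^-1.
Proof.
rewrite hE /short_window NXE /q -exprD.
have -> : (4 + b = 8 + (b' + 18))%N by lia.
by rewrite exprD invfM mulrAC mulVf ?gt_eqF // mul1r.
Qed.
Let sepE : peak_sep = y ^+ 3. Proof. exact: NX. Qed.
Let thrE : threshold = y / 2.
Proof. by rewrite /threshold natrM invfM mulrC. Qed.
Let w_ge0 j : 0 <= w j. Proof. by apply: le_trans (w_low j); exact: ltW. Qed.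
Let h0 : 0 < step_h. Proof. by rewrite hE. Qed.

Let long0 : (0 < long_window <= long_window)%N.
Proof. by rewrite leqnn andbT expn_gt0 N0. Qed.
Let short0 : (0 < short_window <= long_window)%N.
Proof.
by rewrite expn_gt0 N0 leq_pexp2l // leq_add2r.
Qed.

(** At most [d <= N] products of size [N ^ 3 * N]; hence the origin [- N ^ 5] of the candidates. *)
Let proj_bound j : `|mean_proj mu v j| <= (N ^ 5)%:R.
Proof.
rewrite /mean_proj /dotp (le_trans (ler_norm_sum _ _ _)) //.
apply: (@le_trans _ _ (\sum_(l < d) (N ^ 4)%:R)).
  apply: ler_sum => l _; rewrite normrM (expnSr N 3) natrM.
  by have /andP[v0 v1] := v_bound l; rewrite ler_pM // ger0_norm.
by rewrite sumr_const card_ord -[leLHS]mulr_natl -natrM ler_nat expnS leq_mul2r d_le orbT.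
Qed.

(** The differences are at most [2 * N ^ 6], and the step [N ^ -8] brings them into the range where
    the kernel has a single peak. *)
Let candidate_range j i : (i < candidates)%N ->
  step_h * `|mean_proj mu v j - candidate i| <= 2^-1.
Proof.
move=> iG.
have i1 : i%:R / (N ^ (b + 2))%:R <= (N ^ 6)%:R :> R.
  rewrite ler_pdivrMr; last by rewrite ltr0n expn_gt0 N0.
  by rewrite -natrM ler_nat -expnD (leq_trans (ltnW iG)) // /candidates leq_pexp2l //; lia.
have i0 : 0 <= i%:R / (N ^ (b + 2))%:R :> R by rewrite divr_ge0.
have N56 : (N ^ 5)%:R <= (N ^ 6)%:R :> R by rewrite ler_nat leq_pexp2l.
have h1 : `|mean_proj mu v j - candidate i| <= 2 * (N ^ 6)%:R.
  by have := proj_bound j; rewrite /candidate !ler_norml; lra.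
apply: (le_trans (ler_wpM2l (ltW h0) h1)).
have -> : step_h * (2 * (N ^ 6)%:R) = 2 * y ^+ 2.
  by rewrite hE NXE (exprD y 2 6); field; rewrite gt_eqF.
by move: y2 y1 y0; lra.
Qed.

(** At distance [r] the kernel of the long window has dropped to [4 * y ^ 2], below a quarter of the
    threshold [y / 2]. *)
Let r : R := q * y ^+ 20.
Let r0 : 0 < r. Proof. by rewrite mulr_gt0. Qed.

Let accepted_near i : accepted i -> (i < candidates)%N ->
  exists j, `|mean_proj mu v j - candidate i| <= r.
Proof.
move=> ai iG; apply: (deconv_detect g_approx h0 w_ge0 w_sum long0 r0 _ _ _ _ ai).
- by move=> j; exact: candidate_range.
- rewrite mulrA longE thrE /r (exprD y 2 20).
  have -> : 4 / ((q * (y ^+ 2 * y ^+ 20))^-1 * (q * y ^+ 20)) = 4 * y ^+ 2.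
    by field; rewrite !gt_eqF.
  by move: y2 y0; lra.
- by rewrite thrE divr_gt0.
- by rewrite NX thrE; have := ymono (isT : (2 <= 14)%N); move: y2 y0; lra.
Qed.

(** Candidates are accepted near projections only and the kept ones are [N ^ -3] apart, so a full
    list determines a permutation and isolates every projection, whatever the direction. *)
Lemma peaks_accurate : size peaks = k ->
  exists s : {perm 'I_k}, forall j,
    let x := candidate (nth 0%N peaks (s j)) in
    norm2 (mu j - mean_estimate x) <= y /\ `|w j - weight_estimate x| <= y.
Proof.
move=> szk.
have sep0 : 0 < peak_sep by rewrite sepE.
have rs : 2 * r < peak_sep.
  rewrite sepE /r; have := ymono (isT : (4 <= 20)%N); have := ystep 3.
  have := ypow 3; have := ypow 20; have := q1; have := q0; nra.
have [s sP] := scan_recover sep0 szk rs accepted_near.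
exists s => j x; have [ix ax xr xfar] := sP j; rewrite -/x in xr xfar.
have far0 : 0 < y ^+ 3 / 2 by rewrite divr_gt0.
have xfar' c : c != j -> y ^+ 3 / 2 <= `|mean_proj mu v c - x| /\
    step_h * `|mean_proj mu v c - x| <= 2^-1.
  move=> cj; split; last exact: candidate_range.
  by apply: le_trans (xfar c cj); move: rs; rewrite sepE; lra.
(* The leakage of the other peaks through the short window is [8 * q * y ^ 15], which stays below
   the noise [y ^ 14]. *)
have err : 4 / (short_window%:R * (step_h * (y ^+ 3 / 2))) + (N ^ 14)%:R^-1 <= 2 * y ^+ 14.
  rewrite mulrA shortE NX (exprD y 15 3).
  have -> : 4 / ((q * (y ^+ 15 * y ^+ 3))^-1 * (y ^+ 3 / 2)) = 8 * (q * y ^+ 15).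
    by field; rewrite !gt_eqF.
  by have := ystep 14; have := ypow 15; have := q1; have := q0; nra.
have hw := deconv_weight g_approx h0 w_ge0 w_sum short0 xr far0 xfar'.
have hw' : `|cmod (short_deconv 0 x) - w j| <= 2 * y ^+ 2 + 2 * y ^+ 14.
  apply: (le_trans hw); apply: lerD; last exact: err.
  rewrite (mulrA short_window%:R) shortE /r (exprD y 2 18).
  have -> : (q * y ^+ 18)^-1 * (q * (y ^+ 2 * y ^+ 18)) = y ^+ 2.
    by field; rewrite !gt_eqF.
  by [].
have y14 := ymono (isT : (3 <= 14)%N); have y3 := ystep 2.
split; last first.
  by rewrite distrC; apply: (le_trans hw'); move: y14 y3 y2 y0; lra.
have wl0 : 0 < y / 2 by rewrite divr_gt0.
have wl : y / 2 <= cmod (short_deconv 0 x).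
  by move: hw' (w_low j) y14 y3 y2 y0; rewrite -/y ler_norml; lra.
(* The exponent 4 leaves room for the sum over [d <= N] coordinates, since [N * y ^ 4 = y ^ 3]. *)
have hm i : `|(mu j - mean_estimate x) 0 i| <= y ^+ 4.
  have := deconv_mean g_approx h0 w_ge0 w_sum short0 far0 xfar' i wl0 wl.
  rewrite !mxE distrC => /le_trans; apply.
  apply: (@le_trans _ _ (2 * (2 * y ^+ 14) / (y / 2 * step_h) + step_h * (y ^+ 2)^-1)).
    apply: lerD.
      by rewrite ler_pM2r ?invr_gt0 ?mulr_gt0 // ler_pM2l.
    rewrite ler_wpM2l ?(ltW h0) // -real_normK ?num_real // -exprVn invrK.
    by rewrite lerXn2r ?nnegrE.
  rewrite hE (exprD y 5 9) (exprD y 6 2) (exprD y 1 8) expr1.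
  have -> : 2 * (2 * (y ^+ 5 * (y * y ^+ 8))) / (y / 2 * (y ^+ 6 * y ^+ 2)) +
      y ^+ 6 * y ^+ 2 / y ^+ 2 = 8 * y ^+ 5 + y ^+ 6.
    rewrite -(exprD y 6 2); by field; rewrite gt_eqF.
  by have := ystep 4; have := ystep 5; have := ypow 4; lra.
apply: (le_trans (norm2_le_sum _)); apply: (@le_trans _ _ (\sum_(i < d) y ^+ 4)).
  by apply: ler_sum => i _; exact: hm.
rewrite sumr_const card_ord -[leLHS]mulr_natl.
apply: (@le_trans _ _ (N%:R * y ^+ 4)).
  by rewrite ler_wpM2r ?(ltW (ypow 4)) // ler_nat.
rewrite exprS mulrA mulfV ?gt_eqF // mul1r; move: y2 y3 y0; lra.
Qed.

(** Each projection has a candidate within the spacing [rho], where the long kernel is within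
    [2 * y ^ 2] of 1. The value there is close to [w j >= y], hence above the threshold [y / 2]. *)
Lemma peaks_complete :
  (forall j c, j != c -> (2 * N ^ 2)%:R^-1 <= `|mean_proj mu v j - mean_proj mu v c|) ->
  size peaks = k.
Proof.
move=> good.
have sep0 : 0 < peak_sep by rewrite sepE.
have good' j c : j != c -> y ^+ 2 / 2 <= `|mean_proj mu v j - mean_proj mu v c|.
  by move=> /good; rewrite natrM invfM NX mulrC.
pose rho : R := q * y ^+ 24.
have cn i : candidate i = i%:R * rho - (N ^ 5)%:R.
  rewrite /candidate NX /rho /q -exprD.
  by have -> : (b + 2 = b' + 24)%N by rewrite -addnA.
have rho0 : 0 < rho by rewrite mulr_gt0.
apply: (@scan_complete _ _ _ _ _ _ sep0 _ _ rho (mean_proj mu v)).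
- move=> i; rewrite subrK /candidate mul0r sub0r lerDr divr_ge0 //.
- by move=> i j ij; rewrite !cn lerD2r ler_pM2r // ler_nat.
- move=> j.
  (* [u] is the position of the projection in units of the spacing; its integer part is the
     candidate just to its left. *)
  pose u := (mean_proj mu v j + (N ^ 5)%:R) / rho.
  have := proj_bound j; rewrite ler_norml => /andP[z1 z2].
  have u0 : 0 <= u by rewrite divr_ge0 ?(ltW rho0) //; lra.
  have /andP[t1 t2] := truncn_itv u0.
  exists (Num.truncn u).
  have ui : `|mean_proj mu v j - candidate (Num.truncn u)| <= rho.
    rewrite cn.
    have -> : mean_proj mu v j - ((Num.truncn u)%:R * rho - (N ^ 5)%:R) =
       (u - (Num.truncn u)%:R) * rho.
      by rewrite /u; field; rewrite gt_eqF.
    rewrite normrM (gtr0_norm rho0) ler_piMl ?(ltW rho0) // ler_norml.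
    by rewrite -natr1 in t2; lra.
  have iG : (Num.truncn u < candidates)%N.
    rewrite truncn_lt_nat // /u ltr_pdivrMr // /candidates.
    have -> : (N ^ (b + 8))%:R * rho = (N ^ 6)%:R :> R.
      have -> : (b + 8 = (b' + 24) + 6)%N by rewrite -!addnA.
      rewrite expnD natrM /rho /q -exprD mulrAC [X in X * _](_ : _ = 1) ?mul1r //.
      by rewrite NXE mulVf // gt_eqF.
    have : (N ^ 6)%:R = N%:R * (N ^ 5)%:R :> R by rewrite expnS natrM.
    have : 100 <= N%:R :> R by rewrite ler_nat.
    have : 0 < (N ^ 5)%:R :> R by rewrite NXE invr_gt0.
    nra.
  split=> //; rewrite /accepted.
  set x := candidate _ in ui *.
  have rs : rho <= y ^+ 3.
    rewrite /rho; have := ymono (isT : (3 <= 24)%N); have := ypow 24; move: q1 q0; nra.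
  have y3 := ystep 2.
  have far0 : 0 < y ^+ 2 / 4 by rewrite divr_gt0.
  have xfar c : c != j -> y ^+ 2 / 4 <= `|mean_proj mu v c - x| /\
    step_h * `|mean_proj mu v c - x| <= 2^-1.
    move=> cj; split; last exact: candidate_range.
    have h1 := good' c j cj.
    have h2 := ler_distD x (mean_proj mu v c) (mean_proj mu v j).
    rewrite (distrC x) in h2; lra.
  have hw := deconv_weight g_approx h0 w_ge0 w_sum long0 ui far0 xfar.
  have : `|cmod (long_deconv x) - w j| <= 2 * y ^+ 2 + 2 * y ^+ 14.
    apply: (le_trans hw); apply: lerD.
      rewrite (mulrA long_window%:R) longE /rho (exprD y 2 22).
      have -> : (q * y ^+ 22)^-1 * (q * (y ^+ 2 * y ^+ 22)) = y ^+ 2.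
        by field; rewrite !gt_eqF.
      by [].
    rewrite mulrA longE NX (exprD y 20 2).
    have -> : 4 / ((q * (y ^+ 20 * y ^+ 2))^-1 * (y ^+ 2 / 4)) = 16 * (q * y ^+ 20).
      by field; rewrite !gt_eqF.
    have := ystep 14; have := ymono (isT : (15 <= 20)%N); have := ypow 20; have := q1; have := q0; nra.
  have := ymono (isT : (3 <= 14)%N).
  by move: (w_low j) y3 y2 y0; rewrite -/y thrE ler_norml; lra.
- move=> j c /good'.
  have : rho <= y ^+ 4.
    rewrite /rho; have := ymono (isT : (4 <= 24)%N); have := ypow 24; move: q1 q0; nra.
  have := ystep 2; have := ystep 3; have := ypow 2; rewrite sepE; lra.
Qed.

End Round.

(** * The program *)

(** The bound [e] is evaluated anew at each test, so the body has to preserve its value. *)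
Definition for_loop (i : nat) (e : iexp) (c : program) : program :=
  Seq (ISet (IConst i) (IConst 0))
    (While (Not (ILe e (ILoad (IConst i))))
       (Seq c (ISet (IConst i) (IAdd (ILoad (IConst i)) (IConst 1))))).

(** * A program logic with time bounds *)

Section Runs.
Context {R : realType} {d : nat}.
Variables (phi : 'rV[R]_d -> R[i]) (u : nat -> R).
Local Notation state := (@state R).
Implicit Types (s : state) (Q : state -> Prop).

(** Total correctness with a time budget. [Q] serves as a continuation, so that [runs_seq] chains
    instructions without intermediate assertions. *)
Definition runs c s (t : nat) Q : Prop :=
  exists t' s', [/\ exec phi u c s t' s', (t' <= t)%N & Q s'].

Lemma runs_weaken c s t t' Q Q' : runs c s t Q -> (t <= t')%N ->
  (forall s', Q s' -> Q' s') -> runs c s t' Q'.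
Proof.
move=> [t1 [s1 [e1 l1 q1]]] tt' QQ'; exists t1, s1.
by split; [exact: e1|exact: leq_trans tt'|exact: QQ'].
Qed.

Lemma runs_skip s Q : Q s -> runs Skip s 1 Q.
Proof. by move=> q; exists 1%N, s; split=> //; constructor. Qed.

Lemma runs_iset a e s Q : Q (iset s (ieval s a) (ieval s e)) -> runs (ISet a e) s 1 Q.
Proof. by move=> q; exists 1%N; eexists; split; [constructor| |exact: q]. Qed.

Lemma runs_rset a e s Q : Q (rset s (ieval s a) (reval s e)) -> runs (RSet a e) s 1 Q.
Proof. by move=> q; exists 1%N; eexists; split; [constructor| |exact: q]. Qed.

Lemma runs_draw a s Q : Q (draw u s (ieval s a)) -> runs (Draw a) s 1 Q.
Proof. by move=> q; exists 1%N; eexists; split; [constructor| |exact: q]. Qed.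

Lemma runs_query a b s Q :
  let z := phi (\row_(l < d) rmem s (ieval s a + l)%N) in
  Q (rset (rset s (ieval s b) (complex.Re z)) (ieval s b).+1 (complex.Im z)) ->
  runs (Query a b) s 1 Q.
Proof. by move=> z q; exists 1%N; eexists; split; [constructor| |exact: q]. Qed.

Lemma runs_seq c1 c2 s t1 t2 Q :
  runs c1 s t1 (fun s1 => runs c2 s1 t2 Q) -> runs (Seq c1 c2) s (t1 + t2) Q.
Proof.
move=> [t1' [s1 [e1 l1 [t2' [s2 [e2 l2 q]]]]]]; exists (t1' + t2')%N, s2.
by split=> //; [exact: exec_Seq e1 e2|exact: leq_add].
Qed.

Lemma runs_then c1 c2 s t1 t2 Q1 Q :
  runs c1 s t1 Q1 -> (forall s1, Q1 s1 -> runs c2 s1 t2 Q) ->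
  runs (Seq c1 c2) s (t1 + t2) Q.
Proof. by move=> h1 h2; apply: runs_seq; exact: runs_weaken h1 _ h2. Qed.

Lemma runs_if b c1 c2 s t Q :
  runs (if teval s b then c1 else c2) s t Q -> runs (If b c1 c2) s t.+1 Q.
Proof. by move=> [t' [s' [e l q]]]; exists t'.+1, s'; split=> //; constructor. Qed.

(** Each pass pays one step for the test and one for the increment; the outer 2 is the
    initialisation and the failing test. [Inv j] describes the state in which the counter already
    holds [j]. *)
Lemma runs_for i e c s b t (Inv : nat -> state -> Prop) Q :
  Inv 0%N (iset s i 0) ->
  (forall j s', (j <= b)%N -> Inv j s' -> imem s' i = j -> ieval s' e = b) ->
  (forall j s', (j < b)%N -> Inv j s' -> imem s' i = j ->
     runs c s' t (fun s'' => imem s'' i = j /\ Inv j.+1 (iset s'' i j.+1))) ->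
  (forall s', Inv b s' -> imem s' i = b -> Q s') ->
  runs (for_loop i e c) s (b * (t + 2) + 2) Q.
Proof.
move=> I0 Ie Is IQ.
suff H : forall m j s', (j + m = b)%N -> Inv j s' -> imem s' i = j ->
    runs (While (Not (ILe e (ILoad (IConst i))))
       (Seq c (ISet (IConst i) (IAdd (ILoad (IConst i)) (IConst 1))))) s'
      (m * (t + 2) + 1) Q.
  have -> : (b * (t + 2) + 2 = 1 + (b * (t + 2) + 1))%N by lia.
  apply: runs_seq; apply: runs_iset; apply: (H _ 0%N) => //=.
  by rewrite eqxx.
elim=> [|m IH] j s' jm Ij ij.
  rewrite addn0 in jm; rewrite jm in Ij ij.
  exists 1%N, s'; split=> //; last exact: IQ.
  by apply: exec_While_false; rewrite /= negbK ij (Ie b).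
have jb : (j < b)%N by lia.
have [t1 [s1 [e1 l1 [ij1 Ij1]]]] := Is j s' jb Ij ij.
have [||t2 [s2 [e2 l2 q]]] := IH j.+1 (iset s1 i j.+1) _ Ij1.
- by lia.
- by rewrite /= eqxx.
exists (t1 + 1 + t2).+1, s2; split=> //; last by lia.
apply: exec_While_true; [|apply: exec_Seq; [exact: e1|apply: exec_ISet]|].
- by rewrite /= -ltnNge ij (Ie j) // ltnW.
- by rewrite /= ij1 addn1.
Qed.

(** The frame condition. [I] is a list because the natural cells are fixed by the program text; [A]
    is a predicate because the real blocks depend on [n], [d] and [k]. *)
Definition unchanged (I : seq nat) (A : pred nat) s s' : Prop :=
  [/\ forall a, a \notin I -> imem s' a = imem s a,
      forall a, ~~ A a -> rmem s' a = rmem s a & drawn s' = drawn s].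

Lemma unchanged_refl I A s : unchanged I A s s.
Proof. by []. Qed.

Lemma unchanged_trans I A s1 s2 s3 :
  unchanged I A s1 s2 -> unchanged I A s2 s3 -> unchanged I A s1 s3.
Proof.
move=> [a1 b1 c1] [a2 b2 c2]; split=> [a h|a h|]; last by rewrite c2.
- by rewrite a2 // a1.
- by rewrite b2 // b1.
Qed.

Lemma unchanged_iset (I : seq nat) A s s' i m :
  i \in I -> unchanged I A s s' -> unchanged I A s (iset s' i m).
Proof.
move=> iI [a1 b1 c1]; split=> //= a h.
by case: eqP => [ai|_]; [rewrite ai iI in h|exact: a1].
Qed.

Lemma unchanged_rset I (A : pred nat) s s' a x :
  A a -> unchanged I A s s' -> unchanged I A s (rset s' a x).
Proof.
move=> Aa [a1 b1 c1]; split=> //= c h.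
by case: eqP => [ca|_]; [rewrite ca Aa in h|exact: b1].
Qed.

Lemma unchanged_sub (I I' : seq nat) (A A' : pred nat) s s' :
  {subset I <= I'} -> (forall a, A a -> A' a) ->
  unchanged I A s s' -> unchanged I' A' s s'.
Proof.
move=> II AA [a1 b1 c1]; split=> // a h.
  by apply: a1; apply: contra h; exact: II.
by apply: b1; apply: contra h; exact: AA.
Qed.

End Runs.

Local Notation nv m := (ILoad (IConst m)).

(** The exponent is a constant of the program text, so a power is an expression of fixed size and
    costs no step of its own. *)
Fixpoint ipow (e : iexp) (m : nat) : iexp :=
  if m is m'.+1 then IMul (ipow e m') e else IConst 1.

Lemma ieval_ipow (R : realType) (s : @state R) e m :
  ieval s (ipow e m) = (ieval s e ^ m)%N.
Proof. by elim: m => //= m IH; rewrite expnSr -IH. Qed.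

Local Opaque ipow.

(* Natural memory: 0, 1, 2 hold n, d, k; 3 the parameter N; 4 the round, 5 the
   candidate, 6 the frequency, 7 and 8 further counters, 9 the number of peaks,
   10 the window, 11 the offset coordinate; 12, 13, 14, 15 point to the blocks
   of the real memory: the current candidate, the last peak and a complex
   number, then the direction, then the estimates, then the scratch area. *)
Section Program.
Variable b' : nat.
Local Notation b := (b' + 22)%N.

Definition scratch (j : nat) : iexp := IAdd (nv 15) (IConst j).
Definition scalar (j : nat) : iexp := IAdd (nv 12) (IConst j).
Definition rNpow (m : nat) : rexp := RNat (ipow (nv 3) m).

(* The coordinate number [nv 11] is offset; the truncated subtractions compute
   the indicator of [nv 8 = nv 11], and [nv 11 = d] stands for no offset. *)
Definition frequency_prog : program :=
  for_loop 8 (nv 1)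
    (RSet (IAdd (scratch 8) (nv 8))
      (RDiv (RAdd (RMul (RNat (IAdd (ipow (nv 3) (8 + b)) (nv 6)))
                        (RLoad (IAdd (nv 13) (nv 8))))
                  (RNat (ISub (IConst 1)
                    (IAdd (ISub (nv 8) (nv 11)) (ISub (nv 11) (nv 8))))))
            (rNpow 8))).

(** The phase [(L1 + s) h x] is subtracted inside the cosine and the sine of every sample, in place
    of a complex multiplication of their sum. *)
Definition sample_prog : program :=
  for_loop 7 (nv 0)
    (Seq (RSet (scratch 7) (RSub (RNat (IConst 0)) (RLoad (scratch 6))))
    (Seq (for_loop 8 (nv 1)
           (RSet (scratch 7) (RAdd (RLoad (scratch 7))
             (RMul (RLoad (IAdd (scratch 8) (nv 8)))
               (RLoad (IAdd (IConst 2) (IAdd (IMul (nv 7) (nv 1)) (nv 8))))))))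
    (Seq (RSet (scratch 2) (RAdd (RLoad (scratch 2)) (RFun Cos (RLoad (scratch 7)))))
         (RSet (scratch 3) (RAdd (RLoad (scratch 3)) (RFun Sin (RLoad (scratch 7)))))))).

Definition oracle_sqnorm : rexp :=
  RAdd (RMul (RLoad (scratch 4)) (RLoad (scratch 4)))
       (RMul (RLoad (scratch 5)) (RLoad (scratch 5))).

(** Scratch cells: 0 and 1 accumulate the deconvolution, 2 and 3 the sums of cosines and sines, 4
    and 5 hold the oracle's answer, 6 the phase, 7 the current angle, and the frequency starts at
    8. *)
Definition deconv_term_prog : program :=
  Seq frequency_prog
  (Seq (Query (scratch 8) (scratch 4))
  (Seq (RSet (scratch 6) (RMul (RNat (IAdd (ipow (nv 3) (8 + b)) (nv 6)))
                               (RDiv (RLoad (scalar 0)) (rNpow 8))))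
  (Seq (RSet (scratch 2) (RNat (IConst 0)))
  (Seq (RSet (scratch 3) (RNat (IConst 0)))
  (Seq sample_prog
  (Seq (RSet (scratch 0) (RAdd (RLoad (scratch 0))
         (RDiv (RDiv (RAdd (RMul (RLoad (scratch 2)) (RLoad (scratch 4)))
                     (RMul (RLoad (scratch 3)) (RLoad (scratch 5)))) oracle_sqnorm)
               (RMul (RNat (nv 0)) (RNat (nv 10))))))
       (RSet (scratch 1) (RAdd (RLoad (scratch 1))
         (RDiv (RDiv (RSub (RMul (RLoad (scratch 3)) (RLoad (scratch 4)))
                     (RMul (RLoad (scratch 2)) (RLoad (scratch 5)))) oracle_sqnorm)
               (RMul (RNat (nv 0)) (RNat (nv 10)))))))))))).

Definition deconv_prog : program :=
  Seq (RSet (scratch 0) (RNat (IConst 0)))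
  (Seq (RSet (scratch 1) (RNat (IConst 0)))
       (for_loop 6 (nv 10) deconv_term_prog)).

Definition hypot (e1 e2 : rexp) : rexp := RFun Sqrt (RAdd (RMul e1 e1) (RMul e2 e2)).

(** The scalars 2 and 3 keep the deconvolution without offset, the common divisor of the [d]
    quotients. The loop over coordinates counts in cell 11 itself, so each pass selects its own
    offset. *)
Definition record_prog : program :=
  Seq (ISet (IConst 10) (ipow (nv 3) (4 + b)))
  (Seq (ISet (IConst 11) (nv 1))
  (Seq deconv_prog
  (Seq (RSet (scalar 2) (RLoad (scratch 0)))
  (Seq (RSet (scalar 3) (RLoad (scratch 1)))
  (Seq (RSet (IAdd (nv 14) (nv 9)) (hypot (RLoad (scalar 2)) (RLoad (scalar 3))))
  (Seq (for_loop 11 (nv 1)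
     (Seq deconv_prog
       (RSet (IAdd (IAdd (nv 14) (nv 2)) (IAdd (IMul (nv 9) (nv 1)) (nv 11)))
         (RDiv (RDiv (RSub (RMul (RLoad (scratch 1)) (RLoad (scalar 2)))
                           (RMul (RLoad (scratch 0)) (RLoad (scalar 3))))
                     (RAdd (RMul (RLoad (scalar 2)) (RLoad (scalar 2)))
                           (RMul (RLoad (scalar 3)) (RLoad (scalar 3)))))
               (RDiv (RNat (IConst 1)) (rNpow 8))))))
  (Seq (RSet (scalar 1) (RLoad (scalar 0)))
       (ISet (IConst 9) (IAdd (nv 9) (IConst 1)))))))))).

Definition sep_rexp : rexp := RDiv (RNat (IConst 1)) (rNpow 3).

Definition scan_prog : program :=
  for_loop 5 (ipow (nv 3) (b + 8))
    (Seq (RSet (scalar 0) (RSub (RDiv (RNat (nv 5)) (rNpow (b + 2))) (rNpow 5)))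
    (Seq (ISet (IConst 10) (ipow (nv 3) (8 + b)))
    (Seq (ISet (IConst 11) (nv 1))
    (Seq deconv_prog
      (If (RLe (RDiv (RNat (IConst 1)) (RNat (IMul (IConst 2) (nv 3))))
               (hypot (RLoad (scratch 0)) (RLoad (scratch 1))))
        (If (RLe (RAdd (RLoad (scalar 1)) sep_rexp) (RLoad (scalar 0)))
          (If (Not (ILe (nv 2) (nv 9))) record_prog Skip) Skip) Skip))))).

(* The inner loop counts the j < M with j + 1 <= M y, that is, it computes the
   integer part of M y, for which the machine has no instruction. *)
Definition direction_prog : program :=
  for_loop 8 (nv 1)
    (Seq (Draw (scratch 2))
    (Seq (RSet (IAdd (nv 13) (nv 8)) (RNat (IConst 1)))
      (for_loop 7 (IMul (IConst 2) (ipow (nv 3) 2))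
        (If (RLe (RNat (IAdd (nv 7) (IConst 1)))
                 (RMul (RNat (IMul (IConst 2) (ipow (nv 3) 2))) (RLoad (scratch 2))))
          (RSet (IAdd (nv 13) (nv 8))
            (RAdd (RLoad (IAdd (nv 13) (nv 8))) (RNat (IConst 1))))
          Skip)))).

Definition round_prog : program :=
  Seq (ISet (IConst 9) (IConst 0))
  (Seq direction_prog
  (Seq (RSet (scalar 1)
         (RSub (RSub (RDiv (RNat (IConst 0)) (rNpow (b + 2))) (rNpow 5)) sep_rexp))
       scan_prog)).

(** [N] grows as long as [N + 1] is admissible. Both conditions are downward closed, and
    [N ^ m <= n] makes [n] attempts enough. *)
Definition parameter_prog (m : nat) : program :=
  Seq (ISet (IConst 3) (IConst 0))
  (for_loop 4 (nv 0)
    (If (ILe (ipow (IAdd (nv 3) (IConst 1)) m) (nv 0))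
      (If (RLe (RMul (RNat (ipow (IAdd (nv 3) (IConst 1)) m))
                     (RFun Ln (RDiv (RNat (IConst 1)) (RLoad (IConst 1)))))
               (RNat (nv 0)))
        (ISet (IConst 3) (IAdd (nv 3) (IConst 1))) Skip) Skip)).

Definition layout_prog : program :=
  Seq (ISet (IConst 12) (IAdd (IConst 2) (IMul (nv 0) (nv 1))))
  (Seq (ISet (IConst 13) (IAdd (nv 12) (IConst 4)))
  (Seq (ISet (IConst 14) (IAdd (nv 13) (nv 1)))
       (ISet (IConst 15) (IAdd (nv 14) (IAdd (nv 2) (IMul (nv 2) (nv 1))))))).

(** The copy overwrites the input and may overlap its source. It goes towards lower addresses in
    increasing order, so every cell is read before it is overwritten. *)
Definition output_prog : program :=
  for_loop 8 (IAdd (nv 2) (IMul (nv 2) (nv 1)))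
    (RSet (nv 8) (RLoad (IAdd (nv 14) (nv 8)))).

(** There are at most [n] rounds, and those after the first full one are skipped, so that its
    estimates stay in memory. *)
Definition main_prog (m : nat) : program :=
  Seq (parameter_prog m)
  (Seq layout_prog
  (Seq (ISet (IConst 9) (IConst 0))
  (Seq (for_loop 4 (nv 0) (If (Not (ILe (nv 2) (nv 9))) round_prog Skip))
       output_prog))).

End Program.

(** * Execution of one round on the machine *)

Section Deconvolve.
Context {R : realType} {d : nat}.
Variables (phi : 'rV[R]_d -> R[i]) (u : nat -> R).
Variables (n k N b' : nat) (x : 'I_n -> 'rV[R]_d).
Local Notation b := (b' + 22)%N.
Local Notation state := (@state R).
Implicit Types (s : state) (v f : 'rV[R]_d) (th X : R).

Definition scalar_addr : nat := (2 + n * d)%N.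
Definition direction_addr : nat := (scalar_addr + 4)%N.
Definition estimate_addr : nat := (direction_addr + d)%N.
Definition scratch_addr : nat := (estimate_addr + (k + k * d))%N.

Record layout s : Prop := Layout {
  layout_n : imem s 0 = n;
  layout_d : imem s 1 = d;
  layout_k : imem s 2 = k;
  layout_N : imem s 3 = N;
  layout_scalar : imem s 12 = scalar_addr;
  layout_direction : imem s 13 = direction_addr;
  layout_estimate : imem s 14 = estimate_addr;
  layout_scratch : imem s 15 = scratch_addr;
  layout_sample : forall (i : 'I_n) (l : 'I_d), rmem s (2 + (i * d + l))%N = x i 0 l }.

Definition has_direction v s : Prop :=
  forall l : 'I_d, rmem s (direction_addr + l)%N = v 0 l.

Definition oracle_ratio v (t : nat) (e : 'rV[R]_d) : R[i] :=
  let f := grid_freq (step_h N) (long_window N b') v t e in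
  empirical_charfun x f / phi f.

Definition unit_offset (off : nat) : 'rV[R]_d := \row_l ((l : nat) == off)%:R.

Definition work : seq nat := [:: 6; 7; 8]%N.

Lemma sample_addr_lt (i : 'I_n) (l : 'I_d) : (2 + (i * d + l) < scalar_addr)%N.
Proof.
rewrite /scalar_addr ltn_add2l; have := ltn_ord i; have := ltn_ord l; nia.
Qed.

Lemma layout_unchanged (I : seq nat) (A : pred nat) s s' :
  all (fun a => a \notin I) [:: 0; 1; 2; 3; 12; 13; 14; 15]%N ->
  (forall a, A a -> (scalar_addr <= a)%N) ->
  unchanged I A s s' -> layout s -> layout s'.
Proof.
move=> /and5P[i0 i1 i2 i3 /and5P[i12 i13 i14 i15 _]] hA [iu ru _] [? ? ? ? ? ? ? ? xs].
split; rewrite ?iu // => i l; rewrite ru ?xs //.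
by apply/negP => /hA; rewrite leqNgt sample_addr_lt.
Qed.

Lemma runs_frequency v s t off : layout s -> has_direction v s ->
  imem s 6 = t -> imem s 11 = off ->
  runs phi u (frequency_prog b') s (d * 3 + 2) (fun s' =>
    unchanged [:: 8] (fun a => scratch_addr + 8 <= a)%N s s' /\
    forall l : 'I_d, rmem s' (scratch_addr + 8 + l)%N =
      grid_freq (step_h N) (long_window N b') v t (unit_offset off) 0 l).
Proof.
move=> Ls vs t6 o11.
pose U := unchanged [:: 8] (fun a => scratch_addr + 8 <= a)%N s.
have UL s' : U s' -> layout s'.
  move=> us; apply: layout_unchanged us Ls => // a.
  by rewrite /scratch_addr /estimate_addr /direction_addr; lia.
apply: (runs_for (t := 1) (Inv := fun j s' => U s' /\
  forall l : 'I_d, (l < j)%N -> rmem s' (scratch_addr + 8 + l)%N =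
      grid_freq (step_h N) (long_window N b') v t (unit_offset off) 0 l)).
- by split=> //; apply: unchanged_iset => //; exact: unchanged_refl.
- by move=> j s' _ [/UL L' _] _ /=; rewrite (layout_d L').
- move=> j s' jd [us fs] ij; have L' := UL _ us; have [iu ru _] := us.
  apply: runs_rset; rewrite /= !ieval_ipow /= ij (layout_scratch L').
  rewrite (layout_direction L') (layout_N L') (iu 6) // (iu 11) // t6 o11.
  split=> //; split.
    apply: unchanged_iset => //; apply: unchanged_rset => //.
    exact: leq_addr.
  move=> l; rewrite ltnS leq_eqVlt /= eqn_add2l => /orP[/eqP lj|lj].
    rewrite lj eqxx -lj ru; last first.
      rewrite -ltnNge /scratch_addr /estimate_addr; have := ltn_ord l; lia.
    rewrite vs !mxE /step_h /long_window mulrC; congr (_ * (_ + _)).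
    by congr (_%:R); case: eqP => [->|]; lia.
  by rewrite (ltn_eqF lj); apply: fs.
- by move=> s' [us fs] _; split=> // l; apply: fs.
Qed.

Lemma sum_ord_ltS (V : zmodType) m (F : 'I_m -> V) (j : 'I_m) :
  \sum_(l < m | (l < j.+1)%N) F l = \sum_(l < m | (l < j)%N) F l + F j.
Proof.
rewrite (bigD1 j) //= addrC; congr (_ + _); apply: eq_bigl => l.
by rewrite ltnS ltn_neqAle andbC -val_eqE.
Qed.

Lemma runs_dot f (i : 'I_n) (c : R) s : layout s ->
  (forall l : 'I_d, rmem s (scratch_addr + 8 + l)%N = f 0 l) ->
  imem s 7 = i -> rmem s (scratch_addr + 7)%N = c ->
  runs phi u (for_loop 8 (nv 1)
           (RSet (scratch 7) (RAdd (RLoad (scratch 7))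
             (RMul (RLoad (IAdd (scratch 8) (nv 8)))
               (RLoad (IAdd (IConst 2) (IAdd (IMul (nv 7) (nv 1)) (nv 8)))))))) s
    (d * 3 + 2) (fun s' => unchanged [:: 8]%N (pred1 (scratch_addr + 7)%N) s s' /\
      rmem s' (scratch_addr + 7)%N = c + dotp f (x i)).
Proof.
move=> Ls fs i7 cs.
pose U := unchanged [:: 8]%N (pred1 (scratch_addr + 7)%N) s.
have UL s' : U s' -> layout s'.
  move=> us; apply: layout_unchanged us Ls => // a /eqP ->.
  by rewrite /scratch_addr /estimate_addr /direction_addr; lia.
apply: (runs_for (t := 1) (Inv := fun j s' => U s' /\
  rmem s' (scratch_addr + 7)%N = c + \sum_(l < d | (l < j)%N) f 0 l * x i 0 l)).
- split; first by apply: unchanged_iset => //; exact: unchanged_refl.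
  by rewrite big_pred0 ?addr0.
- by move=> j s' _ [/UL L' _] _ /=; rewrite (layout_d L').
- move=> j s' jd [us ss] ij; have L' := UL _ us; have [iu ru _] := us.
  apply: runs_rset; rewrite /= ij (layout_scratch L') (layout_d L') (iu 7)%N // i7.
  split=> //; split.
    apply: unchanged_iset => //; apply: unchanged_rset => //.
    by rewrite /= eqxx.
  rewrite /= eqxx ss -addrA (sum_ord_ltS _ (Ordinal jd)) /=.
  have -> : rmem s' (scratch_addr + 8 + j)%N = f 0 (Ordinal jd).
    by rewrite ru /= ?(fs (Ordinal jd)) //; apply/eqP; lia.
  by rewrite (layout_sample L' i (Ordinal jd)).
- move=> s' [us fs'] _; split=> //; rewrite fs' /dotp.
  by congr (_ + _); apply: eq_bigl => l; rewrite ltn_ord.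
Qed.

Lemma runs_samples f th s : layout s ->
  (forall l : 'I_d, rmem s (scratch_addr + 8 + l)%N = f 0 l) ->
  rmem s (scratch_addr + 6)%N = th ->
  rmem s (scratch_addr + 2)%N = 0 -> rmem s (scratch_addr + 3)%N = 0 ->
  runs phi u sample_prog s (n * (d * 3 + 7) + 2) (fun s' =>
    [/\ unchanged [:: 7; 8]%N (fun a => [|| a == scratch_addr + 2,
          a == scratch_addr + 3 | a == scratch_addr + 7])%N s s',
      rmem s' (scratch_addr + 2)%N = \sum_i cos (dotp f (x i) - th) &
      rmem s' (scratch_addr + 3)%N = \sum_i sin (dotp f (x i) - th)]).
Proof.
move=> Ls fs ths c0 s0.
pose A a := [|| a == scratch_addr + 2,
          a == scratch_addr + 3 | a == scratch_addr + 7]%N.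
pose U := unchanged [:: 7; 8]%N A s.
have UL s' : U s' -> layout s'.
  move=> us; apply: layout_unchanged us Ls => // a.
  by rewrite /A /scratch_addr /estimate_addr /direction_addr; lia.
have -> : (n * (d * 3 + 7) + 2 = n * ((1 + ((d * 3 + 2) + (1 + 1))) + 2) + 2)%N by lia.
apply: (runs_for (Inv := fun j s' => [/\ U s',
  rmem s' (scratch_addr + 2)%N = \sum_(i < n | (i < j)%N) cos (dotp f (x i) - th) &
  rmem s' (scratch_addr + 3)%N = \sum_(i < n | (i < j)%N) sin (dotp f (x i) - th)])).
- split; first by apply: unchanged_iset => //; exact: unchanged_refl.
    by rewrite big_pred0.
  by rewrite big_pred0.
- by move=> j s' _ [/UL L' _] _ /=; rewrite (layout_n L').
- move=> j s' jn [us cs ss] ij; have L' := UL _ us; have [iu ru _] := us.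
  apply: runs_seq; apply: runs_rset; rewrite /= (layout_scratch L').
  set s1 := rset _ _ _.
  have us1 : U s1 by apply: unchanged_rset => //; rewrite /A eqxx !orbT.
  have L1 := UL _ us1.
  apply: (runs_then (@runs_dot f (Ordinal jn) (- th) s1 _ _ _ _)) => //=.
  + by move=> l; rewrite -addnA eqn_add2l /= ru ?fs ?addnA //= /A; apply/negP; lia.
  + by rewrite eqxx ru ?ths ?sub0r // /A !eqn_add2l.
  + move=> s2 [us2 d2]; have [iu2 ru2 _] := us2.
    have us2' : U s2.
      apply: unchanged_trans us1 _; apply: unchanged_sub us2 => // a.
      by rewrite inE => /eqP ->.
      by move=> /eqP ->; rewrite /A eqxx !orbT.
    have L2 := UL _ us2'.
    apply: runs_seq; apply: runs_rset; apply: runs_rset.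
    rewrite /= (layout_scratch L2).
    rewrite !eqn_add2l /= d2 iu2 //= ij; split=> //.
    split.
    * apply: unchanged_iset => //; apply: unchanged_rset; first by rewrite /A eqxx orbT.
      by apply: unchanged_rset => //; rewrite /A eqxx.
    * rewrite ru2 /= ?eqn_add2l //= ?eqn_add2l /= cs.
      by rewrite (sum_ord_ltS _ (Ordinal jn)) /= [- th + _]addrC.
    * rewrite ru2 /= ?eqn_add2l //= ?eqn_add2l /= ss.
      by rewrite (sum_ord_ltS _ (Ordinal jn)) /= [- th + _]addrC.
- move=> s' [us cs ss] _; split=> //; rewrite ?cs ?ss;
  by apply: eq_bigl => i; rewrite ltn_ord.
Qed.

Lemma complex_divE (a1 a2 c1 c2 : R) :
  ((a1 +i* a2) / (c1 +i* c2))%C =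
    (((a1 * c1 + a2 * c2) / (c1 * c1 + c2 * c2)) +i*
     ((a2 * c1 - a1 * c2) / (c1 * c1 + c2 * c2)))%C.
Proof.
have -> : ((c1 +i* c2)^-1 = (c1 / (c1 ^+ 2 + c2 ^+ 2)) +i*
  - (c2 / (c1 ^+ 2 + c2 ^+ 2)))%C by [].
by rewrite -!expr2; simpc; congr (_ +i* _)%C; ring.
Qed.

Definition deconv_summand v off L X (t : nat) : R[i] :=
  let f := grid_freq (step_h N) (long_window N b') v t (unit_offset off) in
  let th := (long_window N b' + t)%:R * (step_h N * X) in
  ((n%:R * L%:R)^-1)%:C%C * ((\sum_i cis (dotp f (x i) - th)) / phi f).

Lemma deconv_sum v off L X :
  deconv (step_h N) (long_window N b') (oracle_ratio v) L (unit_offset off) X =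
    \sum_(t < L) deconv_summand v off L X t.
Proof.
rewrite /deconv mulr_sumr; apply: eq_bigr => t _.
rewrite /oracle_ratio /deconv_summand /empirical_charfun invfM rmorphM.
set f := grid_freq _ _ _ _ _; set th := _%:R * _.
have -> : \sum_i cis (dotp f (x i) - th) = (\sum_i cis (dotp f (x i))) * cis (- th).
  by rewrite mulr_suml; apply: eq_bigr => i _; rewrite cisD.
by ring.
Qed.

Definition term_time : nat := (d * 3 + 2 + (n * (d * 3 + 7) + 2) + 6)%N.

Lemma runs_term v t off L X s : layout s -> has_direction v s ->
  imem s 6 = t -> imem s 10 = L -> imem s 11 = off -> rmem s scalar_addr = X ->
  runs phi u (deconv_term_prog b') s term_time (fun s' =>
    [/\ unchanged [:: 7; 8]%N (fun a => scratch_addr <= a)%N s s',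
      rmem s' scratch_addr =
        rmem s scratch_addr + complex.Re (deconv_summand v off L X t) &
      rmem s' (scratch_addr + 1)%N =
        rmem s (scratch_addr + 1)%N + complex.Im (deconv_summand v off L X t)]).
Proof.
move=> Ls vs t6 L10 o11 Xs.
set f := grid_freq (step_h N) (long_window N b') v t (unit_offset off).
pose th := (long_window N b' + t)%:R * (step_h N * X) : R.
pose U := unchanged [:: 7; 8]%N (fun a => scratch_addr <= a)%N s.
have UL s' : U s' -> layout s'.
  move=> us; apply: layout_unchanged us Ls => // a.
  by rewrite /scratch_addr /estimate_addr /direction_addr; lia.
have -> : (term_time = (d * 3 + 2) + (1 + (1 + (1 + (1 + ((n * (d * 3 + 7) + 2) + (1 + 1)))))))%N.
  by rewrite /term_time; lia.
apply: (runs_then (runs_frequency Ls vs t6 o11)) => s1 [us1 f1].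
have us1' : U s1.
  apply: unchanged_sub us1 => [a|a]; first by rewrite !inE => /eqP ->.
  by apply: leq_trans; exact: leq_addr.
have L1 := UL _ us1'; have [iu1 ru1 _] := us1.
apply: runs_seq; apply: runs_query; rewrite /= (layout_scratch L1) -addnS.
have -> : \row_(l < d) rmem s1 (scratch_addr + 8 + l)%N = f.
  by apply/rowP => l; rewrite mxE f1.
set z := phi f.
apply: runs_seq; apply: runs_rset; apply: runs_seq; apply: runs_rset.
apply: runs_seq; apply: runs_rset.
rewrite /= (layout_scratch L1) !ieval_ipow /= (layout_scalar L1) (layout_N L1).
rewrite !(iu1 6)%N // t6.
have neqZ j : (scalar_addr + 0 == scratch_addr + j)%N = false.
  by apply/eqP; rewrite /scratch_addr /estimate_addr /direction_addr; lia.
rewrite !neqZ addn0 (ru1 scalar_addr); last first.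
  by rewrite -ltnNge /scratch_addr /estimate_addr /direction_addr; lia.
rewrite Xs; set s2 := rset _ _ _.
have us2 : U s2 by do 5 (apply: unchanged_rset; first exact: leq_addr).
have L2 := UL _ us2.
have := @runs_samples f th s2 L2.
move=> /(_ _ _ _ _)/runs_then; apply.
- by move=> l; rewrite /s2 /= -(addnA _ 8 l) !eqn_add2l /= addnA f1.
- by rewrite /s2 /= !eqn_add2l /= /th mulrC [_ * X]mulrC mulrC.
- by rewrite /s2 /= !eqn_add2l.
- by rewrite /s2 /= !eqn_add2l.
move=> s3 [us3 c3 sn3]; have [iu3 ru3 _] := us3.
have us3' : U s3.
  apply: unchanged_trans us2 _; apply: unchanged_sub us3 => // a.
  by case/or3P => /eqP ->; exact: leq_addr.
have L3 := UL _ us3'; have [iU _ _] := us3'.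
have r3 j : (j \notin [:: 2; 3; 7])%N ->
    rmem s3 (scratch_addr + j)%N = rmem s2 (scratch_addr + j)%N.
  by move=> jn; rewrite ru3 // !eqn_add2l; move: jn; rewrite !inE.
apply: runs_seq; apply: runs_rset; apply: runs_rset.
rewrite /= (layout_scratch L3) (layout_n L3) !(iU 10)%N // L10 !eqn_add2l /=.
rewrite c3 sn3 !(r3 4)%N // !(r3 5)%N // !(r3 1)%N // (r3 0)%N //.
have e4 : rmem s2 (scratch_addr + 4)%N = complex.Re z by rewrite /s2 /= !eqn_add2l.
have e5 : rmem s2 (scratch_addr + 5)%N = complex.Im z by rewrite /s2 /= !eqn_add2l.
have e0 : rmem s2 (scratch_addr + 0)%N = rmem s scratch_addr.
  rewrite /s2 /= !eqn_add2l /= ru1 ?addn0 //; lia.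
have e1 : rmem s2 (scratch_addr + 1)%N = rmem s (scratch_addr + 1)%N.
  rewrite /s2 /= !eqn_add2l /= ru1 //; lia.
rewrite e0 e1 e4 e5.
have -> : deconv_summand v off L X t =
   ((n%:R * L%:R)^-1)%:C%C *
   (((\sum_i cos (dotp f (x i) - th)) +i* (\sum_i sin (dotp f (x i) - th))) / z)%C.
  rewrite /deconv_summand -/f -/th; congr (_ * (_ / _)).
  by elim/big_rec3: _ => // i y1 y2 y3 _ ->; rewrite /cis; simpc.
have ez : z = (complex.Re z +i* complex.Im z)%C by case: (z).
rewrite [X in _ * (_ / X)]ez complex_divE /=; split.
- do 2 (apply: unchanged_rset; first exact: leq_addr); exact: us3'.
- rewrite /= addn1 ltn_eqF // addn0 eqxx; congr (_ + _).
  by rewrite !mul0r subr0 mulrC.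
- by rewrite /=; congr (_ + _); rewrite mul0r addr0 mulrC.
Qed.

Definition deconv_time L : nat := (L * (term_time + 2) + 4)%N.

Lemma runs_deconv v off L X s : layout s -> has_direction v s ->
  imem s 10 = L -> imem s 11 = off -> rmem s scalar_addr = X ->
  runs phi u (deconv_prog b') s (deconv_time L) (fun s' =>
    [/\ unchanged work (fun a => scratch_addr <= a)%N s s',
      rmem s' scratch_addr = complex.Re (deconv (step_h N) (long_window N b')
         (oracle_ratio v) L (unit_offset off) X) &
      rmem s' (scratch_addr + 1)%N = complex.Im (deconv (step_h N) (long_window N b')
         (oracle_ratio v) L (unit_offset off) X)]).
Proof.
move=> Ls vs L10 o11 Xs.
pose U := unchanged work (fun a => scratch_addr <= a)%N s.
have UL s' : U s' -> layout s'.
  move=> us; apply: layout_unchanged us Ls => // a.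
  by rewrite /scratch_addr /estimate_addr /direction_addr; lia.
have -> : (deconv_time L = 1 + (1 + (L * (term_time + 2) + 2)))%N.
  by rewrite /deconv_time; lia.
apply: runs_seq; apply: runs_rset; apply: runs_seq; apply: runs_rset.
rewrite /= (layout_scratch Ls); set s1 := rset _ _ _.
have us1 : U s1.
  by do 2 (apply: unchanged_rset; first exact: leq_addr); exact: unchanged_refl.
pose D j := \sum_(t < j) deconv_summand v off L X t.
rewrite deconv_sum.
apply: (runs_for (Inv := fun j s' => [/\ U s',
   rmem s' scratch_addr = complex.Re (D j) &
   rmem s' (scratch_addr + 1)%N = complex.Im (D j)])).
- split; first exact: unchanged_iset.
    by rewrite /= addn1 ltn_eqF // addn0 eqxx /D big_ord0.
  by rewrite /= eqxx /D big_ord0.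
- by move=> j s' _ [[iu _ _] _ _] _ /=; rewrite iu.
- move=> j s' jL [us' re im] ij; have L' := UL _ us'; have [iu ru _] := us'.
  have vs' : has_direction v s'.
    move=> l; rewrite ru ?vs // -ltnNge /scratch_addr /estimate_addr.
    by have := ltn_ord l; lia.
  have Xs' : rmem s' scalar_addr = X.
    by rewrite ru // -ltnNge /scratch_addr /estimate_addr /direction_addr; lia.
  have L10' : imem s' 10 = L by rewrite iu.
  have o11' : imem s' 11 = off by rewrite iu.
  apply: (runs_weaken (runs_term L' vs' ij L10' o11' Xs')) => // s2 [us2 re2 im2].
  have [iu2 _ _] := us2; split; first by rewrite iu2.
  split.
  + apply: unchanged_iset => //; apply: unchanged_trans us' _.
    by apply: unchanged_sub us2 => // a; rewrite !inE => ->; rewrite orbT.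
  + by rewrite /= re2 re /D big_ord_recr /= raddfD.
  + by rewrite /= im2 im /D big_ord_recr /= raddfD.
- by move=> s' [us' re im] _.
Qed.

Lemma unit_offset0 : unit_offset d = 0.
Proof. by apply/rowP => l; rewrite !mxE ltn_eqF. Qed.

Lemma unit_offset_ord (i : 'I_d) : unit_offset i = delta_mx 0 i.
Proof. by apply/rowP => l; rewrite !mxE eqxx. Qed.

Definition weight_at v X : R := weight_estimate N b' (oracle_ratio v) X.
Definition mean_at v X : 'rV[R]_d := mean_estimate N b' (oracle_ratio v) X.

Definition weight_addr (a : nat) : nat := (estimate_addr + a)%N.
Definition mean_addr (a l : nat) : nat := (estimate_addr + k + (a * d + l))%N.

Lemma mean_addr_lt a (l : 'I_d) : (a < k)%N -> (mean_addr a l < scratch_addr)%N.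
Proof.
rewrite /mean_addr /scratch_addr => ak; rewrite -addnA !ltn_add2l.
have := ltn_ord l; nia.
Qed.

Lemma weight_addr_lt a : (a < k)%N -> (weight_addr a < scratch_addr)%N.
Proof. by rewrite /weight_addr /scratch_addr; lia. Qed.

Lemma mean_addr_inj a a' (l l' : 'I_d) : mean_addr a l = mean_addr a' l' -> a = a' /\ l = l'.
Proof.
move=> /addnI e.
have d0 : (0 < d)%N by case: (l) => /= m; case: (d).
have := congr1 (divn^~ d) e; rewrite !divnMDl // !divn_small // !addn0 => ->.
by have := congr1 (modn^~ d) e; rewrite !modnMDl !modn_small // => /ord_inj ->.
Qed.

Lemma rmem_rset s a (y : R) : rmem (rset s a y) a = y.
Proof. by rewrite /= eqxx. Qed.

Lemma rmem_rset_ne s a a' (y : R) : a' <> a -> rmem (rset s a y) a' = rmem s a'.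
Proof. by move=> /eqP h; rewrite /= (negbTE h). Qed.

Ltac solve_addr :=
  rewrite ?/weight_addr ?/mean_addr ?/scratch_addr ?/estimate_addr ?/direction_addr; lia.

(** Everything beyond the input except the direction, which has to survive the scan. *)
Definition scan_memory (a : nat) : bool :=
  (scalar_addr <= a < direction_addr)%N || (estimate_addr <= a)%N.

Lemma layout_scan (I : seq nat) s s' :
  all (fun a => a \notin I) [:: 0; 1; 2; 3; 12; 13; 14; 15]%N ->
  unchanged I scan_memory s s' -> layout s -> layout s'.
Proof.
move=> h; apply: layout_unchanged => // a.
by rewrite /scan_memory /estimate_addr /direction_addr; lia.
Qed.

Lemma direction_scan (I : seq nat) v s s' :
  unchanged I scan_memory s s' -> has_direction v s -> has_direction v s'.
Proof.
move=> [_ ru _] vs l; rewrite ru ?vs // /scan_memory /estimate_addr /direction_addr.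
by have := ltn_ord l; lia.
Qed.

Lemma scratch_scan_memory a : (scratch_addr <= a)%N -> scan_memory a.
Proof. by rewrite /scan_memory /scratch_addr; lia. Qed.

Definition record_time : nat :=
  (deconv_time (short_window N b') + d * (deconv_time (short_window N b') + 3) + 9)%N.

Definition scan_cells : seq nat := [:: 5; 6; 7; 8; 9; 10; 11]%N.

Lemma runs_record v X (c : nat) s : layout s -> has_direction v s ->
  imem s 9 = c -> (c < k)%N -> rmem s scalar_addr = X ->
  runs phi u (record_prog b') s record_time (fun s' =>
    [/\ unchanged [:: 6; 7; 8; 9; 10; 11]%N scan_memory s s',
     imem s' 9 = c.+1, rmem s' (scalar_addr + 1)%N = X,
     (rmem s' (weight_addr c) = weight_at v X /\
      forall l : 'I_d, rmem s' (mean_addr c l) = mean_at v X 0 l) &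
     forall a, (a < c)%N -> rmem s' (weight_addr a) = rmem s (weight_addr a) /\
       forall l : 'I_d, rmem s' (mean_addr a l) = rmem s (mean_addr a l)]).
Proof.
move=> Ls vs c9 ck Xs.
pose I := [:: 6; 7; 8; 9; 10; 11]%N.
pose U := unchanged I scan_memory s.
have UL s' : U s' -> layout s' by move=> us; apply: layout_scan us Ls.
have UV s' : U s' -> has_direction v s' by move=> us; apply: direction_scan us vs.
have scm j : (j < 4)%N -> scan_memory (scalar_addr + j)%N.
  by move=> j4; rewrite /scan_memory /direction_addr; lia.
pose sw := short_window N b'.
pose F0 := deconv (step_h N) (long_window N b') (oracle_ratio v) sw 0 X.
have -> : (record_time = 1 + (1 + (deconv_time sw + (1 + (1 + (1 +
   ((d * (deconv_time sw + 1 + 2) + 2) + (1 + 1))))))))%N.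
  by rewrite /record_time -/sw; lia.
apply: runs_seq; apply: runs_iset; apply: runs_seq; apply: runs_iset.
rewrite /= ieval_ipow /= (layout_N Ls) (layout_d Ls).
set s1 := iset _ _ _.
have us1 : U s1 by do 2 (apply: unchanged_iset => //); exact: unchanged_refl.
apply: (runs_then (runs_deconv (UL _ us1) (UV _ us1) erefl erefl Xs)).
move=> s2; rewrite unit_offset0 -/F0 => -[us2 re2 im2].
have us2' : U s2.
  apply: unchanged_trans us1 _; apply: unchanged_sub us2 => [a|a].
    by rewrite !inE => /or3P[] ->; rewrite ?orbT.
  exact: scratch_scan_memory.
have L2 := UL _ us2'; have [iu2 ru2 _] := us2.
have c2 : imem s2 9 = c by rewrite iu2.
apply: runs_seq; apply: runs_rset; apply: runs_seq; apply: runs_rset.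
apply: runs_seq; apply: runs_rset.
have neZ j a : (j < 4)%N -> (scratch_addr <= a)%N -> (a == scalar_addr + j)%N = false.
  by move=> j4 h; apply/eqP; move: h; rewrite /scratch_addr /estimate_addr /direction_addr; lia.
have neO j a : (j < 4)%N -> (estimate_addr <= a)%N -> (a == scalar_addr + j)%N = false.
  by move=> j4 h; apply/eqP; move: h; rewrite /estimate_addr /direction_addr; lia.
rewrite /= (layout_scalar L2) (layout_scratch L2) (layout_estimate L2) c2.
rewrite (neZ 2%N (scratch_addr + 1)%N) ?leq_addr // !eqn_add2l /= addn0 re2 im2.
set s3 := rset _ _ _.
have us3 : U s3.
  apply: unchanged_rset; first by rewrite /scan_memory leq_addr orbT.
  by do 2 (apply: unchanged_rset; first exact: scm).
have L3 := UL _ us3.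
pose est s' := [/\ imem s' 9 = c /\ imem s' 10 = sw, rmem s' scalar_addr = X,
  rmem s' (scalar_addr + 2)%N = complex.Re F0,
  rmem s' (scalar_addr + 3)%N = complex.Im F0 &
  rmem s' (weight_addr c) = weight_at v X].
pose old s' := forall a, (a < c)%N -> rmem s' (weight_addr a) = rmem s (weight_addr a) /\
       forall l : 'I_d, rmem s' (mean_addr a l) = rmem s (mean_addr a l).
have lo a : (a < c)%N -> (a < k)%N by move=> ac; exact: ltn_trans ck.
have r2 a : (scalar_addr <= a)%N -> (a < scratch_addr)%N -> rmem s2 a = rmem s a.
  by move=> h1 h2; rewrite ru2 // -ltnNge.
have ow a : (scalar_addr <= weight_addr a)%N.
  by rewrite /weight_addr /estimate_addr /direction_addr; lia.
have om a l : (scalar_addr <= mean_addr a l)%N.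
  by rewrite /mean_addr /estimate_addr /direction_addr; lia.
have e3 : est s3.
  split; first by rewrite /= !iu2.
  - rewrite /s3 !rmem_rset_ne; try solve_addr.
    by rewrite r2 //; solve_addr.
  - by rewrite /s3 2?rmem_rset_ne ?rmem_rset //; solve_addr.
  - by rewrite /s3 rmem_rset_ne ?rmem_rset //; solve_addr.
  - rewrite /s3 rmem_rset /weight_at /weight_estimate /short_deconv -/F0.
    by case: (F0) => a1 a2; rewrite /cmod /= -!expr2.
have o3 : old s3.
  move=> a ac; have ak := lo a ac; split=> [|l].
    rewrite /s3 !rmem_rset_ne; try solve_addr.
    by rewrite r2 ?ow //; exact: weight_addr_lt.
  rewrite /s3 !rmem_rset_ne; try solve_addr.
  by rewrite r2 ?om //; exact: mean_addr_lt.
apply: (runs_then (Q1 := fun s' => [/\ U s', est s', old s' &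
   forall l : 'I_d, rmem s' (mean_addr c l) = mean_at v X 0 l])).
  apply: (runs_for (Inv := fun j s' => [/\ U s', est s', old s' &
     forall l : 'I_d, (l < j)%N -> rmem s' (mean_addr c l) = mean_at v X 0 l])).
  - split=> //; exact: unchanged_iset.
  - by move=> j s' _ [/UL L' _ _ _] _ /=; rewrite (layout_d L').
  - move=> j s' jd [us' [[c' s10] X' re' im' w'] o' m'] ij.
    apply: (runs_then (runs_deconv (UL _ us') (UV _ us') s10 ij X')).
    move=> s4; rewrite (unit_offset_ord (Ordinal jd)) => -[us4 re4 im4].
    have us4' : U s4.
      apply: unchanged_trans us' _; apply: unchanged_sub us4 => [a|a].
        by rewrite !inE => /or3P[] ->; rewrite ?orbT.
      exact: scratch_scan_memory.
    have L4 := UL _ us4'; have [iu4 ru4 _] := us4.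
    have r4 a : (a < scratch_addr)%N -> rmem s4 a = rmem s' a.
      by move=> h; rewrite ru4 // -ltnNge.
    apply: runs_rset; rewrite /= (layout_estimate L4) (layout_k L4) (layout_d L4).
    rewrite !ieval_ipow /= (layout_N L4) (layout_scalar L4) (layout_scratch L4).
    rewrite !(iu4 9)%N // !(iu4 11)%N // c' ij addn0 re4 im4.
    have sc j' : (j' < 4)%N -> (scalar_addr + j' < scratch_addr)%N.
      by rewrite /scratch_addr /estimate_addr /direction_addr; lia.
    rewrite !(r4 (scalar_addr + 2)%N) ?sc // !(r4 (scalar_addr + 3)%N) ?sc // re' im'.
    split=> //; split.
    + apply: unchanged_iset => //; apply: unchanged_rset => //.
      by rewrite /scan_memory -addnA leq_addr orbT.
    + have c4 : imem s4 9 = c by rewrite iu4.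
      split=> [||||] /=; first by rewrite c4 iu4.
      * rewrite ifN_eq; last by apply/eqP; solve_addr.
        by rewrite r4 //; solve_addr.
      * rewrite ifN_eq; last by apply/eqP; solve_addr.
        by rewrite r4 //; solve_addr.
      * rewrite ifN_eq; last by apply/eqP; solve_addr.
        by rewrite r4 //; solve_addr.
      * rewrite ifN_eq; last by apply/eqP; solve_addr.
        by rewrite r4 //; exact: weight_addr_lt.
    + move=> a ac; have ak := lo a ac; have [wa ma] := o' a ac.
      split=> [|l] /=.
        rewrite ifN_eq; last by apply/eqP; solve_addr.
        by rewrite r4 //; exact: weight_addr_lt.
      rewrite ifN_eq ?r4 //; first exact: mean_addr_lt.
      apply/eqP => e; have [ac' _] := @mean_addr_inj a c l (Ordinal jd) e.
      by rewrite ac' ltnn in ac.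
    + move=> l lj /=; case: eqP => [e|ne].
        have [_ ->] := @mean_addr_inj c c l (Ordinal jd) e.
        rewrite /mean_at /mean_estimate mxE /short_deconv -/F0 /step_h.
        set Fi := deconv _ _ _ _ _ _; case: (Fi) => a1 a2; case: (F0) => a3 a4.
        by rewrite complex_divE /= div1r.
      rewrite r4; last exact: mean_addr_lt.
      apply: m'; move: lj; rewrite ltnS leq_eqVlt => /orP[/eqP lj|//].
      by case: ne; rewrite /mean_addr lj.
  - by move=> s' [us' e' o' m'] _; split=> // l; apply: m'.
move=> s5 [us5 [[c5 _] X5 re5 im5 w5] o5 m5]; have L5 := UL _ us5.
apply: runs_seq; apply: runs_rset; apply: runs_iset.
rewrite /= (layout_scalar L5) c5 addn0 X5; split=> //=.
- apply: unchanged_iset => //; apply: unchanged_rset => //; exact: scm.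
- by rewrite addn1.
- by rewrite eqxx.
- split=> [|l]; rewrite neO //.
  + exact: leq_addr.
  + by rewrite /mean_addr; lia.
- move=> a ac; have [w5a m5a] := o5 a ac; split=> [|l]; rewrite neO //.
  + exact: leq_addr.
  + by rewrite /mean_addr; lia.
Qed.

Lemma cmodE (z : R[i]) : cmod z =
  Num.sqrt (complex.Re z * complex.Re z + complex.Im z * complex.Im z).
Proof. by case: z => a1 a2; rewrite /cmod /= -!expr2. Qed.

Definition peaks_upto v (j : nat) : seq nat :=
  @scan R k (accepted N b' (oracle_ratio v)) (candidate N b')
    (candidate N b' 0 - peak_sep N) (peak_sep N) j.

Definition estimates v (l : seq nat) s : Prop :=
  forall a, (a < size l)%N ->
    rmem s (weight_addr a) = weight_at v (candidate N b' (nth 0%N l a)) /\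
    forall i : 'I_d, rmem s (mean_addr a i) = mean_at v (candidate N b' (nth 0%N l a)) 0 i.

(** The list of peaks is never stored: its length, its last point and the estimates at its points
    are all that the scan and the output consult. *)
Definition recorded v (l : seq nat) s : Prop :=
  [/\ imem s 9 = size l,
   rmem s (scalar_addr + 1)%N =
     last (candidate N b' 0 - peak_sep N) (map (candidate N b') l) &
   estimates v l s].

Lemma recorded_unchanged v l (I : seq nat) (A : pred nat) s s' : (size l <= k)%N ->
  (9 \notin I)%N -> (forall a, A a -> (a == scalar_addr) || (scratch_addr <= a)%N) ->
  unchanged I A s s' -> recorded v l s -> recorded v l s'.
Proof.
move=> lk I9 hA [iu ru _] [h9 h1 he].
have nA a : (scalar_addr < a)%N -> (a < scratch_addr)%N -> ~~ A a.
  by move=> h2 h3; apply/negP => /hA /orP[/eqP|]; lia.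
split; rewrite ?iu // ?ru //; first by apply: nA; solve_addr.
move=> a al; have ak := leq_trans al lk; have [wa ma] := he a al.
split=> [|i]; rewrite ru //.
- by apply: nA; [solve_addr|exact: weight_addr_lt].
- by apply: nA; [solve_addr|exact: mean_addr_lt].
Qed.

Definition scan_time : nat :=
  (candidates N b' * (deconv_time (long_window N b') + record_time + 8) + 2)%N.

Lemma runs_scan v s : layout s -> has_direction v s -> recorded v [::] s ->
  runs phi u (scan_prog b') s scan_time (fun s' =>
    unchanged scan_cells scan_memory s s' /\
    recorded v (peaks_upto v (candidates N b')) s').
Proof.
move=> Ls vs rs; set lw := long_window N b'.
pose U := unchanged scan_cells scan_memory s.
have UL s' : U s' -> layout s' by move=> us; apply: layout_scan us Ls.
have UV s' : U s' -> has_direction v s' by move=> us; apply: direction_scan us vs.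
have Usub (I : seq nat) (A : pred nat) s1 s2 : {subset I <= scan_cells} ->
    (forall a, A a -> scan_memory a) -> U s1 -> unchanged I A s1 s2 -> U s2.
  by move=> h1 h2 u1 u2; apply: unchanged_trans u1 _; apply: unchanged_sub u2.
have -> : (scan_time = candidates N b' * ((1 + (1 + (1 + (deconv_time lw +
    record_time.+3)))) + 2) + 2)%N.
  by rewrite /scan_time -/lw; lia.
apply: (runs_for (Inv := fun j s' => U s' /\ recorded v (peaks_upto v j) s')).
- split; first by apply: unchanged_iset => //; exact: unchanged_refl.
  by case: rs => h9 h1 he; split.
- by move=> j s' _ [/UL L' _] _; rewrite ieval_ipow /= (layout_N L').
move=> j s' jG [us' rs'] ij; have L' := UL _ us'; have V' := UV _ us'.
pose X := candidate N b' j : R.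
have lk : (size (peaks_upto v j) <= k)%N by exact: size_scan.
apply: runs_seq; apply: runs_rset; apply: runs_seq; apply: runs_iset.
apply: runs_seq; apply: runs_iset.
rewrite /= !ieval_ipow /= (layout_N L') (layout_d L') (layout_scalar L') ij addn0.
set s1 := iset _ _ _.
have u1 : unchanged [:: 10; 11]%N (pred1 scalar_addr) s' s1.
  do 2 (apply: unchanged_iset => //); apply: unchanged_rset; first exact: eqxx.
  exact: unchanged_refl.
have us1 : U s1.
  apply: Usub us' u1 => [a|a /eqP ->]; first by rewrite !inE => /orP[] ->; rewrite ?orbT.
  by rewrite /scan_memory; solve_addr.
have rs1 : recorded v (peaks_upto v j) s1.
  by apply: recorded_unchanged u1 rs' => // a /eqP ->; rewrite eqxx.
have X1 : rmem s1 scalar_addr = X by rewrite /= eqxx.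
apply: (runs_then (@runs_deconv v d lw X _ (UL _ us1) (UV _ us1) erefl erefl X1)).
move=> s2; rewrite unit_offset0 -/lw => -[u2 re2 im2].
have us2 : U s2.
  apply: Usub us1 u2 => [a|a]; last exact: scratch_scan_memory.
  by rewrite !inE => /or3P[] ->; rewrite ?orbT.
have L2 := UL _ us2; have V2 := UV _ us2.
have rs2 : recorded v (peaks_upto v j) s2.
  by apply: recorded_unchanged u2 rs1 => // a ->; rewrite orbT.
have [iu2 ru2 _] := u2; have [h9 h1 he] := rs2.
have X2 : rmem s2 scalar_addr = X by rewrite ru2 // -ltnNge; solve_addr.
have i5 : imem s2 5 = j by rewrite iu2.
have SE : peaks_upto v j.+1 = @scan_step R k (accepted N b' (oracle_ratio v))
  (candidate N b') (candidate N b' 0 - peak_sep N) (peak_sep N) (peaks_upto v j) j.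
  by [].
rewrite -SE.
(* Three tests can reject the candidate; they share this run, padded to the time of the accepting
   branch. *)
have reject : peaks_upto v j.+1 = peaks_upto v j ->
    runs phi u Skip s2 record_time (fun s'' => imem s'' 5 = j /\
      U (iset s'' 5 j.+1) /\ recorded v (peaks_upto v j.+1) (iset s'' 5 j.+1)).
  move=> ->; apply: (runs_weaken (t := 1)); last by move=> s''; exact: id.
    apply: runs_skip; split=> //; split; first exact: unchanged_iset.
    by case: rs2.
  by rewrite /record_time; lia.
apply: runs_if; rewrite /= (layout_N L2) (layout_scratch L2) addn0 re2 im2 -cmodE div1r.
rewrite -[cmod _]/(cmod (long_deconv N b' (oracle_ratio v) X)).
rewrite -[_ <= _]/(accepted N b' (oracle_ratio v) j).
case: ifPn => acc; last first.
  apply: (runs_weaken (reject _)) => //; first by rewrite SE /scan_step (negbTE acc) andbF.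
  by lia.
apply: runs_if; rewrite /= ieval_ipow /= (layout_N L2) (layout_scalar L2) addn0 X2 h1 div1r.
rewrite -[(N ^ 3)%:R^-1]/(peak_sep N).
case: ifPn => far; last first.
  apply: (runs_weaken (reject _)) => //; first by rewrite SE /scan_step (negbTE far) !andbF.
apply: runs_if; rewrite /= (layout_k L2) h9 -ltnNge.
case: ifPn => small; last first.
  by apply: (runs_weaken (reject _)) => //; rewrite SE /scan_step (negbTE small).
have lE : peaks_upto v j.+1 = rcons (peaks_upto v j) j.
  by rewrite SE /scan_step small acc far.
rewrite -SE; apply: (runs_weaken (runs_record L2 V2 h9 small X2)) => //.
move=> s3 [u3 c3 x3 [w3 m3] old3].
have i53 : imem s3 5 = j by case: u3 => -> .
split=> //; split.
  apply: unchanged_iset => //; apply: Usub us2 u3 => // a.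
  by rewrite !inE => /or4P[] => [->|->|->|/or3P[] ->]; rewrite ?orbT.
rewrite lE; split=> /=.
- by rewrite c3 size_rcons.
- by rewrite x3 map_rcons last_rcons.
- move=> a; rewrite size_rcons ltnS leq_eqVlt nth_rcons => /orP[/eqP ->|al].
    by rewrite ltnn eqxx.
  by rewrite al /=; have [-> mo] := old3 a al; have [-> me] := he a al; split=> // i; rewrite mo me.
by move=> s' [us' rs'] _; split.
Qed.

(** The number of equiprobable values of a coordinate of the direction; it is at least [2 * k ^ 2]
    once [k <= N]. *)
Definition draws : nat := (2 * N ^ 2)%N.

(** The successor keeps each coordinate at least 1, hence the norm of every grid frequency at least
    [h * long_window]. *)
Definition drawn_direction (r : nat) : 'rV[R]_d :=
  \row_(l < d) (level draws (draws%:R * u (r + l)%N)).+1%:R.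

Definition direction_memory (a : nat) : bool :=
  (direction_addr <= a < estimate_addr)%N || (scratch_addr <= a)%N.

(** The frame condition for programs that consume the random tape. *)
Definition redrawn (I : seq nat) (A : pred nat) s s' : Prop :=
  (forall a, a \notin I -> imem s' a = imem s a) /\
  (forall a, ~~ A a -> rmem s' a = rmem s a).

Lemma layout_redrawn (I : seq nat) (A : pred nat) s s' :
  all (fun a => a \notin I) [:: 0; 1; 2; 3; 12; 13; 14; 15]%N ->
  (forall a, A a -> (scalar_addr <= a)%N) ->
  redrawn I A s s' -> layout s -> layout s'.
Proof.
move=> h hA [iu ru] Ls.
suff [*] : layout (State (imem s') (rmem s') (drawn s)) by split.
by apply: layout_unchanged h hA _ Ls; split.
Qed.

Definition direction_time : nat := (d * (draws * 4 + 6) + 2)%N.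

Lemma runs_direction r s : layout s -> drawn s = r ->
  runs phi u direction_prog s direction_time (fun s' =>
    [/\ redrawn [:: 7; 8]%N direction_memory s s', drawn s' = (r + d)%N &
     has_direction (drawn_direction r) s']).
Proof.
move=> Ls dr.
pose U := redrawn [:: 7; 8]%N direction_memory s.
have UL s' : U s' -> layout s'.
  move=> us; apply: layout_redrawn us Ls => // a; rewrite /direction_memory; solve_addr.
have -> : (direction_time = d * ((1 + (1 + (draws * (2 + 2) + 2))) + 2) + 2)%N.
  by rewrite /direction_time; lia.
apply: (runs_for (Inv := fun j s' => [/\ U s', drawn s' = (r + j)%N &
  forall l : 'I_d, (l < j)%N ->
    rmem s' (direction_addr + l)%N = drawn_direction r 0 l])).
- split=> //; last by rewrite addn0.
  split=> // a; rewrite !inE negb_or /= => /andP[_ /negbTE]; by rewrite eq_sym => ->.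
- by move=> j s' _ [/UL L' _ _] _ /=; rewrite (layout_d L').
- move=> j s' jd [us' dr' vs'] ij; have L' := UL _ us'.
  apply: runs_seq; apply: runs_draw; rewrite /= (layout_scratch L') /draw dr'.
  apply: runs_seq; apply: runs_rset; rewrite /= (layout_direction L') ij.
  set y := u (r + j)%N.
  set s1 := rset _ _ _.
  pose V := redrawn [:: 7]%N (pred1 (direction_addr + j)%N) s1.
  have us1 : U s1.
    have [iu ru] := us'; split=> // a; rewrite /direction_memory => na /=.
    rewrite ifN_eq; last by apply/eqP => ae; move: na; rewrite ae; solve_addr.
    rewrite ifN_eq; last by apply/eqP => ae; move: na; rewrite ae; solve_addr.
    by apply: ru.
  have VU s2 : V s2 -> U s2.
    have [iu1 ru1] := us1; move=> [iu2 ru2]; split=> a h.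
      rewrite iu2 ?iu1 //; move: h; rewrite !inE; case: eqP => //.
    rewrite ru2 ?ru1 //=; apply: contra h => /eqP ->.
    by rewrite /direction_memory; solve_addr.
  have y1 : rmem s1 (scratch_addr + 2)%N = y.
    rewrite /= ifN_eq ?eqxx //; apply/eqP; solve_addr.
  apply: (runs_for (Inv := fun m s2 => [/\ V s2, drawn s2 = (r + j).+1 &
    rmem s2 (direction_addr + j)%N =
      (\sum_(i < m) (i.+1%:R <= draws%:R * y)%R)%N.+1%:R])).
  + split=> //; last by rewrite big_ord0 /= eqxx.
    split=> // a; rewrite !inE /= => /negbTE; by rewrite eq_sym => ->.
  + by move=> m s2 _ [/VU/UL L2 _ _] _; rewrite /= ieval_ipow /= (layout_N L2).
  + move=> m s2 _ [vs2 dr2 c2] im; have L2 := UL _ (VU _ vs2); have [iu2 ru2] := vs2.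
    apply: runs_if; rewrite /= !ieval_ipow /= (layout_N L2) (layout_scratch L2) im.
    have -> : rmem s2 (scratch_addr + 2)%N = y.
      by rewrite ru2 ?y1 //=; apply/eqP; solve_addr.
    rewrite addn1 -/draws; case: ifPn => le.
      apply: runs_rset; rewrite /= (layout_direction L2) (iu2 8)%N //= ij.
      split=> //; split=> //.
        split=> a h; last first.
          by transitivity (rmem s2 a); [apply: rmem_rset_ne; exact/eqP|exact: ru2].
        by rewrite -(iu2 a h); move: h; rewrite inE /= => h; rewrite (negbTE h).
      by rewrite /= eqxx c2 big_ord_recr /= le addn1 natr1.
    apply: runs_skip; split=> //; split=> //.
      split=> a h; last exact: ru2.
      by rewrite -(iu2 a h); move: h; rewrite inE /= => h; rewrite (negbTE h).
    by rewrite /= c2 big_ord_recr /= (negbTE le) addn0.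
  move=> s2 [vs2 dr2 c2] _; have us2 := VU _ vs2; have [iu2 ru2] := vs2.
  split; first by rewrite iu2.
  split=> /=.
  + have [iu ru] := us2; split=> // a; rewrite !inE negb_or /= => /andP[h7 h8].
    by rewrite (negbTE h8) iu // !inE negb_or h7.
  + by rewrite dr2 addnS.
  + move=> l; rewrite ltnS leq_eqVlt => /orP[/eqP lj|lj].
      by rewrite lj c2 level_count mxE lj.
    rewrite ru2; last by rewrite /= eqn_add2l (ltn_eqF lj).
    have := ltn_ord l => ld.
    rewrite /= eqn_add2l (ltn_eqF lj) ifN_eq ?vs' //.
    by apply/eqP; solve_addr.
- by move=> s' [us' dr' vs'] _; split=> // l; apply: vs'.
Qed.

Definition round_time : nat := (direction_time + scan_time + 2)%N.

Lemma layout_round s s' : redrawn scan_cells (fun a => scalar_addr <= a)%N s s' ->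
  layout s -> layout s'.
Proof. by apply: layout_redrawn. Qed.

Lemma runs_round r s : layout s -> drawn s = r ->
  runs phi u (round_prog b') s round_time (fun s' =>
    [/\ redrawn scan_cells (fun a => scalar_addr <= a)%N s s',
     drawn s' = (r + d)%N &
     recorded (drawn_direction r) (peaks_upto (drawn_direction r) (candidates N b')) s']).
Proof.
move=> Ls dr; set v := drawn_direction r.
have -> : (round_time = 1 + (direction_time + (1 + scan_time)))%N.
  by rewrite /round_time; lia.
apply: runs_seq; apply: runs_iset; set s1 := iset _ _ _.
have r1 : redrawn scan_cells (fun a => scalar_addr <= a)%N s s1.
  by split=> // a; rewrite !inE /= => h; case: eqP => // a9; rewrite a9 in h.
have L1 := layout_round r1 Ls.
apply: (runs_then (runs_direction L1 dr)) => s2 [r2 dr2 v2].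
have L2 : layout s2.
  by apply: layout_redrawn r2 L1 => // a; rewrite /direction_memory; solve_addr.
apply: runs_seq; apply: runs_rset; set s3 := rset _ _ _.
have e3 : s3 = rset s2 (scalar_addr + 1)%N (candidate N b' 0 - peak_sep N).
  by rewrite /s3 /= !ieval_ipow /= (layout_scalar L2) (layout_N L2) div1r.
have u3 : unchanged [::] scan_memory s2 s3.
  rewrite e3; apply: unchanged_rset; last exact: unchanged_refl.
  by rewrite /scan_memory; solve_addr.
have L3 : layout s3 by apply: layout_scan u3 L2.
have V3 := direction_scan u3 v2.
have [iu2 ru2] := r2; have [iu3 ru3 dr3] := u3.
have rec3 : recorded v [::] s3.
  by split; [rewrite iu3 // iu2|rewrite e3 rmem_rset|].
apply: (runs_weaken (runs_scan L3 V3 rec3)) => // s4 [u4 rec4].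
have [iu4 ru4 dr4] := u4; split=> //; last by rewrite dr4 dr3 dr2.
have [iu1 ru1] := r1; split=> a h.
  rewrite iu4 // iu3 // iu2 ?iu1 //; move: h; rewrite !inE !negb_or.
  by move=> /and5P[_ _ -> -> _].
rewrite ru4 ?ru3 ?ru2 ?ru1 //; move: h; rewrite -ltnNge /scan_memory /direction_memory; solve_addr.
Qed.

End Deconvolve.

Lemma nth_flatten_const (T : Type) (x0 : T) (c : nat) (ss : seq (seq T)) i l :
  all (fun s => size s == c) ss -> (i < size ss)%N -> (l < c)%N ->
  nth x0 (flatten ss) (i * c + l) = nth x0 (nth [::] ss i) l.
Proof.
elim: ss i => // s ss IH [|i] /= /andP[/eqP sc al] ilt lc; rewrite nth_cat sc.
  by rewrite mul0n add0n lc.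
rewrite mulSn -addnA ltnNge leq_addr /= addKn; exact: IH.
Qed.

(** * The choice of N and the initial memory *)

Section Setup.
Context {R : realType} {d : nat}.
Variables (phi : 'rV[R]_d -> R[i]) (u : nat -> R).
Variables (n k b' m : nat) (x : 'I_n -> 'rV[R]_d) (eps delta : R).
Hypothesis m0 : (0 < m)%N.
Hypothesis delta01 : 0 < delta < 1.
Local Notation state := (@state R).
Implicit Types s : state.

(** The condition that [N ^ m] times the maximum of 1 and [ln (1 / delta)] is at most [n], split
    into the two tests that the program evaluates. *)
Definition fits (N : nat) : bool :=
  (N ^ m <= n)%N && ((N ^ m)%:R * ln (1%:R / delta) <= n%:R).

Lemma fits_le N N' : (N <= N')%N -> fits N' -> fits N.
Proof.
move=> NN /andP[h1 h2]; have NNm : (N ^ m <= N' ^ m)%N by rewrite leq_exp2r.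
rewrite /fits (leq_trans NNm h1) /=; apply: le_trans h2.
rewrite ler_wpM2r ?ler_nat // ln_ge0 // div1r.
by case/andP: delta01 => d0 /ltW; rewrite invf_ge1.
Qed.

Lemma fits0 : fits 0.
Proof. by rewrite /fits exp0n // mul0r ler0n. Qed.

Lemma fits_le_n N : fits N -> (N <= n)%N.
Proof.
move=> /andP[h _]; apply: leq_trans h; case: N => // N.
by rewrite -[X in (X <= _)%N]expn1 leq_pexp2l.
Qed.

Lemma fits_max : exists2 N, fits N & forall N', fits N' -> (N' <= N)%N.
Proof.
have ex : exists N, fits N by exists 0%N; exact: fits0.
by have [N fN maxN] := ex_maxnP ex fits_le_n; exists N.
Qed.

Lemma runs_parameter s : imem s 0 = n -> rmem s 1 = delta ->
  runs phi u (parameter_prog m) s (n * 5 + 3) (fun s' =>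
    [/\ unchanged [:: 3; 4]%N pred0 s s', fits (imem s' 3) &
      forall N, fits N -> (N <= imem s' 3)%N]).
Proof.
move=> n_s d_s.
have -> : (n * 5 + 3 = 1 + (n * (3 + 2) + 2))%N by lia.
apply: runs_seq; apply: runs_iset => /=; set s1 := iset _ _ _.
have u1 : unchanged [:: 3; 4]%N pred0 s s1 by apply: unchanged_iset.
apply: (runs_for (Inv := fun j s' => [/\ unchanged [:: 3; 4]%N pred0 s s',
   fits (imem s' 3) & forall N, fits N -> (minn j N <= imem s' 3)%N])).
- split; first exact: unchanged_iset.
    exact: fits0.
  by move=> N _; rewrite min0n.
- by move=> j s' _ [[iu _ _] _ _] _ /=; rewrite iu.
- move=> j s' jn [us f3 m3] ij; have [iu ru _] := us.
  have skip : ~~ fits (imem s' 3).+1 -> imem s' 4 = j /\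
    [/\ unchanged [:: 3; 4]%N pred0 s (iset s' 4 j.+1),
      fits (imem (iset s' 4 j.+1) 3) &
      forall N, fits N -> (minn j.+1 N <= imem (iset s' 4 j.+1) 3)%N].
    move=> nf; split=> //; split=> //=; first exact: unchanged_iset.
    move=> N fN; rewrite geq_min; apply/orP; right; rewrite leqNgt; apply/negP => lt.
    by move: nf; rewrite (fits_le lt fN).
  apply: runs_if; rewrite /= ieval_ipow /= addn1 (iu 0%N) // n_s.
  case: ifPn => c1; last first.
    apply: (@runs_weaken _ _ _ _ _ _ 1) => //; last by move=> ?; exact: id.
    by apply: runs_skip; apply: skip; rewrite /fits (negbTE c1).
  apply: runs_if; rewrite /= ieval_ipow /= addn1 (iu 0%N) // n_s ru // d_s.
  case: ifPn => c2; last first.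
    by apply: runs_skip; apply: skip; rewrite /fits c1 (negbTE c2).
  apply: runs_iset; rewrite /= addn1; split=> //; split=> /=.
  + by do 2 (apply: unchanged_iset => //).
  + by rewrite /fits c1.
  + by move=> N /m3; lia.
- move=> s' [us f3 m3] _; split=> // N fN; have := m3 N fN.
  by rewrite (minn_idPr (fits_le_n fN)).
Qed.

Lemma input_sample (i : 'I_n) (l : 'I_d) :
  rmem (input k eps delta x) (2 + (i * d + l))%N = x i 0 l.
Proof.
rewrite /= /allpairs_dep (@nth_flatten_const _ _ d) //.
- by rewrite (nth_map i) ?size_enum_ord // nth_ord_enum (nth_map l) ?size_enum_ord // nth_ord_enum.
- by apply/allP => _ /mapP[i' _ ->]; rewrite size_map size_enum_ord.
- by rewrite size_map size_enum_ord.
Qed.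

Lemma runs_layout N s : unchanged [:: 3; 4]%N pred0 (input k eps delta x) s ->
  imem s 3 = N ->
  runs phi u layout_prog s 4 (fun s' => [/\ layout k N x s' & drawn s' = 0%N]).
Proof.
move=> [iu ru dr] i3.
rewrite (_ : 4 = 1 + (1 + (1 + 1)))%N //.
do 3 (apply: runs_seq; apply: runs_iset); apply: runs_iset.
rewrite /= !iu //=; split=> //.
split=> //=; rewrite ?iu //=.
by move=> i l; rewrite ru // input_sample.
Qed.

End Setup.

(** * Repetition of the rounds *)

Section Rounds.
Context {R : realType} {d : nat}.
Variables (phi : 'rV[R]_d -> R[i]) (u : nat -> R).
Variables (n k b' : nat) (x : 'I_n -> 'rV[R]_d) (N : nat).
Local Notation state := (@state R).
Implicit Types s : state.

Definition round_direction (r : nat) : 'rV[R]_d := drawn_direction u N (r * d).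
Definition round_peaks (r : nat) : seq nat :=
  peaks_upto phi k N b' x (round_direction r) (candidates N b').

Lemma size_round_peaks r : (size (round_peaks r) <= k)%N.
Proof. exact: size_scan. Qed.

Definition found s : Prop := exists r, size (round_peaks r) = k /\
  estimates phi k N b' x (round_direction r) (round_peaks r) s.

Definition unsuccessful (r : nat) : Prop :=
  forall j, (j < r)%N -> (size (round_peaks j) < k)%N.

(** As long as no round was full, exactly [j * d] uniforms are consumed, so round [j] reads the
    block that the probabilistic analysis assigns to it. After a success nothing more is drawn. *)
Definition rounds_state (j : nat) s : Prop := layout k N x s /\
  (imem s 9 = k /\ found s \/
   [/\ (imem s 9 < k)%N, drawn s = (j * d)%N & unsuccessful j]).

Lemma layout_iset4 s j : layout k N x s -> layout k N x (iset s 4 j).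
Proof. by move=> [*]; split. Qed.

Lemma runs_rounds s : (0 < k)%N -> layout k N x s -> drawn s = 0%N -> imem s 9 = 0%N ->
  runs phi u (for_loop 4 (nv 0) (If (Not (ILe (nv 2) (nv 9))) (round_prog b') Skip)) s
    (n * (@round_time d n N b' + 3) + 2) (rounds_state n).
Proof.
move=> k0 Ls dr i9.
have -> : (n * (@round_time d n N b' + 3) + 2 = n * ((@round_time d n N b').+1 + 2) + 2)%N by lia.
apply: (runs_for (Inv := rounds_state)).
- split; first exact: layout_iset4.
  by right; split; rewrite /= ?i9.
- by move=> j s' _ [L' _] _ /=; rewrite (layout_n L').
- move=> j s' jn [L' H] ij; apply: runs_if; rewrite /= (layout_k L').
  case: H => [[k9 fd]|[k9 dr' uns]].
    rewrite k9 leqnn /=; apply: (@runs_weaken _ _ _ _ _ _ 1); last by move=> ?; exact: id.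
      apply: runs_skip; split=> //; split; first exact: layout_iset4.
      by left.
    by rewrite /round_time; lia.
  rewrite -ltnNge k9 /=; apply: (runs_weaken (runs_round phi u b' L' dr')) => // s2 [r2 dr2 rec2].
  have L2 := layout_round r2 L'; have [iu2 _] := r2; have [c2 _ e2] := rec2.
  split; first by rewrite iu2.
  split; first exact: layout_iset4.
  have := size_round_peaks j; rewrite leq_eqVlt => /orP[/eqP full|part].
    by left; split; [rewrite /= c2; exact: full|exists j].
  right; split=> /=; first by rewrite c2.
    by rewrite dr2 mulSn addnC.
  by move=> i; rewrite ltnS leq_eqVlt => /orP[/eqP ->|/uns].
- by move=> s' H _.
Qed.

Lemma runs_output s : layout k N x s ->
  runs phi u output_prog s ((k + k * d) * 3 + 2) (fun s' =>
    forall a, (a < k + k * d)%N -> rmem s' a = rmem s (@estimate_addr d n + a)%N).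
Proof.
move=> Ls.
apply: (runs_for (t := 1) (Inv := fun j s' => [/\
  forall a, a != 8%N -> imem s' a = imem s a,
  forall a, (j <= a)%N -> rmem s' a = rmem s a &
  forall a, (a < j)%N -> rmem s' a = rmem s (@estimate_addr d n + a)%N])).
- by split=> // a /negbTE h /=; rewrite h.
- by move=> j s' _ [iu _ _] _ /=; rewrite !iu // (layout_k Ls) (layout_d Ls).
- move=> j s' jk [iu ru cu] ij; apply: runs_rset.
  rewrite /= ij iu // (layout_estimate Ls); split=> //; split=> a.
  + by move=> a8 /=; rewrite (negbTE a8) iu.
  + by move=> ja /=; rewrite gtn_eqF // ru // ltnW.
  + rewrite ltnS leq_eqVlt /= => /orP[/eqP ->|aj].
      by rewrite eqxx ru // leq_addl.
    by rewrite ltn_eqF // cu.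
- by move=> s' [_ _ cu] _ a ak; apply: cu.
Qed.

End Rounds.

(** * The whole program and its running time *)

Section Program.
Context {R : realType} {d : nat}.
Variables (phi : 'rV[R]_d -> R[i]) (u : nat -> R).
Variables (n k b' m : nat) (x : 'I_n -> 'rV[R]_d) (eps delta : R).

Definition main_time (N : nat) : nat := (n * 5 + 3 + (4 + (1 +
  (n * (@round_time d n N b' + 3) + 2 + ((k + k * d) * 3 + 2)))))%N.

Definition reads_off (N r : nat) (s : @state R) : Prop := forall a : 'I_k,
  let X := candidate N b' (nth 0%N (round_peaks phi u k b' x N r) a) in
  out_weight s a = weight_at phi N b' x (round_direction u N r) X /\
  out_mean d s a = mean_at phi N b' x (round_direction u N r) X.

(** Termination is unconditional, while the estimates are claimed if some round is full. The round
    that is read off is the one at which the program stopped, possibly another one. *)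
Lemma runs_main N : (0 < m)%N -> 0 < delta < 1 -> (0 < k)%N ->
  fits n m delta N -> (forall N', fits n m delta N' -> (N' <= N)%N) ->
  runs phi u (main_prog b' m) (input k eps delta x) (main_time N) (fun s =>
    (exists2 r, (r < n)%N & size (round_peaks phi u k b' x N r) = k) ->
    exists2 r, size (round_peaks phi u k b' x N r) = k & reads_off N r s).
Proof.
move=> m0 delta01 k0 fN maxN.
have [t1 [s1 [ex1 l1 [u1 f1 max1]]]] :=
  @runs_parameter R d phi u n m delta m0 delta01 (input k eps delta x) erefl erefl.
have N_s : imem s1 3 = N by apply/eqP; rewrite eqn_leq maxN //= max1.
apply: runs_seq; exists t1, s1; split=> //.
apply: (runs_then (runs_layout phi u u1 N_s)) => s2 [L2 dr2].
apply: runs_seq; apply: runs_iset => /=.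
have L3 : layout k N x (iset s2 9 0) by case: L2 => [*]; split.
apply: (runs_then (runs_rounds phi u b' k0 L3 dr2 erefl)) => s4 [L4 H4].
apply: (runs_weaken (runs_output phi u L4)) => // s5 cp [r rn rk].
case: H4 => [[_ fd]|[_ _ uns]]; last by have := uns r rn; rewrite rk ltnn.
have [r' [rk' est]] := fd; exists r' => // a.
have ak : (a < size (round_peaks phi u k b' x N r'))%N by rewrite rk'.
have [wa ma] := est a ak; split.
  by rewrite /out_weight cp ?ltn_addr // wa.
apply/rowP => l; rewrite mxE -ma /mean_addr -!addnA cp ?addnA //.
rewrite -addnA ltn_add2l; have := ltn_ord a; have := ltn_ord l; nia.
Qed.

Lemma fits_pow N j : (0 < j <= m)%N -> fits n m delta N -> (N ^ j <= n)%N.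
Proof.
move=> /andP[j0 jm] /andP[h _]; apply: leq_trans h.
case: N => [|N]; first by rewrite exp0n.
exact: leq_pexp2l.
Qed.

(** The loops nest as rounds, candidates, offsets, window, samples, coordinates: six factors, each
    at most [n], since the exponents of [N] in them are at most [m] and [N ^ m <= n]. *)
Lemma main_time_le N : (b' + 30 <= m)%N -> fits n m delta N -> (0 < n)%N ->
  (d <= n)%N -> (k <= n)%N -> (main_time N <= 300 * n ^ 6)%N.
Proof.
move=> bm fN n0 dn kn.
have lw : (long_window N b' <= n)%N by apply: fits_pow fN; lia.
have sw : (short_window N b' <= n)%N by apply: fits_pow fN; lia.
have cw : (candidates N b' <= n)%N by apply: fits_pow fN; lia.
have dw : (draws N <= 2 * n)%N by rewrite /draws leq_mul2l /=; apply: fits_pow fN; lia.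
have step j : (n ^ j <= n ^ j.+1)%N by rewrite leq_pexp2l.
have s0 := step 0%N; have p1 := step 1%N; have p2 := step 2%N.
have p3 := step 3%N; have p4 := step 4%N; have p5 := step 5%N.
have nS j : (n * n ^ j = n ^ j.+1)%N by rewrite expnS.
have n1 : (n = n ^ 1)%N by rewrite expn1.
have tt : (@term_time d n <= 30 * n ^ 2)%N.
  rewrite /term_time; have : (n * (d * 3 + 7) <= n * (n * 3 + 7))%N by rewrite leq_mul2l; lia.
  move: (nS 1%N); rewrite -n1; nia.
have dt L : (L <= n)%N -> (@deconv_time d n L <= 40 * n ^ 3)%N.
  move=> Ln; rewrite /deconv_time.
  have : (L * (@term_time d n + 2) <= n * (30 * n ^ 2 + 2))%N by rewrite leq_mul // leq_add2r.
  move: (nS 2%N); nia.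
have rt : (@record_time d n N b' <= 100 * n ^ 4)%N.
  rewrite /record_time; have D := dt _ sw.
  have : (d * (@deconv_time d n (short_window N b') + 3) <= n * (40 * n ^ 3 + 3))%N.
    by rewrite leq_mul // leq_add2r.
  move: (nS 3%N); nia.
have st : (@scan_time d n N b' <= 160 * n ^ 5)%N.
  rewrite /scan_time; have D := dt _ lw.
  have : (candidates N b' * (@deconv_time d n (long_window N b') + @record_time d n N b' + 8) <=
     n * (40 * n ^ 3 + 100 * n ^ 4 + 8))%N.
    by rewrite leq_mul // leq_add2r leq_add.
  move: (nS 3%N) (nS 4%N); nia.
have drt : (@direction_time d N <= 20 * n ^ 2)%N.
  rewrite /direction_time.
  have : (d * (draws N * 4 + 6) <= n * (2 * n * 4 + 6))%N.
    by rewrite leq_mul // leq_add2r leq_mul2r.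
  move: (nS 1%N); rewrite -n1; nia.
have ro : (@round_time d n N b' <= 185 * n ^ 5)%N by rewrite /round_time; lia.
rewrite /main_time.
have : (n * (@round_time d n N b' + 3) <= n * (185 * n ^ 5 + 3))%N.
  by rewrite leq_mul2l leq_add2r ro orbT.
have : (k * d <= n * n)%N by rewrite leq_mul.
move: (nS 5%N) (nS 1%N); rewrite -n1; nia.
Qed.

End Program.

(** * The noise in the deconvolution *)

Lemma le_norm2 (R : realType) d (x : 'rV[R]_d) l : `|x 0 l| <= norm2 x.
Proof.
rewrite -sqrtr_sqr /norm2 ler_sqrt; last by apply: sumr_ge0 => i _; rewrite -expr2 sqr_ge0.
by rewrite /dotp (bigD1 l) //= -expr2 lerDl sumr_ge0 // => i _; rewrite -expr2 sqr_ge0.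
Qed.

Section NoiseLevel.
Context {R : realType}.
Variables (N b e : nat) (a A c1 c2 c1' c2' : R) (d : nat).
Hypotheses (c1_ge0 : 0 <= c1) (c2_ge0 : 0 <= c2) (c1'_ge0 : 0 <= c1').
Hypotheses (a_gt0 : 0 < a) (A_gt0 : 0 < A).
Hypotheses (d_gt0 : (0 < d)%N) (d_le : (d <= N)%N).
Hypothesis b_large : c1 + 5 * c2 + 15 <= b%:R * (c2' - c2).
Hypothesis e_large : c1 + (b + 5)%:R * c2 + 15 <= e%:R.
Hypothesis N_large : 6 + A <= a * N%:R.

(** With [s = c1 + (b + 5) * c2], the SFD bound at [N ^ (b + 5)] is at least [a * N ^ -s], so both
    errors have to be of order [N ^ -(s + 15)]: 14 for the target and one more factor [N] for the
    constants [6 + A <= a * N]. For the FFD term this reads [b * c2' >= s + 15], which is [b_large];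
    the gap [c2' > c2] makes it satisfiable. *)
Lemma noise_level :
  6 * (N ^ e)%:R^-1 + A * d%:R `^ (- c1') * (N ^ b)%:R `^ (- c2') <=
  (N ^ 14)%:R^-1 * (a * d%:R `^ (- c1) * (N ^ (b + 5))%:R `^ (- c2)).
Proof.
have N1 : (0 < N)%N by exact: leq_trans d_gt0 d_le.
have X1 : 1 <= N%:R :> R by rewrite ler1n.
have X0 : 0 < N%:R :> R by rewrite ltr0n.
have powE j (c : R) : (N ^ j)%:R `^ (- c) = N%:R `^ (- (j%:R * c)).
  by rewrite natrX -powR_mulrn ?ler0n // -powRrM mulrN.
have invE j : (N ^ j)%:R^-1 = N%:R `^ (- j%:R) :> R.
  by rewrite natrX powRN powR_mulrn ?ler0n.
pose s := c1 + (b + 5)%:R * c2; pose t := N%:R `^ (- (s + 15)).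
have t0 : 0 < t by exact: powR_gt0.
have He : (N ^ e)%:R^-1 <= t.
  by rewrite invE ler_powR // lerN2.
have Hb : (N ^ b)%:R `^ (- c2') <= t.
  rewrite powE ler_powR // lerN2 /s natrD; move: b_large; nra.
have Hd1 : d%:R `^ (- c1') <= 1 :> R.
  apply: (@le_trans _ _ (d%:R `^ 0)); last by rewrite powRr0.
  by rewrite ler_powR ?ler1n // oppr_le0.
have Hd2 : N%:R `^ (- c1) <= d%:R `^ (- c1).
  rewrite !powRN lef_pV2 ?posrE ?powR_gt0 ?ltr0n //.
  by rewrite ge0_ler_powR ?nnegrE ?ler0n ?ler_nat.
have rhs : N%:R * t = (N ^ 14)%:R^-1 * (N%:R `^ (- c1) * (N ^ (b + 5))%:R `^ (- c2)).
  rewrite invE powE -!powRD ?(gt_eqF X0) ?implybT //.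
  rewrite -{1}(powRr1 (ltW X0)) -powRD ?(gt_eqF X0) ?implybT //.
  by congr (_ `^ _); rewrite /s; ring.
apply: (@le_trans _ _ ((6 + A) * t)).
  rewrite [leRHS]mulrDl lerD ?ler_pM2l // -mulrA ler_pM2l //.
  by rewrite -(mul1r t) ler_pM ?powR_ge0.
apply: (@le_trans _ _ (a * (N%:R * t))).
  by rewrite mulrA ler_pM2r.
rewrite rhs mulrCA ler_wpM2l ?invr_ge0 ?ler0n // -mulrA ler_pM2l //.
by rewrite ler_wpM2r ?powR_ge0.
Qed.

End NoiseLevel.

(** The finite lattice on which the empirical characteristic function is controlled; it does not
    depend on the random directions. *)
Definition integer_freq (R : realType) (h : R) d Z (f : {ffun 'I_d -> 'I_Z.+1}) : 'rV[R]_d :=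
  h *: \row_l (f l)%:R.

(** * The quotient of the characteristic functions *)

Section Ratio.
Context {R : realType} {d k k' : nat}.
Variables (D : probability (borelRd R d) R) (D' : 'I_k' -> probability (borelRd R d) R).
Variables (mu : 'I_k -> 'rV[R]_d) (mu' : 'I_k' -> 'rV[R]_d).
Variables (w : 'I_k -> R) (w' : 'I_k' -> R).

Definition part_weight (j : 'I_k + 'I_k') : R :=
  match j with inl i => w i | inr i => w' i end.
Definition part_law (j : 'I_k + 'I_k') : probability (borelRd R d) R :=
  match j with inl i => D | inr i => D' i end.
Definition part_mean (j : 'I_k + 'I_k') : 'rV[R]_d :=
  match j with inl i => mu i | inr i => mu' i end.

Lemma mixtureE S : mixture D D' mu mu' w w' S =
  (\sum_j (part_weight j)%:E * translate (part_law j) (part_mean j) S)%E.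
Proof. by rewrite big_sumType. Qed.

Lemma sum_part_weight : \sum_j part_weight j = \sum_j w j + \sum_j w' j.
Proof. by rewrite big_sumType. Qed.

Local Notation mixcf := (mix_charfun part_weight part_law part_mean).

Hypothesis w'_ge0 : forall j, 0 <= w' j.
Hypothesis w'_sum : \sum_j w' j <= 1.

(** Dividing the SFD components by [phi_D] leaves the sum of characters exactly. What remains is the
    sampling error and the FFD components, whose weights sum to at most 1. *)
Lemma ratio_error t (z : R[i]) (E lo hi : R) :
  cmod (z - mixcf t) <= E -> 0 < lo -> lo <= cmod (charfun D t) -> 0 <= hi ->
  (forall j, cmod (charfun (D' j) t) <= hi) ->
  cmod (z / charfun D t - \sum_j (w j)%:C%C * cis (dotp t (mu j))) <= (E + hi) / lo.
Proof.
move=> zE lo0 lop hi0 hip.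
have p0 : charfun D t != 0 by rewrite -cmod_eq0 gt_eqF // (lt_le_trans lo0).
have -> : z / charfun D t - \sum_j (w j)%:C%C * cis (dotp t (mu j)) =
  ((z - mixcf t) + \sum_j (w' j)%:C%C * (cis (dotp t (mu' j)) * charfun (D' j) t))
    / charfun D t.
  rewrite /mix_charfun big_sumType /= opprD addrA subrK mulrBl; congr (_ - _).
  by rewrite mulr_suml; apply: eq_bigr => j _; rewrite mulrA mulfK.
have E0 : 0 <= E by apply: le_trans (cmod_ge0 _) zE.
rewrite cmodM cmodV ler_pM ?invr_ge0 ?cmod_ge0 //; last first.
  by rewrite lef_pV2 ?posrE // (lt_le_trans lo0).
rewrite (le_trans (cmodD _ _)) // lerD // (le_trans (cmod_sum _ _ _)) //.
apply: (@le_trans _ _ (\sum_j w' j * hi)).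
  apply: ler_sum => j _; rewrite !cmodM cmod_cis mul1r cmod_real ger0_norm //.
  by rewrite ler_wpM2l.
by rewrite -mulr_suml ler_piMl.
Qed.

Variables (N b' e : nat) (a A c1 c2 c1' c2' : R).
Local Notation b := (b' + 22)%N.
Hypotheses (c1_ge0 : 0 <= c1) (c2_ge0 : 0 <= c2) (c1'_ge0 : 0 <= c1').
Hypotheses (a_gt0 : 0 < a) (A_gt0 : 0 < A).
Hypotheses (d_gt0 : (0 < d)%N) (d_le : (d <= N)%N) (N_ge : (100 <= N)%N).
Hypothesis b_large : c1 + 5 * c2 + 15 <= b%:R * (c2' - c2).
Hypothesis e_large : c1 + (b + 5)%:R * c2 + 15 <= e%:R.
Hypothesis N_large : 6 + A <= a * N%:R.
Hypothesis sfd : SFD a c1 c2 D.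
Hypothesis ffd : forall j, FFD A c1' c2' (D' j).

(** In units of [h], a coordinate of a grid frequency is at most
    [2 * L * (2 * N ^ 2 + 1) + 1 <= L * N ^ 4] with [L = long_window]. *)
Definition max_freq : nat := N ^ (b + 12).

Lemma grid_freq_integer (z : 'I_d -> nat) s eo : (forall l, z l <= 2 * N ^ 2 + 1)%N ->
  (s < long_window N b')%N -> offset eo ->
  exists f : {ffun 'I_d -> 'I_max_freq.+1},
    grid_freq (step_h N) (long_window N b') (\row_l (z l)%:R) s eo =
      integer_freq (step_h N) f :> 'rV[R]_d /\
    forall l, (long_window N b' * z l <= f l)%N.
Proof.
move=> zle sL off.
have [q [q1 eq]] : exists q : 'I_d -> nat, (forall l, q l <= 1)%N /\ eo = \row_l (q l)%:R.
  case: off => [->|[i ->]].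
    by exists (fun=> 0%N); split=> //; apply/rowP => l; rewrite !mxE.
  exists (fun l => (l == i) : nat); split=> [l|]; first by case: (l == i).
  by apply/rowP => l; rewrite !mxE eqxx.
have N0 : (0 < N)%N by exact: leq_trans N_ge.
have lt l : ((long_window N b' + s) * z l + q l < max_freq.+1)%N.
  rewrite ltnS; set L := long_window N b'.
  have -> : max_freq = (L * N ^ 4)%N.
    have e12 : (b + 12 = 8 + b + 4)%N by rewrite [RHS]addnAC addnC.
    by rewrite /max_freq /L /long_window -expnD e12.
  have L0 : (0 < L)%N by rewrite expn_gt0 N0.
  have : ((L + s) * z l <= (2 * L) * (2 * N ^ 2 + 1))%N by rewrite leq_mul // mul2n -addnn leq_add2l ltnW.
  have := q1 l; have : (N ^ 4 = N ^ 2 * N ^ 2)%N by rewrite -expnD.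
  have : (100 * 100 <= N ^ 2)%N by rewrite expnS expn1 leq_mul.
  nia.
exists [ffun l => Ordinal (lt l)]; split=> [|l].
  rewrite /grid_freq /integer_freq eq; congr (_ *: _); apply/rowP => l.
  rewrite !mxE ffunE.
  by rewrite [RHS](_ : _ = ((long_window N b' + s) * z l + q l)%:R) // [RHS]natrD natrM.
by rewrite ffunE /= mulnDl -addnA leq_addr.
Qed.

(** A coordinate of size at least [N ^ b] bounds the norm from below, where FFD is applied; [d <= N]
    coordinates of size at most [N ^ (b + 4)] bound it by [N ^ (b + 5)], where SFD is applied. *)
Lemma oracle_ratio_approx n (x : 'I_n -> 'rV[R]_d) (z : 'I_d -> nat) s eo :
  (forall f : {ffun 'I_d -> 'I_max_freq.+1},
     cmod (empirical_charfun x (integer_freq (step_h N) f)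
           - mixcf (integer_freq (step_h N) f)) <= 6 * (N ^ e)%:R^-1) ->
  (forall l, 0 < z l <= 2 * N ^ 2 + 1)%N -> (s < long_window N b')%N -> offset eo ->
  cmod (oracle_ratio (charfun D) N b' x (\row_l (z l)%:R) s eo - \sum_j (w j)%:C%C *
    cis (dotp (grid_freq (step_h N) (long_window N b') (\row_l (z l)%:R) s eo) (mu j)))
    <= (N ^ 14)%:R^-1.
Proof.
move=> approx zle sL off.
have [f [ef fl]] : exists f : {ffun 'I_d -> 'I_max_freq.+1},
    grid_freq (step_h N) (long_window N b') (\row_l (z l)%:R) s eo =
      integer_freq (step_h N) f :> 'rV[R]_d /\
    forall l, (long_window N b' * z l <= f l)%N.
  by apply: grid_freq_integer => // l; case/andP: (zle l).
have N0 : (0 < N)%N by exact: leq_trans N_ge.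
have X1 : 1 <= N%:R :> R by rewrite ler1n.
have hE j : (8 <= j)%N -> step_h N * (N ^ j)%:R = (N ^ (j - 8))%:R :> R.
  move=> j8; rewrite -[in LHS](subnKC j8) expnD natrM mulrA mulVf ?mul1r //.
  by rewrite gt_eqF // ltr0n expn_gt0 N0.
have h0 : 0 < step_h N :> R by rewrite invr_gt0 ltr0n expn_gt0 N0.
have tl l : (integer_freq (step_h N) f) 0 l = step_h N * (f l)%:R by rewrite !mxE.
have low : (N ^ b)%:R <= norm2 (integer_freq (step_h N) f) :> R.
  have l0 : 'I_d := Ordinal d_gt0.
  apply: le_trans (le_norm2 _ l0); rewrite tl ger0_norm ?mulr_ge0 ?(ltW h0) //.
  have -> : (N ^ b)%:R = step_h N * (N ^ (8 + b))%:R :> R by rewrite hE // addKn.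
  rewrite ler_pM2l // ler_nat; apply: leq_trans (fl l0).
  by rewrite -[X in (X <= _)%N]muln1 leq_mul2l; case/andP: (zle l0) => ->; rewrite orbT.
have high : norm2 (integer_freq (step_h N) f) <= (N ^ (b + 5))%:R :> R.
  apply: (le_trans (norm2_le_sum _)).
  apply: (@le_trans _ _ (\sum_(l < d) (N ^ (b + 4))%:R)).
    apply: ler_sum => l _; rewrite tl ger0_norm ?mulr_ge0 ?(ltW h0) //.
    have -> : (N ^ (b + 4))%:R = step_h N * (N ^ (b + 12))%:R :> R.
      by rewrite hE ?(leq_trans _ (leq_addl _ _)) // -(addnBA b (isT : 8 <= 12)%N).
    by rewrite ler_pM2l // ler_nat -ltnS.
  rewrite sumr_const card_ord -[leLHS]mulr_natl -natrM ler_nat.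
  by rewrite (_ : (b + 5 = (b + 4).+1)%N) ?expnS ?leq_mul2r ?d_le ?orbT // addnS.
have T1 j : 1 <= (N ^ j)%:R :> R by rewrite ler1n expn_gt0 N0.
rewrite /oracle_ratio ef.
have lo0 : 0 < a * d%:R `^ (- c1) * (N ^ (b + 5))%:R `^ (- c2).
  by rewrite !mulr_gt0 ?powR_gt0 ?ltr0n // expn_gt0 N0.
apply: (le_trans (ratio_error (approx f) lo0 (SFD_lower sfd (T1 _) high) _ (fun j => FFD_upper (ffd j) (T1 _) low))).
  by rewrite !mulr_ge0 ?powR_ge0 // ltW.
rewrite ler_pdivrMr //; exact: noise_level.
Qed.

End Ratio.

(** * Sample size *)

Import -(notations) mpoly.

Lemma total_degreeX (R : realType) (p : mpoly 5 R) m :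
  (mmeasure mdeg p <= 2)%N -> (total_degree (p ^+ m) <= m)%N.
Proof.
move=> p2; rewrite /total_degree -subn1 leq_subLR add1n.
have [->|p0] := eqVneq p 0; first by rewrite expr0n; case: m => [|m]; rewrite ?msize1 ?mmeasure0.
elim: m => [|m IH]; first by rewrite expr0 msize1.
by rewrite exprS msizeM ?expf_neq0 // -subn1 leq_subLR add1n (leq_trans (leq_add p2 IH)).
Qed.

(** The final 1 pays for rounding up to an integer. The constants of SFD and FFD enter through [K]
    only, so the degree of a power depends on its exponent alone. *)
Definition size_base (R : realType) (K : nat) : mpoly 5 R :=
  mpolyC 5 (K%:R : R) * (1 + \sum_(i < 5) mpolyX R (mnm1 i)) + 1.

Lemma size_base_degree (R : realType) K : (mmeasure mdeg (size_base R K) <= 2)%N.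
Proof.
apply: leq_trans (mmeasureD_le _ _ _) _; rewrite geq_max mmeasure1 andbT mul_mpolyC.
apply: leq_trans (mmeasureZ_le _ _ _) _.
apply: leq_trans (mmeasureD_le _ _ _) _; rewrite geq_max mmeasure1 /=.
apply: leq_trans (mmeasure_sum _ _ _ _) _; apply/bigmax_leqP => i _.
by rewrite mmeasureX /= mdeg1.
Qed.

Lemma sample_polyX (R : realType) d k (mu : 'I_k -> 'rV[R]_d) (w : 'I_k -> R) eps K m :
  sample_poly (size_base R K ^+ m) mu w eps =
    (K%:R * (1 + (d%:R + fine (separation mu)^-1%E + max_norm mu +
      (min_weight w)^-1 + eps^-1)) + 1) ^+ m.
Proof.
rewrite /sample_poly rmorphXn /= mevalD mevalM mevalC mevalD !meval1; congr ((_ * (1 + _) + 1) ^+ m).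
rewrite raddf_sum /= !big_ord_recr big_ord0 /= !mevalXU /= add0r.
by [].
Qed.

(** * Soundness and completeness of the rounds for a good sample *)

Section Recovery.
Context {R : realType} {d k k' : nat}.
Variables (D : probability (borelRd R d) R) (D' : 'I_k' -> probability (borelRd R d) R).
Variables (mu : 'I_k -> 'rV[R]_d) (mu' : 'I_k' -> 'rV[R]_d).
Variables (w : 'I_k -> R) (w' : 'I_k' -> R).
Hypotheses (w'_ge0 : forall j, 0 <= w' j).
Hypotheses (w_sum : \sum_j w j <= 1) (w'_sum : \sum_j w' j <= 1).
Variables (N b' e : nat) (a A c1 c2 c1' c2' : R).
Local Notation b := (b' + 22)%N.
Hypotheses (c1_ge0 : 0 <= c1) (c2_ge0 : 0 <= c2) (c1'_ge0 : 0 <= c1').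
Hypotheses (a_gt0 : 0 < a) (A_gt0 : 0 < A).
Hypotheses (d_gt0 : (0 < d)%N) (d_le : (d <= N)%N) (N_ge : (100 <= N)%N).
Hypothesis b_large : c1 + 5 * c2 + 15 <= b%:R * (c2' - c2).
Hypothesis e_large : c1 + (b + 5)%:R * c2 + 15 <= e%:R.
Hypothesis N_large : 6 + A <= a * N%:R.
Hypothesis sfd : SFD a c1 c2 D.
Hypothesis ffd : forall j, FFD A c1' c2' (D' j).
Hypothesis mu_bound : forall j l, `|mu j 0 l| <= N%:R.
Hypothesis w_low : forall j, N%:R^-1 <= w j.
Variables (n : nat) (x : 'I_n -> 'rV[R]_d) (u : nat -> R).
Hypothesis approx : forall f : {ffun 'I_d -> 'I_(max_freq N b').+1},
  cmod (empirical_charfun x (integer_freq (step_h N) f) -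
    mix_charfun (part_weight w w') (part_law D D') (part_mean mu mu')
      (integer_freq (step_h N) f)) <= 6 * (N ^ e)%:R^-1.

Local Notation v := (@round_direction R d u N).

Let v_bound r l : 0 <= v r 0 l <= (N ^ 3)%:R.
Proof.
rewrite mxE ler0n ler_nat /=; apply: leq_trans (ltn_ord _) _.
have N2 : (0 < N ^ 2)%N by rewrite expn_gt0; apply/orP; left; exact: leq_trans N_ge.
rewrite /draws [leqRHS]expnS; apply: (@leq_trans (3 * N ^ 2)).
  by rewrite ltn_pmul2r.
by rewrite leq_mul2r (leq_trans _ N_ge) ?orbT.
Qed.

Let round_approx r s eo : (s < long_window N b')%N -> offset eo ->
  cmod (oracle_ratio (charfun D) N b' x (v r) s eo - \sum_(j < k) (w j)%:C%C *
    cis (dotp (grid_freq (step_h N) (long_window N b') (v r) s eo) (mu j)))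
    <= (N ^ 14)%:R^-1.
Proof.
apply: (oracle_ratio_approx w'_ge0 w'_sum c1_ge0 c2_ge0 c1'_ge0 a_gt0 A_gt0 d_gt0 d_le
  N_ge b_large e_large N_large sfd ffd approx (z := fun l => (level _ _).+1)) => l.
by rewrite /= addn1 ltn_ord.
Qed.

Lemma round_accurate r s : size (round_peaks (charfun D) u k b' x N r) = k ->
  reads_off (charfun D) u k b' x N r s ->
  exists p : {perm 'I_k}, forall j, norm2 (mu j - out_mean d s (p j)) <= N%:R^-1 /\
    `|w j - out_weight s (p j)| <= N%:R^-1.
Proof.
move=> rk ro.
have [p pP] := peaks_accurate N_ge d_le (v_bound r) mu_bound w_low w_sum (@round_approx r) rk.
by exists p => j; have [-> ->] := ro (p j); exact: pP.
Qed.

Lemma round_complete r :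
  (forall j c, j != c -> (2 * N ^ 2)%:R^-1 <= `|dotp (v r) (mu j) - dotp (v r) (mu c)|) ->
  size (round_peaks (charfun D) u k b' x N r) = k.
Proof.
exact: (peaks_complete N_ge d_le (v_bound r) mu_bound w_low w_sum (@round_approx r)).
Qed.

End Recovery.

(** * Failure probabilities *)

Section SampleSize.
Context {R : realType}.
Variables (n d N b' e : nat) (delta : R).
Hypotheses (N_ge : (100 <= N)%N) (d_le : (d <= N)%N) (delta01 : 0 < delta < 1).
Hypothesis fN : fits n (b' + 37 + 2 * e) delta N.

Let lam : R := ln (1%:R / delta).

Let lam_ge0 : 0 <= lam.
Proof. by rewrite ln_ge0 // div1r; case/andP: delta01 => d0 /ltW; rewrite invf_ge1. Qed.

(** The left side is [delta / e], so the exponent [1 + lam] is a common target for both failure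
    probabilities. *)
Let half_delta : expR (- (lam + 1)) <= delta / 2.
Proof.
have /andP[d0 _] := delta01.
rewrite opprD expRD /lam div1r lnV ?posrE // opprK lnK ?posrE // ler_pM2l //.
by rewrite expRN lef_pV2 ?posrE ?expR_gt0 // -[leLHS]/(1 + 1) expR_ge1Dx.
Qed.

(** The exponent of [fits] splits into three: [N ^ (b' + 35)] dominates the logarithm of the number
    of frequencies, [N ^ (2 * e)] is the inverse square of the accuracy, and [N ^ 2 >= 10000] covers
    numerical constants. *)
Let size_large : (N ^ 2 * N ^ (b' + 35) * (N ^ e) ^ 2)%:R * (1 + lam) <= 2 * n%:R.
Proof.
have -> : (N ^ 2 * N ^ (b' + 35) * (N ^ e) ^ 2 = N ^ (b' + 37 + 2 * e))%N.
  by rewrite -expnM -!expnD; congr (_ ^ _)%N; clear; lia.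
have /andP[] := fN; rewrite -(ler_nat R) -/lam; lra.
Qed.

(** From [1 / 2 <= exp (- 1 / 2)], as [n] is at least [2 * (1 + lam)]. *)
Lemma direction_failure : 2^-1 ^+ n <= delta / 2.
Proof.
apply: le_trans half_delta.
have h : 2^-1 <= expR (- 2^-1) :> R by have := expR_ge1Dx (- 2^-1 : R); lra.
apply: (@le_trans _ _ (expR (- 2^-1) ^+ n)).
  by rewrite lerXn2r ?nnegrE ?expR_ge0 // invr_ge0.
rewrite -expRM_natl ler_expR.
have : 4 <= (N ^ 2 * N ^ (b' + 35) * (N ^ e) ^ 2)%:R :> R.
  rewrite ler_nat -mulnA -[4%N]muln1 leq_mul ?muln_gt0 ?expn_gt0 ?(leq_trans _ N_ge) //.
  by rewrite -[4%N]/(2 ^ 2)%N leq_exp2r // (leq_trans _ N_ge).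
by move: size_large lam_ge0; nra.
Qed.

(** The lattice has [(Z + 1) ^ d <= exp (d * Z)] points with [d * Z <= N ^ (b' + 35)]; this generous
    bound on its logarithm only costs a power of [N]. *)
Lemma sampling_failure :
  ((max_freq N b').+1 ^ d)%:R * (4 * expR (- (n%:R * (N ^ e)%:R^-1 ^+ 2 / 16)))
    <= delta / 2.
Proof.
apply: le_trans half_delta.
set Z := max_freq N b'; pose P : R := (N ^ (b' + 35))%:R; pose Y : R := (N ^ e)%:R ^+ 2.
have Y0 : 0 < Y by rewrite exprn_gt0 // ltr0n expn_gt0 (leq_trans _ N_ge).
have P1 : 1 <= P by rewrite ler1n expn_gt0 (leq_trans _ N_ge).
have hZ : (Z.+1 ^ d)%:R <= expR P.
  apply: (@le_trans _ _ (expR Z%:R ^+ d)).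
    rewrite natrX lerXn2r ?nnegrE ?expR_ge0 // -natr1 addrC; exact: expR_ge1Dx.
  rewrite -expRM_natl ler_expR -natrM ler_nat /Z /max_freq.
  have -> : (b' + 35 = (b' + 22 + 12).+1)%N by lia.
  by rewrite expnS leq_mul2r d_le orbT.
have h4 : 4 <= expR 3 :> R by have := expR_ge1Dx (3 : R); lra.
apply: (@le_trans _ _ (expR P * (expR 3 * expR (- (n%:R * (N ^ e)%:R^-1 ^+ 2 / 16))))).
  by rewrite ler_pM ?mulr_ge0 ?expR_ge0 // ler_wpM2r ?expR_ge0.
rewrite -!expRD ler_expR exprVn -/Y.
have big : (10000 * P * Y) * (1 + lam) <= 2 * n%:R.
  apply: le_trans size_large; rewrite ler_wpM2r ?addr_ge0 // natrM [((N ^ e) ^ 2)%:R]natrX -/Y natrM -/P.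
  rewrite ler_pM2r // ler_pM2r; last lra.
  have N100 : 100 <= N%:R :> R by rewrite ler_nat.
  rewrite natrX; nra.
have : 300 * (P * (1 + lam)) <= n%:R / Y / 16.
  rewrite ler_pdivlMr // ler_pdivlMr //.
  have : 0 <= P * Y * (1 + lam) by rewrite !mulr_ge0 ?addr_ge0 // ltW.
  move: big; nra.
have : 0 <= (P - 1) * lam by rewrite mulr_ge0 // subr_ge0.
move: lam_ge0 P1; lra.
Qed.

End SampleSize.

(** If all coordinates were below [N ^ -2], the norm would be below [d * N ^ -2 <= 1 / N], hence
    below the separation. *)
Lemma separated_coordinate (R : realType) d k (mu : 'I_k -> 'rV[R]_d) (N : nat) :
  (0 < d <= N)%N -> (0 < separation mu)%E -> fine (separation mu)^-1%E <= N%:R ->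
  forall j c, j != c -> exists l, 2 * (2 * N ^ 2)%:R^-1 <= `|(mu j - mu c) 0 l|.
Proof.
move=> /andP[d0 dN] sep0 sepN j c jc.
have N0 : 0 < N%:R :> R by rewrite ltr0n (leq_trans d0).
have le1 : (separation mu <= (norm2 (mu j - mu c))%:E)%E.
  by apply: (bigmin_le_cond +oo%E (j := (j, c)) (fun p => (norm2 (mu p.1 - mu p.2))%:E)).
have low : N%:R^-1 <= norm2 (mu j - mu c).
  case: (separation mu) sep0 sepN le1 => [g| |] //.
  rewrite lte_fin lee_fin => g0; rewrite inver gt_eqF //= => gN; apply: le_trans.
  by rewrite -[leRHS]invrK lef_pV2 // posrE invr_gt0.
have [//|no] := pselect (exists l, 2 * (2 * N ^ 2)%:R^-1 <= `|(mu j - mu c) 0 l|).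
have small l : `|(mu j - mu c) 0 l| < (N%:R ^+ 2)^-1.
  rewrite ltNge; apply/negP => h; apply: no; exists l.
  by rewrite natrM invfM mulrA mulfV ?pnatr_eq0 // mul1r natrX.
have : norm2 (mu j - mu c) < N%:R^-1.
  apply: le_lt_trans (norm2_le_sum _) _.
  apply: (@lt_le_trans _ _ (\sum_(l < d) (N%:R ^+ 2)^-1)).
    by apply: ltr_sum => //; apply/hasP; exists (Ordinal d0).
  rewrite sumr_const card_ord -[leLHS]mulr_natl expr2 invfM mulrA.
  by rewrite ler_piMl ?invr_ge0 ?ler0n // ler_pdivrMr // mul1r ler_nat.
by rewrite ltNge low.
Qed.

(** The number of components is not among the variables of the sample-size polynomial; it is
    controlled through [1 / w_min]. *)
Lemma card_le_min_weight (R : realType) k (w : 'I_k -> R) :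
  \sum_j w j <= 1 -> 0 < min_weight w -> k%:R <= (min_weight w)^-1.
Proof.
move=> w1 wm; rewrite -[leRHS]mul1r ler_pdivlMr //; apply: le_trans w1.
apply: (@le_trans _ _ (\sum_(j < k) min_weight w)).
  by rewrite sumr_const card_ord mulr_natl.
by apply: ler_sum => j _; exact: bigmin_le.
Qed.

Lemma fine_inv_ge0 (R : realType) (x : \bar R) : (0 < x)%E -> 0 <= fine x^-1%E.
Proof. by case: x => [r| |] //; rewrite ?invey ?lte_fin // => r0; rewrite inver gt_eqF //= invr_ge0 ltW. Qed.

Theorem theorem3p4 (R : realType) :
  exists q : {poly R},
  forall c1 c2 c1' c2' : R, 0 <= c1 -> 0 <= c2 -> 0 <= c1' -> 0 <= c2' ->
    c2 < c2' ->
  exists deg : nat,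
  forall a A : R, 0 < a -> 0 < A ->
  exists (p : mpoly.mpoly 5 R) (prog : program),
  (total_degree p <= deg)%N /\
  forall (d k k' : nat)
    (D : probability (borelRd R d) R)
    (D' : 'I_k' -> probability (borelRd R d) R)
    (mu : 'I_k -> 'rV[R]_d) (mu' : 'I_k' -> 'rV[R]_d)
    (w : 'I_k -> R) (w' : 'I_k' -> R),
  (0 < d)%N -> (0 < k)%N ->
  (forall j, 0 <= w j) -> (forall j, 0 <= w' j) ->
  \sum_(j < k) w j + \sum_(j < k') w' j = 1 ->
  centered D -> (forall j, centered (D' j)) ->
  SFD a c1 c2 D -> (forall j, FFD A c1' c2' (D' j)) ->
  (0 < separation mu)%E -> 0 < min_weight w ->
  forall (eps delta : R) (n : nat), 0 < eps < 1 -> 0 < delta < 1 ->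
  sample_poly p mu w eps * Num.max 1 (ln delta^-1) <= n%:R ->
  (forall (x : 'I_n -> 'rV[R]_d) (u : nat -> R), (forall j, 0 <= u j <= 1) ->
     exists (t : nat) (s : state),
       exec (charfun D) u prog (input k eps delta x) t s /\ t%:R <= q.[n%:R]) /\
  (forall (dO : measure_display) (Omega : measurableType dO)
     (Pr : probability Omega R)
     (X : 'I_n -> {RV Pr >-> borelRd R d}) (U : nat -> {RV Pr >-> R}),
   iid_with_uniforms (mixture D D' mu mu' w w') X U ->
   exists E : set Omega,
     [/\ measurable E, ((1 - delta)%:E <= Pr E)%E &
       forall o, E o -> exists (t : nat) (s : state),
         exec (charfun D) (fun j => U j o) prog
           (input k eps delta (fun i => X i o)) t s /\
         accurate eps mu w (out_mean d s) (@out_weight R k s)]).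
Proof.
exists (300%:R *: 'X^6) => c1 c2 c1' c2' c1_ge0 c2_ge0 c1'_ge0 _ gap.
(* The strict gap [c2 < c2'] provides a power of [N] at which the FFD bound lies below the SFD bound
   by the required margin. *)
have [b' b_large] : exists b', c1 + 5 * c2 + 15 <= (b' + 22)%:R * (c2' - c2).
  pose y := (c1 + 5 * c2 + 15) / (c2' - c2).
  have y0 : 0 <= y by rewrite divr_ge0 //; lra.
  exists (Num.bound y); rewrite -ler_pdivrMr ?subr_gt0 // -/y natrD.
  by apply: (le_trans (ltW (archi_boundP y0))); rewrite lerDl.
have [e e_large] : exists e, c1 + (b' + 22 + 5)%:R * c2 + 15 <= e%:R.
  exists (Num.bound (c1 + (b' + 22 + 5)%:R * c2 + 15)); apply/ltW/archi_boundP.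
  by rewrite !addr_ge0 ?mulr_ge0.
(* The degree is fixed from the exponents alone, before [a] and [A] are given. *)
pose m := (b' + 37 + 2 * e)%N; exists m => a A a0 A0.
have m0 : (0 < m)%N by rewrite /m; lia.
have bm : (b' + 30 <= m)%N by rewrite /m; lia.
have [K K100 K_large] : exists2 K, (100 <= K)%N & 6 + A <= a * K%:R.
  exists (100 + Num.bound ((6 + A) / a))%N; first exact: leq_addr.
  have y0 : 0 <= (6 + A) / a by rewrite divr_ge0 ?addr_ge0 ?ltW.
  rewrite mulrC -ler_pdivrMr // natrD; apply: (le_trans (ltW (archi_boundP y0))).
  by rewrite lerDr.
exists (size_base R K ^+ m), (main_prog b' m).
split; first exact/total_degreeX/size_base_degree.
move=> d k k' D D' mu mu' w w' d0 k0 w0 w'0 W1 _ _ sfd ffd sep wmin eps delta n.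
move=> /andP[eps0 eps1] delta01; rewrite sample_polyX => nP.
have w1 : \sum_j w j <= 1 by rewrite -W1 lerDl sumr_ge0.
have w'1 : \sum_j w' j <= 1 by rewrite -W1 lerDr sumr_ge0.
have [N fN maxN] := @fits_max R n m delta m0.
set S : R := d%:R + _ + _ + _ + _ in nP.
have s0 := fine_inv_ge0 sep.
have B0 : 0 <= max_norm mu by exact: bigmax_ge_id.
have wi0 : 0 <= (min_weight w)^-1 by rewrite invr_ge0 ltW.
have ei0 : 0 <= eps^-1 by rewrite invr_ge0 ltW.
have S0 : 0 <= S by rewrite !addr_ge0.
have d_ge0 : 0 <= d%:R :> R by [].
(* The integer just above [K * (1 + S)] is at most the base of the polynomial, so it fits, and the
   maximal [N] is at least that integer. *)
have KSN : K%:R * (1 + S) <= N%:R.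
  have y0 : 0 <= K%:R * (1 + S) by rewrite mulr_ge0 ?addr_ge0.
  have /andP[y1 y2] := truncn_itv y0.
  apply: (le_trans (ltW y2)); rewrite ler_nat; apply: maxN; apply/andP.
  set Pi := K%:R * (1 + S) + 1 in nP *.
  have T : (((Num.truncn (K%:R * (1 + S))).+1 ^ m)%:R <= Pi ^+ m)%R.
    by rewrite natrX lerXn2r ?nnegrE ?addr_ge0 // -natr1 lerD2r.
  have Pi0 : 0 <= Pi ^+ m by rewrite exprn_ge0 // addr_ge0.
  split.
    rewrite -(ler_nat R); apply: (le_trans T); apply: le_trans nP.
    by rewrite ler_peMr // le_max lexx.
  apply: le_trans nP; rewrite div1r; apply: ler_pM => //; last by rewrite le_max lexx orbT.
  by rewrite ln_ge0 //; case/andP: delta01 => h /ltW; rewrite invf_ge1.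
have K1 : 1 <= K%:R :> R by rewrite ler1n (leq_trans _ K100).
have SN : S <= N%:R by apply: le_trans KSN; move: K1 S0; clear; nra.
have KN : (K <= N)%N by rewrite -(ler_nat R); apply: le_trans KSN; move: K1 S0; clear; nra.
have N100 := leq_trans K100 KN.
have N0 : 0 < N%:R :> R by rewrite ltr0n (leq_trans _ N100).
have dN : (d <= N)%N by rewrite -(ler_nat R); apply: le_trans SN; rewrite /S; move: s0 B0 wi0 ei0; clear; lra.
have sN : fine (separation mu)^-1%E <= N%:R.
  by apply: le_trans SN; rewrite /S; move: d_ge0 s0 B0 wi0 ei0; clear; lra.
have BN : max_norm mu <= N%:R.
  by apply: le_trans SN; rewrite /S; move: d_ge0 s0 B0 wi0 ei0; clear; lra.
have wN : (min_weight w)^-1 <= N%:R.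
  by apply: le_trans SN; rewrite /S; move: d_ge0 s0 B0 wi0 ei0; clear; lra.
have eN : eps^-1 <= N%:R.
  by apply: le_trans SN; rewrite /S; move: d_ge0 s0 B0 wi0 ei0; clear; lra.
have kN : (k <= N)%N.
  by rewrite -(ler_nat R) (le_trans _ wN) // card_le_min_weight.
have Nn : (N <= n)%N := fits_le_n m0 fN.
have n0 : (0 < n)%N by apply: leq_trans Nn; exact: leq_trans N100.
have time : (@main_time d n k b' N <= 300 * n ^ 6)%N.
  apply: main_time_le bm fN n0 _ _.
  - exact: leq_trans dN Nn.
  - exact: leq_trans kN Nn.
have run := fun x u => runs_main (charfun D) u b' x eps m0 delta01 k0 fN maxN.
split=> [x u _|dO Omega Pr X U iid].
  have [t [s [ex tl _]]] := run x u; exists t, s; split=> //.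
  by rewrite hornerZ hornerXn -natrX -natrM ler_nat (leq_trans tl).
have W_ge0 j : 0 <= part_weight w w' j by case: j.
have W_sum : \sum_j part_weight w w' j = 1 by rewrite sum_part_weight.
have QE (C : set (borelRd R d)) (_ : measurable C) := mixtureE D D' mu mu' w w' C.
have Q1 : mixture D D' mu mu' w w' setT = 1%E.
  rewrite mixtureE (eq_bigr (fun j => (part_weight w w' j)%:E)).
    by rewrite sumEFin W_sum.
  by move=> j _; rewrite /translate /pushforward preimage_setT probability_setT mule1.
have eta01 : 0 < ((N ^ e)%:R^-1 : R) <= 1.
  have Ne : (0 < N ^ e)%N by rewrite expn_gt0 (leq_trans _ N100).
  by rewrite invr_gt0 ltr0n Ne invf_le1 ?ler1n ?ltr0n.
have [B1 [mB1 PB1 good1]] :=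
  uniform_concentration W_ge0 W_sum QE (@integer_freq R (step_h N) d (max_freq N b')) iid n0 eta01.
have M0 : (0 < 2 * N ^ 2)%N by rewrite muln_gt0 expn_gt0 (leq_trans _ N100).
have kM : (2 * k ^ 2 <= 2 * N ^ 2)%N by rewrite leq_mul2l leq_exp2r.
have tau0 : 0 < (2 * N ^ 2)%:R^-1 :> R by rewrite invr_gt0 ltr0n.
have dN' : (0 < d <= N)%N by rewrite d0.
have [B2 [mB2 PB2 good2]] := random_directions n iid Q1 d0 M0
  (direction_separates M0 kM tau0 (separated_coordinate dN' sep sN)).
(* Half of [delta] goes to the sample and half to the directions; the event for the sample is valid
   for all directions at once. *)
exists (~` (B1 `|` B2)); split; first by apply: measurableC; exact: measurableU.
  rewrite probability_setC; last exact: measurableU.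
  rewrite EFinB leeB // (le_trans (measureU2 _ _ _)) //.
  rewrite [delta]splitr EFinD; apply: leeD.
    apply: (le_trans PB1); rewrite lee_fin card_ffun !card_ord.
    exact: (sampling_failure N100 dN delta01 fN).
  by apply: (le_trans PB2); rewrite lee_fin; exact: (direction_failure N100 delta01 fN).
move=> o /not_orP[/good1 approx /good2[r rn sepr]].
set x := fun i => X i o in approx; set u := fun j => U j o in sepr.
have mu_bound j l : `|mu j 0 l| <= N%:R.
  apply: (le_trans (le_norm2 _ _)); apply: le_trans BN.
  exact: (le_bigmax 0 (fun j => norm2 (mu j))).
have w_low j : N%:R^-1 <= w j.
  apply: (@le_trans _ _ (min_weight w)); last exact: bigmin_le.
  by rewrite -[leRHS]invrK lef_pV2 // posrE invr_gt0.
have N_large : 6 + A <= a * N%:R.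
  by apply: (le_trans K_large); rewrite ler_pM2l // ler_nat.
have rk : size (round_peaks (charfun D) u k b' x N r) = k.
  apply: (round_complete w'0 w1 w'1 c1_ge0 c2_ge0 c1'_ge0 a0 A0 d0 dN N100 b_large
    e_large N_large sfd ffd mu_bound w_low approx) => j c jc.
  move: sepr; rewrite negb_exists => /forallP/(_ j).
  rewrite negb_exists => /forallP/(_ c); rewrite jc /= -leNgt.
  rewrite (_ : \row_l _ = round_direction u N r) //.
  by apply/rowP => l; rewrite !mxE ffunE.
have [t [s [ex _ H]]] := run x u; exists t, s; split=> //.
(* The round [r'] that the program outputs may differ from the separating round [r]; being full is
   what makes it accurate. *)
have [r' rk' ro] := H (ex_intro2 _ _ r rn rk).
have [p pP] := round_accurate w'0 w1 w'1 c1_ge0 c2_ge0 c1'_ge0 a0 A0 d0 dN N100 b_large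
    e_large N_large sfd ffd mu_bound w_low approx rk' ro.
have Neps : N%:R^-1 <= eps by rewrite -[leRHS]invrK lef_pV2 // posrE invr_gt0.
exists p; split; apply: bigmax_le => [|j _]; rewrite ?(ltW eps0) //.
  by apply: le_trans Neps; case: (pP j).
by apply: le_trans Neps; case: (pP j).
Qed.
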